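(* The set $\mathscr{M} = \{D \in \mathscr{A}(\mathbb{C}_0) : \sigma_a(D) = \frac12\}$ is strongly $\aleph_0$-algebrable as a subset of $\mathscr{A}(\mathbb{C}_0)$. Also, there is a dense $G_\delta$ subset of $\mathscr{A}(\mathbb{C}_0)$ such that any of its elements generates a free algebra contained in $\mathscr{M} \cup \{0\}$.
   Context: $\mathbb{C}_0 = \{s \in \mathbb{C} : \mathrm{Re}\, s > 0\}$. A Dirichlet series is a series $D = \sum_{n=1}^\infty a_n n^{-s}$ with $a_n \in \mathbb{C}$; its abscissa of absolute convergence $\sigma_a(D) \in [-\infty,\infty]$ is the infimum of the $\sigma \in \mathbb{R}$ such that $D$ converges absolutely on $\{\mathrm{Re}\, s > \sigma\}$. A Dirichlet polynomial is a finite sum $\sum_{n=1}^N a_n n^{-s}$. $\mathscr{H}_\infty$ is the Banach algebra, with the supremum norm on $\mathbb{C}_0$, of all bounded holomorphic functions $f:\mathbb{C}_0 \to \mathbb{C}$ which can be represented as a Dirichlet series in some half-plane; $f$ is identified with its Dirichlet series. $\mathscr{A}(\mathbb{C}_0)$ is the closed subalgebra of $\mathscr{H}_\infty$ of all functions which are uniform limits on $\mathbb{C}_0$ of a sequence of Dirichlet polynomials; it carries the supremum norm. Let $\mathcal{A}$ be an algebra of complex-valued functions on a set and $\kappa$ a cardinal. A subset $Z \subset \mathcal{A}$ is strongly $\kappa$-algebrable if there is a subalgebra $\mathcal{B}$ of $\mathcal{A}$ which is generated by an algebraically independent set of generators of cardinality $\kappa$ and such that $\mathcal{B} \subset Z \cup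 \{0\}$. A set $X$ is algebraically independent if, for every $N$ and all distinct $x_1,\dots,x_N \in X$, the only polynomial $Q \in \mathbb{C}[z_1,\dots,z_N]$ with $Q(x_1,\dots,x_N) = 0$ is $Q = 0$. Subalgebras are not required to contain the unit: the subalgebra generated by a set $X$ consists of all $Q(x_1,\dots,x_N)$ with $x_i \in X$ and $Q$ a polynomial without constant term. An element $D$ generates a free algebra if $\{D\}$ is algebraically independent. *)

(* Defs.v *)
From HB Require Import structures.
From mathcomp Require Import all_boot all_order all_algebra.
From mathcomp Require Import complex.
From mathcomp Require Import -(notations) mpoly.
From mathcomp Require Import all_classical all_reals all_analysis.
From mathcomp Require Import borel_hierarchy.
Import numFieldNormedType.Exports.

Set Implicit Arguments.
Unset Strict Implicit.
Unset Printing Implicit Defensive.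

Import Order.TTheory GRing.Theory Num.Theory.
Local Open Scope classical_set_scope.
Local Open Scope ring_scope.

Section FunctionAlgebra.
Context {T : Type} {K : fieldType}.
Implicit Types (A B X Z : set (T -> K)).

Definition poly_eval n (Q : mpoly n K) (x : 'I_n -> T -> K) : T -> K :=
  fun t => meval (fun i => x i t) Q.

Definition algebraically_independent X :=
  forall n (x : 'I_n -> T -> K), injective x -> (forall i, X (x i)) ->
  forall Q : mpoly n K, poly_eval Q x = cst 0 -> Q = 0.

(* Subalgebras need not contain the constant function 1. *)
Definition subalgebra A B :=
  [/\ B `<=` A, B (cst 0),
      forall f g, B f -> B g -> B (f \+ g),
      forall f g, B f -> B g -> B (f \* g) &
      forall (c : K) f, B f -> B (fun t => c * f t)].

(* The condition on [mnm0] says that [Q] has no constant term. *)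
Definition generated_algebra X : set (T -> K) :=
  [set f | exists n (x : 'I_n -> T -> K) (Q : mpoly n K),
     [/\ forall i, X (x i), mcoeff mnm0 Q = 0 & f = poly_eval Q x]].

(* The cardinal is given by any set [kappa] having this cardinality. *)
Definition strongly_algebrable A U (kappa : set U) Z :=
  exists B, [/\ subalgebra A B,
    exists X, [/\ (X #= kappa)%card, algebraically_independent X &
                  B = generated_algebra X] &
    B `<=` Z `|` [set cst 0]].

Definition generates_free_algebra (f : T -> K) :=
  algebraically_independent [set f].

End FunctionAlgebra.

(* [R[i]] itself carries no topology: packed as a closed field, it inherits  *)
(* the one defined by its norm.                                              *)
Definition cplx (R : realType) : numClosedFieldType := R[i].

Section Dirichlet.
Context {R : realType}.
Local Notation C := (cplx R).
Implicit Types (a : nat -> C) (s : C).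

Definition C0 : set C := [set s | 0 < complex.Re s].

Definition holomorphic (f : C0 -> C) :=
  forall s, C0 s -> derivable (valL_ 0 f) s 1.

(* n^{-s} = e^{- (Re s) ln n} (cos ((Im s) ln n) - i sin ((Im s) ln n)) *)
Definition npow (n : nat) s : C :=
  let r := expR (- (complex.Re s * ln n%:R)) in
  let theta := complex.Im s * ln n%:R in
  Complex (r * cos theta) (- (r * sin theta)).

(* Coefficients are indexed from 0: [a n] is the coefficient of (n+1)^{-s}. *)
Definition dirichlet_term a s : nat -> C := fun n => a n * npow n.+1 s.

(* The coefficients of a Dirichlet series representing [f] are unique, which *)
(* is what lets a function be identified with its series in [calM].          *)
Definition represents a (f : C0 -> C) :=
  exists sigma : R, forall s : C0, sigma < complex.Re (\val s) ->
    series (dirichlet_term a (\val s)) @ \oo --> f s.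

Definition sigma_a a : \bar R :=
  ereal_inf [set sigma%:E | sigma in [set sigma : R |
    forall s, sigma < complex.Re s ->
      cvgn [normed series (dirichlet_term a s)]]].

Definition dirichlet_polynomial (p : C0 -> C) :=
  exists N a, forall s : C0, p s = series (dirichlet_term a (\val s)) N.

Definition Hinfty : set (C0 -> C) :=
  [set f | [/\ holomorphic f, bounded_fun f & exists a, represents a f]].

(* The topology of uniform convergence on [C0] is the one of the supremum    *)
(* norm, see [nbhs_AC0_supnorm]; as a type, [AC0] has the induced topology.  *)
Definition AC0 : set {uniform C0 -> C} :=
  [set f | Hinfty f /\
     exists P : nat -> C0 -> C,
       (forall k, dirichlet_polynomial (P k)) /\ {uniform, P @ \oo --> f}].

Definition calM : set (C0 -> C) :=
  [set f | AC0 f /\ exists2 a, represents a f & sigma_a a = (2^-1)%:E].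

Definition supnorm (f : C0 -> C) : R :=
  sup [set complex.Re `|f s| | s in [set: C0]].

Lemma nbhs_AC0_supnorm (f : AC0) (U : set AC0) :
  nbhs f U <->
  exists2 e : R, 0 < e &
    forall g : AC0, supnorm (fun s : C0 => (\val g : C0 -> C) s -
                                      (\val f : C0 -> C) s) < e -> U g.
Proof.
have bnd (h : AC0) : exists M : C, forall s : C0, `|(\val h : C0 -> C) s| <= M.
  have [[_ [M [_ HM]] _] _] : AC0 (\val h) by exact: (set_mem (valP h)).
  by exists (M + 1) => s; apply: HM => //; rewrite ltrDl ltr01.
have nrmC (z : C) : `|z| = ((complex.Re `|z|)%:C)%C :> R[i].
  by rewrite normc_def.
have ltC (x y : C) : (x < y) =
    (complex.Im y == complex.Im x) && (complex.Re x < complex.Re y).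
  exact: ltcE.
have leC (x y : C) : (x <= y) =
    (complex.Im y == complex.Im x) && (complex.Re x <= complex.Re y).
  exact: lecE.
have C0_1 : C0 1 by rewrite /C0 /= ltr01.
split.
- case=> W [[V oV <-] Vf VU].
  have /uniform_nbhs[E [entE EV]] : nbhs (\val f : {uniform C0 -> C}) V.
    by apply: open_nbhs_nbhs; split.
  move: entE; rewrite -entourage_ballE => -[eps eps_gt0 epsE].
  have eps0 : (0 : C) < eps := eps_gt0.
  exists (complex.Re eps); first by move: eps0; rewrite ltC => /andP[].
  move=> g ltg; apply: VU; apply: EV => s _; apply: epsE => /=.
  rewrite -ball_normE /= distrC nrmC.
  have -> : eps = ((complex.Re eps)%:C)%C :> R[i].
    move: eps0; rewrite ltC => /andP[/eqP /= i0 _].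
    by rewrite [LHS]complexE i0 mulr0 addr0.
  rewrite ltC /= eqxx /=.
  apply: le_lt_trans ltg; apply: ub_le_sup; last by exists s.
  have [M HM] := bnd g; have [N HN] := bnd f.
  exists (complex.Re (M + N)) => _ [t _ <-].
  have : `|(\val g : C0 -> C) t - (\val f : C0 -> C) t| <= M + N.
    by apply: le_trans (ler_normB _ _) _; exact: lerD.
  by rewrite leC => /andP[].
- case=> e e0 eU.
  have : nbhs (f : initial_topology (set_val : AC0 -> {uniform C0 -> C}))
    (set_val @^-1` [set h : {uniform C0 -> C} |
      forall s : C0, [set: C0] s -> ball ((\val f : C0 -> C) s)
        (((e / 2)%:C)%C : C) (h s)]).
    apply: initial_continuous; apply/uniform_nbhs.
    exists [set xy : C * C | ball xy.1 (((e / 2)%:C)%C : C) xy.2]; split => //.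
    rewrite -entourage_ballE; exists (((e / 2)%:C)%C : C) => //=.
    by rewrite ltC /= eqxx divr_gt0.
  apply: filterS => g /= Hg; apply: eU.
  apply: (@le_lt_trans _ _ (e / 2)); last first.
    by rewrite ltr_pdivrMr // ltr_pMr // ltr1n.
  apply: ge_sup.
    by eexists; exists (SigSub (mem_set C0_1)).
  move=> _ [s _ <-]; have := Hg s I.
  by rewrite -ball_normE /= distrC nrmC ltC /= eqxx /= => /ltW.
Qed.

End Dirichlet.
Arguments C0 : clear implicits.
Arguments Hinfty : clear implicits.
Arguments AC0 : clear implicits.
Arguments calM : clear implicits.

(* Main.v *)
Require Import Defs.
From HB Require Import structures.
From mathcomp Require Import all_boot all_order all_algebra.
From mathcomp Require Import cyclic separable cyclotomic.
From mathcomp Require Import complex.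
From mathcomp Require Import -(notations) mpoly.
From mathcomp Require Import -(notations) monalg.
From mathcomp Require Import finmap.
From mathcomp Require Import all_classical all_reals all_analysis.
From mathcomp Require Import borel_hierarchy.
From mathcomp Require Import ring lra zify.
Import numFieldNormedType.Exports.
Import Order.TTheory GRing.Theory Num.Theory.
Set Implicit Arguments.
Unset Strict Implicit.
Unset Printing Implicit Defensive.
Local Open Scope classical_set_scope.
Local Open Scope ring_scope.

(** The upper bound [sigma_a <= 1/2] holds on the whole algebra. By the Bessel
inequality [dpoly_bessel], the square sum of the coefficients of a Dirichlet
polynomial is at most the square of its supremum; the coefficients of a uniform
limit are therefore limits of coefficients, they are square summable, and the
Cauchy-Schwarz inequality gives absolute convergence above the abscissa 1/2
([sigma_a_le_half]). Membership in the algebra amounts to uniform approximability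
([AC0P]), for which one has to know that uniform limits of Dirichlet polynomials
are holomorphic: this follows from a Lipschitz estimate, obtained from a Cauchy
formula in which the circle is replaced by roots of unity.

The lower bound is a category argument. Say that [f] is generic if for every
polynomial expression [F] of positive degree in [f], with Dirichlet polynomials as
coefficients, and for every [sigma < 1/2], the sums of the [|a_k| * k^-sigma], for
[a_k] the coefficients of [F], are unbounded. Then [sigma_a F = 1/2] for all these
[F]. Dividing the expressions into countably many bounded families, and replacing
unboundedness by a condition on finitely many coefficients, one sees that generic
functions form a countable intersection of open sets, and only the density of each
of these has to be proved ([good_dense]).

Density rests on polynomials of norm 1 with large absolute sums
([large_dirichlet_polynomial]). As in the theorem of Bohnenblust and Hille they come
from products of Fourier matrices and of diagonal matrices whose entries are the
monomials of distinct primes; Chebyshev's lower bound for the number of primes makes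
the exponent 1/2 sharp. Given a Dirichlet polynomial [p0] near [f], one adds
[eta * r^-s * (1 + r'^-s * A)] with [A] such a polynomial and [r], [r'] primes that
do not occur in the data. In an expression of degree [d], the terms of degree [d] in
[r] and 1 in [r'] come only from the top coefficient times [A] ([marked_coef]),
whatever the other coefficients are; hence one perturbation serves a whole family of
expressions.

A generic [f] generates a free algebra inside the set in question, which is the
second assertion. For the first one, take one generic [f] and the functions
[p^-s * f] for all primes [p]: a polynomial in them is a polynomial in [f] with
Dirichlet polynomials as coefficients, and by unique factorisation these do not all
vanish ([mcomb_eq0]). *)

(** * The modulus of complex numbers *)

Section ComplexModulus.
Context {R : realType}.
Local Notation C := (cplx R).
Implicit Types (z w : C).

Definition cabs z : R := complex.Re `|z|.

Lemma cabsE z : `|z| = (cabs z)%:C%C.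
Proof. by rewrite /cabs normc_def. Qed.

Lemma cabs_ge0 z : 0 <= cabs z.
Proof. by rewrite -(lecR 0) -cabsE normr_ge0. Qed.

Lemma cabsM z w : cabs (z * w) = cabs z * cabs w.
Proof. by apply: (@complexI R); rewrite rmorphM /= -!cabsE normrM. Qed.

Lemma cabsD z w : cabs (z + w) <= cabs z + cabs w.
Proof. by rewrite -lecR rmorphD /= -!cabsE ler_normD. Qed.

Lemma cabsN z : cabs (- z) = cabs z.
Proof. by rewrite /cabs normrN. Qed.

Lemma cabsB z w : cabs (z - w) = cabs (w - z).
Proof. by rewrite /cabs distrC. Qed.

Lemma cabs0 : cabs 0 = 0.
Proof. by rewrite /cabs normr0. Qed.

Lemma cabs1 : cabs 1 = 1.
Proof. by rewrite /cabs normr1. Qed.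

Lemma cabs_eq0 z : (cabs z == 0) = (z == 0).
Proof. by rewrite -[z == 0]normr_eq0 cabsE -(inj_eq (@complexI R)). Qed.

Lemma cabs_gt0 z : (0 < cabs z) = (z != 0).
Proof. by rewrite lt0r cabs_ge0 andbT cabs_eq0. Qed.

Lemma cabsX z n : cabs (z ^+ n) = cabs z ^+ n.
Proof. by elim: n => [|n IH]; rewrite ?cabs1 // !exprS cabsM IH. Qed.

Lemma cabsV z : cabs z^-1 = (cabs z)^-1.
Proof. by apply: (@complexI R); rewrite fmorphV /= -!cabsE normfV. Qed.

Lemma cabs_dist z w : cabs z <= cabs w + cabs (z - w).
Proof. by rewrite -{1}(subrK w z) addrC; apply: le_trans (cabsD _ _) _. Qed.

Lemma cabs_distD v z w : cabs (z - w) <= cabs (z - v) + cabs (v - w).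
Proof. by rewrite -(subrK v z) -addrA subrK; exact: cabsD. Qed.

Lemma cabs_sum I (r : seq I) (P : pred I) (F : I -> C) :
  cabs (\sum_(i <- r | P i) F i) <= \sum_(i <- r | P i) cabs (F i).
Proof.
elim/big_rec2: _ => [|i y x _ h]; first by rewrite cabs0.
by apply: le_trans (cabsD _ _) _; rewrite lerD2l.
Qed.

Lemma cabs_real (x : R) : cabs (x%:C%C : C) = `|x|.
Proof. by rewrite /cabs normc_def /= expr0n /= addr0 sqrtr_sqr. Qed.

Lemma cabs_nat n : cabs n%:R = n%:R.
Proof.
by rewrite -[n%:R](rmorph_nat (real_complex R)) cabs_real ger0_norm ?ler0n.
Qed.

Lemma cabs_sqr z : cabs z ^+ 2 = complex.Re z ^+ 2 + complex.Im z ^+ 2.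
Proof.
by rewrite /cabs normc_def /= sqr_sqrtr // addr_ge0 ?sqr_ge0.
Qed.

Lemma cabs_ge_Re z : `|complex.Re z| <= cabs z.
Proof.
rewrite -(@ler_pXn2r _ 2) ?nnegrE ?cabs_ge0 // cabs_sqr -normrX ger0_norm ?sqr_ge0 //.
by rewrite lerDl sqr_ge0.
Qed.

Lemma cabs_ge_Im z : `|complex.Im z| <= cabs z.
Proof.
rewrite -(@ler_pXn2r _ 2) ?nnegrE ?cabs_ge0 // cabs_sqr -normrX ger0_norm ?sqr_ge0 //.
by rewrite lerDr sqr_ge0.
Qed.

Lemma cabs_le_ReIm z : cabs z <= `|complex.Re z| + `|complex.Im z|.
Proof.
rewrite -(@ler_pXn2r _ 2) ?nnegrE ?cabs_ge0 ?addr_ge0 // cabs_sqr.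
rewrite sqrrD !real_normK ?num_real // -addrA lerD2l lerDr.
by rewrite mulrn_wge0 // mulr_ge0.
Qed.

Lemma cabs_conj z : cabs (z^*) = cabs z.
Proof. by rewrite /cabs norm_conjC. Qed.

Lemma cabs_sqr_conj z : (cabs z ^+ 2)%:C%C = z * z^* :> C.
Proof. by rewrite rmorphXn /= -cabsE normCK. Qed.

Lemma cvg_cabsP {T : Type} {F : set_system T} {FF : Filter F} (f : T -> C) (l : C) :
  f @ F --> l <-> forall e : R, 0 < e -> \forall x \near F, cabs (l - f x) < e.
Proof.
split=> [/cvgrPdist_lt h e e0|h].
  have e0' : (0 : C) < e%:C%C by rewrite ltcR.
  by near do rewrite -ltcR -cabsE; apply: h.
apply/cvgrPdist_lt => e; case: e => a b; rewrite ltcE /= => /andP[/eqP -> a0].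
by near do rewrite cabsE ltcR; apply: h.
Unshelve. all: by end_near. Qed.

End ComplexModulus.

(** * Roots of unity and the discrete Cauchy formula *)

Section DiscreteCauchy.
Context {F : numClosedFieldType}.

Lemma primitive_root_exists n : (0 < n)%N -> exists z : F, n.-primitive_root z.
Proof.
move=> n0; pose p : {poly F} := 'X^n - 1.
have [r Dp] := closed_field_poly_normal p.
rewrite (monicP _) ?monicXnsubC // scale1r in Dp.
have rn1 : all n.-unity_root r.
  by apply/allP=> z; rewrite -root_prod_XsubC -Dp.
have sz_r : (n < (size r).+1)%N.
  by rewrite -(size_prod_XsubC r id) -Dp size_XnsubC.
have [|z] := hasP (has_prim_root n0 rn1 _ sz_r); last by exists z.
by rewrite -separable_prod_XsubC -Dp separable_Xn_sub_1 // pnatr_eq0 -lt0n.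
Qed.

Lemma sum_expr_unity_root (x : F) n : x ^+ n = 1 -> x != 1 ->
  \sum_(j < n) x ^+ j = 0.
Proof.
move=> xn x1; have /eqP := subrX1 x n.
by rewrite xn subrr eq_sym mulf_eq0 subr_eq0 (negPf x1) /= => /eqP.
Qed.

Lemma norm_unity_root (x : F) n : (0 < n)%N -> x ^+ n = 1 -> `|x| = 1.
Proof.
move=> n0 xn; apply/eqP; rewrite -(@pexpr_eq1 _ _ n) ?normr_ge0 //.
by rewrite -normrX xn normr1.
Qed.

Lemma prim_root_orthogonality (w : F) n (i k : 'I_n) : n.-primitive_root w ->
  \sum_(j < n) (w ^+ j) ^+ i * (w ^+ j) ^- k = (i == k)%:R * n%:R.
Proof.
move=> pw; have n0 := prim_order_gt0 pw.
have wU : w != 0.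
  apply/eqP => w0; have /eqP := prim_expr_order pw.
  by rewrite w0 expr0n gtn_eqF // eq_sym oner_eq0.
have E (j : 'I_n) : (w ^+ j) ^+ i * (w ^+ j) ^- k = (w ^+ i * w ^- k) ^+ j.
  by rewrite exprMn exprVn -!exprM mulnC [(j * k)%N]mulnC.
under eq_bigr do rewrite E.
have [->|ik] := eqVneq.
  rewrite mulfV ?expf_neq0 // mul1r.
  by under eq_bigr do rewrite expr1n; rewrite sumr_const card_ord.
rewrite mul0r sum_expr_unity_root //.
  by rewrite exprMn exprVn -!exprM mulnC exprM [(k * n)%N]mulnC exprM
    !(prim_expr_order pw) !expr1n invr1 mulr1.
apply: contra ik; rewrite -subr_eq0 => /eqP h.
have : w ^+ i = w ^+ k.
  by apply/eqP; rewrite -(inj_eq (mulIf (invr_neq0 (expf_neq0 k wU)))) mulfV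
    ?expf_neq0 // -subr_eq0 h.
move/eqP; rewrite (eq_prim_root_expr pw) !modn_small //.
Qed.

(** The Cauchy formula on the circle of radius [r], with the integral replaced
by a mean over the [n]-th roots of unity: for a polynomial of degree less than
[n] the mean is exact, so that no error term has to be estimated. *)
Lemma discrete_cauchy (p : {poly F}) n (w r h : F) :
  n.-primitive_root w -> (size p <= n)%N -> r != 0 ->
  p.[h] - p.[0] = n%:R^-1 * \sum_(j < n) p.[r * w ^+ j] *
    \sum_(k < n | (0 < k)%N) (h / r) ^+ k * (w ^+ j) ^- k.
Proof.
move=> pw szp r0; have n0 := prim_order_gt0 pw.
have nU : n%:R != 0 :> F by rewrite pnatr_eq0 -lt0n.
transitivity (\sum_(k < n | (0 < k)%N) p`_k * h ^+ k).
  rewrite !(horner_coef_wide _ szp) -sumrB [LHS](bigID (fun k : 'I_n => (0 < k)%N)) /=.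
  rewrite [X in _ + X]big1 ?addr0; last first.
    by move=> k; rewrite -eqn0Ngt => /eqP ->; rewrite !expr0 subrr.
  by apply: eq_bigr => k k0; rewrite expr0n gtn_eqF // mulr0 subr0.
under [in RHS]eq_bigr => j _ do
  rewrite (horner_coef_wide _ szp) mulr_suml.
rewrite exchange_big /= mulr_sumr big_mkcond /=.
apply: eq_bigr => i _.
under eq_bigr => j _ do rewrite mulr_sumr.
rewrite exchange_big /=.
have E (k : 'I_n) : \sum_(j < n) p`_i * (r * w ^+ j) ^+ i *
      ((h / r) ^+ k * (w ^+ j) ^- k) =
   p`_i * r ^+ i * (h / r) ^+ k * ((i == k)%:R * n%:R).
  rewrite -(prim_root_orthogonality i k pw) mulr_sumr; apply: eq_bigr => j _.
  by rewrite exprMn; ring.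
under eq_bigr => k _ do rewrite E.
rewrite big_mkcond /= (bigD1 i) //= big1 => [|k ki]; last first.
  by rewrite eq_sym (negPf ki) mul0r mulr0 if_same.
rewrite addr0 eqxx mul1r; case: ifP => _; last by rewrite mulr0.
rewrite exprMn exprVn; field.
by rewrite nU expf_neq0.
Qed.

End DiscreteCauchy.

(** * The complex exponential and its approximation by polynomials *)

Section ComplexExponential.
Context {R : realType}.
Local Notation C := (cplx R).
Implicit Types (z w : C).

Definition cexp z : C :=
  Complex (expR (complex.Re z) * cos (complex.Im z))
          (expR (complex.Re z) * sin (complex.Im z)).

Lemma ReD z w : complex.Re (z + w) = complex.Re z + complex.Re w.
Proof. by case: z; case: w. Qed.

Lemma ImD z w : complex.Im (z + w) = complex.Im z + complex.Im w.
Proof. by case: z; case: w. Qed.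

Lemma Re_scale (x : R) z : complex.Re (x%:C%C * z : C) = x * complex.Re z.
Proof. by case: z => a b /=; rewrite mul0r subr0. Qed.

Lemma Im_scale (x : R) z : complex.Im (x%:C%C * z : C) = x * complex.Im z.
Proof. by case: z => a b /=; rewrite mul0r addr0. Qed.

Lemma cexpD z w : cexp (z + w) = cexp z * cexp w.
Proof.
apply/eqP; rewrite eq_complex /= ReD ImD expRD cosD sinD; apply/andP.
by split; apply/eqP; ring.
Qed.

Lemma cexp0 : cexp 0 = 1.
Proof. by apply/eqP; rewrite eq_complex /= expR0 cos0 sin0 mulr1 mulr0 !eqxx. Qed.

Lemma cabs_cexp z : cabs (cexp z) = expR (complex.Re z).
Proof.
apply/eqP; rewrite -(@eqrXn2 _ 2) ?cabs_ge0 ?expR_ge0 // cabs_sqr /=.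
by rewrite !exprMn -mulrDr cos2Dsin2 mulr1.
Qed.

Lemma cexp_muln z n : cexp (n%:R * z) = cexp z ^+ n.
Proof.
elim: n => [|n IH]; first by rewrite mul0r cexp0.
by rewrite -natr1 mulrDl mul1r cexpD IH exprSr.
Qed.

Lemma is_derive_small (f : R -> R) df : is_derive (0 : R) (1 : R) f df ->
  forall e, 0 < e -> exists2 d, 0 < d &
    forall h, `|h| < d -> `|f h - f 0 - df * h| <= e * `|h|.
Proof.
case=> dfx dfE e e0.
have /cvgrPdist_lt/(_ e e0) := dfx.
rewrite -dfE => -[d /= d0 hd]; exists d => // h hd'.
have [->|h0] := eqVneq h 0; first by rewrite subrr mulr0 subr0 normr0 mulr0.
have := hd h; rewrite /ball_ /= sub0r normrN => /(_ hd' h0) /ltW.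
rewrite addr0 [h *: 1](mulr1 h) => H.
have {}H : `|'D_1 f 0 - h^-1 * (f h - f 0)| <= e by exact: H.
have -> : f h - f 0 - 'D_1 f 0 * h = - (h * ('D_1 f 0 - h^-1 * (f h - f 0))).
  by field.
by rewrite normrN normrM mulrC ler_wpM2r.
Qed.


Lemma cexp_small e : 0 < e -> exists2 d, 0 < d &
  forall z, cabs z < d -> cabs (cexp z - 1 - z) <= e * cabs z.
Proof.
move=> e0; pose e' := Num.min (e / 8) 1.
have e'0 : 0 < e' by rewrite lt_min ltr01 divr_gt0.
have e'1 : e' <= 1 by rewrite ge_min lexx orbT.
have e'e : e' <= e / 8 by rewrite ge_min lexx.
have [d1 d10 h1] := is_derive_small (is_derive_expR (0 : R)) e'0.
have [d2 d20 h2] := is_derive_small (is_derive_cos (0 : R)) e'0.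
have [d3 d30 h3] := is_derive_small (is_derive_sin (0 : R)) e'0.
pose d := Num.min (Num.min d1 d2) (Num.min d3 (e' / 2)).
have d0 : 0 < d by rewrite !lt_min d10 d20 d30 divr_gt0.
exists d => // z; rewrite !lt_min => /andP[/andP[z1 z2] /andP[z3 z4]].
have zx := cabs_ge_Re z; have zy := cabs_ge_Im z.
have z0 := cabs_ge0 z.
set x := complex.Re z in zx; set y := complex.Im z in zy.
have {h1}hx := h1 x (le_lt_trans zx z1).
have {h2}hc := h2 y (le_lt_trans zy z2).
have {h3}hs := h3 y (le_lt_trans zy z3).
rewrite expR0 mul1r in hx; rewrite cos0 sin0 oppr0 mul0r subr0 in hc.
rewrite cos0 sin0 subr0 mul1r in hs.
have ex1 : `|expR x - 1| <= 2 * `|x|.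
  rewrite -(subrK x (expR x - 1)); apply: le_trans (ler_normD _ _) _.
  have : e' * `|x| <= 1 * `|x| by rewrite ler_wpM2r.
  by lra.
have ex3 : expR x <= 3.
  have : expR x - 1 <= 2 * `|x| by apply: le_trans ex1; rewrite ler_norm.
  by lra.
apply: le_trans (cabs_le_ReIm _) _.
have -> : complex.Re (cexp z - 1 - z) = (expR x - 1 - x) + expR x * (cos y - 1).
  by rewrite /x /y; case: (z) => a b /=; ring.
have -> : complex.Im (cexp z - 1 - z) = expR x * (sin y - y) + (expR x - 1) * y.
  by rewrite /x /y; case: (z) => a b /=; ring.
have H1 : `|expR x - 1 - x + expR x * (cos y - 1)| <= 4 * e' * cabs z.
  apply: le_trans (ler_normD _ _) _; rewrite normrM [ `|expR x|]ger0_norm ?expR_ge0 //.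
  have : expR x * `|cos y - 1| <= 3 * (e' * cabs z).
    by apply: ler_pM; rewrite ?expR_ge0 //; apply: le_trans hc _; rewrite ler_wpM2l // ltW.
  have : e' * `|x| <= e' * cabs z by rewrite ler_wpM2l // ltW.
  by lra.
have H2 : `|expR x * (sin y - y) + (expR x - 1) * y| <= 4 * e' * cabs z.
  apply: le_trans (ler_normD _ _) _; rewrite !normrM [ `|expR x|]ger0_norm ?expR_ge0 //.
  have : expR x * `|sin y - y| <= 3 * (e' * cabs z).
    by apply: ler_pM; rewrite ?expR_ge0 //; apply: le_trans hs _; rewrite ler_wpM2l // ltW.
  have : `|expR x - 1| * `|y| <= (2 * (e' / 2)) * cabs z.
    apply: ler_pM => //; apply: le_trans ex1 _; rewrite ler_wpM2l //.
    by apply: le_trans zx _; exact: ltW.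
  by lra.
have : 8 * e' * cabs z <= e * cabs z by rewrite ler_wpM2r // ; lra.
by lra.
Qed.

Lemma cabs_expB_le z w n (E : R) : cabs z <= E -> cabs w <= E -> 1 <= E ->
  cabs (z ^+ n - w ^+ n) <= n%:R * E ^+ n * cabs (z - w).
Proof.
move=> zE wE E1; rewrite subrXX cabsM mulrC ler_wpM2r ?cabs_ge0 //.
apply: le_trans (cabs_sum _ _ _) _.
have -> : n%:R * E ^+ n = \sum_(i < n) E ^+ n.
  by rewrite sumr_const card_ord mulr_natl.
apply: ler_sum => i _; rewrite cabsM !cabsX.
apply: (@le_trans _ _ (E ^+ (n.-1 - i) * E ^+ i)).
  by apply: ler_pM; rewrite ?exprn_ge0 ?cabs_ge0 // lerXn2r ?nnegrE ?cabs_ge0 //;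
    apply: le_trans E1.
rewrite -exprD ler_weXn2l //; have := ltn_ord i; lia.
Qed.

(** Approximability by polynomials on a disc is what the discrete Cauchy formula
requires of an entire function; for [exp] the Euler products
[(1 + z / n) ^+ n] do, which avoids power series. *)
Definition poly_approx (r : R) (f : C -> C) := forall e : R, 0 < e ->
  exists p : {poly C}, forall z, cabs z <= r -> cabs (f z - p.[z]) <= e.

Lemma poly_approx_cexp r (a : C) : 0 < r -> poly_approx r (fun z => cexp (a * z)).
Proof.
move=> r0 e e0; pose rho := cabs a * r + 1.
have rho0 : 0 < rho by rewrite ltr_wpDl // mulr_ge0 ?cabs_ge0 // ltW.
have [d d0 hd] := @cexp_small (e / (rho * expR rho)) (divr_gt0 e0 (mulr_gt0 rho0 (expR_gt0 _))).
pose n := (Num.truncn (rho / d)).+1.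
have n0 : 0 < n%:R :> R by rewrite ltr0n.
have nd : rho / n%:R < d.
  rewrite ltr_pdivrMr // mulrC -ltr_pdivrMr //.
  by apply: truncnS_gt.
exists ((1 + (a / n%:R) *: 'X) ^+ n) => z zr.
rewrite horner_exp !hornerE.
have -> : a * z = n%:R * (a / n%:R * z).
  by field; rewrite pnatr_eq0.
rewrite cexp_muln; set u := _ / _ * z.
have uE : cabs u <= rho / n%:R.
  rewrite /u !cabsM cabsV cabs_nat mulrAC ler_pM2r ?invr_gt0 //.
  apply: (@le_trans _ _ (cabs a * r)); first by rewrite ler_wpM2l ?cabs_ge0.
  by rewrite lerDl.
have uE' : complex.Re u <= rho / n%:R.
  by apply: le_trans uE; apply: le_trans (cabs_ge_Re _); exact: ler_norm.
have E1 : 1 <= expR (rho / n%:R) by rewrite -[leLHS]expR0 ler_expR divr_ge0 // ltW.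
apply: le_trans (cabs_expB_le _ _ _ E1) _.
- by rewrite cabs_cexp ler_expR.
- apply: le_trans (cabsD _ _) _; rewrite cabs1.
  by apply: le_trans (expR_ge1Dx _); rewrite lerD2l.
rewrite -expRM_natl mulrCA divff ?mulr1 ?gt_eqF // opprD addrA.
have h2 := hd u (le_lt_trans uE nd).
apply: (@le_trans _ _ (n%:R * expR rho * (e / (rho * expR rho) * (rho / n%:R)))).
  rewrite ler_wpM2l ?mulr_ge0 ?expR_ge0 //.
  apply: le_trans h2 _; rewrite ler_wpM2l //.
  by rewrite divr_ge0 ?mulr_ge0 ?expR_ge0 // ltW.
rewrite le_eqVlt; apply/orP; left; apply/eqP; field.
by rewrite !gt_eqF ?expR_gt0.
Qed.

Lemma poly_approxZ r (c : C) f :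
  poly_approx r f -> poly_approx r (fun z => c * f z).
Proof.
move=> hf e e0; have c0 : 0 < cabs c + 1 by rewrite ltr_wpDl ?cabs_ge0.
have [p hp] := hf _ (divr_gt0 e0 c0).
exists (c *: p) => z zr; rewrite hornerZ -mulrBr cabsM.
apply: le_trans (ler_wpM2l (cabs_ge0 _) (hp z zr)) _.
rewrite mulrCA ler_piMr ?(ltW e0) //.
by rewrite ler_pdivrMr // mul1r lerDl.
Qed.

Lemma poly_approx_sum r (I : eqType) (s : seq I) (f : I -> C -> C) :
  (forall i, poly_approx r (f i)) ->
  poly_approx r (fun z => \sum_(i <- s) f i z).
Proof.
move=> hf; elim: s => [|i s IH] e e0.
  by exists 0 => z _; rewrite big_nil hornerC subrr cabs0 ltW.
have e20 : 0 < e / 2 by rewrite divr_gt0.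
have [p hp] := hf i _ e20; have [q hq] := IH _ e20.
exists (p + q) => z zr; rewrite big_cons hornerD opprD addrACA.
apply: le_trans (cabsD _ _) _.
by rewrite (splitr e) lerD // ?hp ?hq.
Qed.

Lemma geometric_tail_le (t : R) n : 0 <= t -> t <= 1 / 2 ->
  \sum_(k < n | (0 < k)%N) t ^+ k <= 2 * t.
Proof.
move=> t0 t1; case: n => [|n]; first by rewrite big_ord0 mulr_ge0.
have := subrX1 t n.+1; rewrite (bigID (fun k : 'I_n.+1 => (0 < k)%N)) /=.
set S := \sum_(i < _ | _) _; rewrite [X in _ * (S + X)](_ : _ = 1); last first.
  rewrite (bigD1 ord0) //= expr0 big1 ?addr0 // => i.
  by rewrite -eqn0Ngt -val_eqE /= => /andP[/eqP -> ]; rewrite eqxx.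
have S0 : 0 <= S by apply: sumr_ge0 => i _; rewrite exprn_ge0.
have := exprn_ge0 n.+1 t0.
by nra.
Qed.

Lemma poly_lipschitz (p : {poly C}) (r M : R) (h : C) : 0 < r ->
  (forall z, cabs z = r -> cabs p.[z] <= M) -> cabs h <= r / 2 ->
  cabs (p.[h] - p.[0]) <= 2 * M / r * cabs h.
Proof.
move=> r0 pM hr; pose n := (size p).+1.
have [w pw] := @primitive_root_exists C n (ltn0Sn _).
have r0' : (r%:C%C : C) != 0 by rewrite -cabs_eq0 cabs_real normr_eq0 gt_eqF.
rewrite (discrete_cauchy h pw (leqnSn _) r0') cabsM cabsV cabs_nat.
have n0 : 0 < n%:R :> R by rewrite ltr0n.
rewrite ler_pdivrMl //.
have w1 j : cabs (w ^+ j) = 1.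
  rewrite cabsX; have := norm_unity_root (ltn0Sn _) (prim_expr_order pw).
  by rewrite /cabs => ->; rewrite expr1n.
apply: le_trans (cabs_sum _ _ _) _.
have -> : n%:R * (2 * M / r * cabs h) = \sum_(j < n) 2 * M / r * cabs h.
  by rewrite sumr_const card_ord mulr_natl.
apply: ler_sum => j _; rewrite cabsM.
have -> : 2 * M / r * cabs h = M * (2 * (cabs h / r)) by field; rewrite gt_eqF.
apply: ler_pM; rewrite ?cabs_ge0 //.
  by apply: pM; rewrite cabsM w1 mulr1 cabs_real gtr0_norm.
apply: le_trans (cabs_sum _ _ _) _.
have E k : cabs ((h / r%:C%C) ^+ k * (w ^+ j) ^- k) = (cabs h / r) ^+ k.
  rewrite cabsM cabsV [cabs ((w ^+ j) ^+ k)]cabsX w1 expr1n invr1 mulr1.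
  by rewrite cabsX cabsM cabsV cabs_real gtr0_norm.
under eq_bigr do rewrite E.
apply: geometric_tail_le; first by rewrite divr_ge0 ?cabs_ge0 ?ltW.
by rewrite ler_pdivrMr // mul1r mulrC.
Qed.

(** The Lipschitz constant depends only on the bound [M], not on [f]: this is
what makes difference quotients converge uniformly along a uniformly convergent
sequence. *)
Lemma poly_approx_lipschitz (f : C -> C) (r M : R) (h : C) : 0 < r ->
  poly_approx r f -> (forall z, cabs z = r -> cabs (f z) <= M) ->
  cabs h <= r / 2 -> cabs (f h - f 0) <= 2 * M / r * cabs h.
Proof.
move=> r0 fp fM hr; apply/ler_addgt0Pr => e e0.
have [p hp] := fp (e / 3) (divr_gt0 e0 (ltr0Sn _ _)).
have pM z : cabs z = r -> cabs p.[z] <= M + e / 3.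
  move=> zr; apply: le_trans (cabs_dist _ (f z)) _; apply: lerD; first exact: fM.
  by rewrite cabsB; apply: hp; rewrite zr.
have := poly_lipschitz r0 pM hr.
have h1 : cabs (f h - p.[h]) <= e / 3.
  by apply: hp; lra.
have h0 : cabs (p.[0] - f 0) <= e / 3 by rewrite cabsB; apply: hp; rewrite cabs0 ltW.
have := cabs_distD p.[h] (f h) (f 0); have := cabs_distD p.[0] p.[h] (f 0).
have : 2 * (M + e / 3) / r * cabs h <= 2 * M / r * cabs h + e / 3.
  have -> : 2 * (M + e / 3) / r * cabs h = 2 * M / r * cabs h + e / 3 * (2 * (cabs h / r)).
    by field; rewrite gt_eqF.
  have : cabs h / r <= 1 / 2 by rewrite ler_pdivrMr //; lra.
  by rewrite lerD2l => ?; apply: ler_piMr; lra.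
by lra.
Qed.

End ComplexExponential.

(** * Dirichlet polynomials and the Bessel inequality *)

(** The multiplicative monoid of the positive integers. The index [k] stands for
the integer [k.+1], as it does for the coefficients of [dirichlet_term]. *)
Definition dnat := nat.
HB.instance Definition _ := Choice.copy dnat nat.

Definition dmul (m n : dnat) : dnat := (m.+1 * n.+1).-1%N.

Lemma dmulS m n : (dmul m n).+1 = (m.+1 * n.+1)%N.
Proof. by rewrite prednK // muln_gt0. Qed.

Lemma dmulA : associative dmul.
Proof. by move=> m n p; apply: succn_inj; rewrite !dmulS mulnA. Qed.

Lemma dmul0n : left_id (0%N : dnat) dmul.
Proof. by move=> m; apply: succn_inj; rewrite !dmulS mul1n. Qed.

Lemma dmuln0 : right_id (0%N : dnat) dmul.
Proof. by move=> m; apply: succn_inj; rewrite !dmulS muln1. Qed.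

Lemma dmul_eq0 (m n : dnat) : dmul m n = 0%N -> m = 0%N /\ n = 0%N.
Proof.
move=> h; have := dmulS m n; rewrite h => /esym/eqP.
by rewrite muln_eq1 !eqSS => /andP[/eqP -> /eqP ->].
Qed.

HB.instance Definition _ := @monalg.Choice_isMonomialDef.Build dnat 0%N dmul
  dmulA dmul0n dmuln0 dmul_eq0.

Lemma dmulC : commutative dmul.
Proof. by move=> m n; apply: succn_inj; rewrite !dmulS mulnC. Qed.

HB.instance Definition _ := monalg.MonomialDef_isConomialDef.Build dnat dmulC.

Section Bessel.
Context {R : realType}.
Local Notation C := (cplx R).

Lemma cabs_geometric_sum (x : C) n : cabs x = 1 -> x != 1 ->
  cabs (\sum_(j < n) x ^+ j) <= 2 / cabs (x - 1).
Proof.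
move=> x1 xn1; have x0 : 0 < cabs (x - 1) by rewrite cabs_gt0 subr_eq0.
rewrite ler_pdivlMr // mulrC -cabsM -subrX1.
by apply: le_trans (cabsD _ _) _; rewrite cabsN cabs1 cabsX x1 expr1n.
Qed.

(** Averaging the squared modulus over the first [K] powers kills the
off-diagonal terms, whose geometric sums stay bounded as [K] grows. *)
Lemma bessel_unimodular N (d u : 'I_N -> C) (M : R) :
  (forall i, cabs (u i) = 1) -> injective u ->
  (forall j, cabs (\sum_i d i * u i ^+ j) <= M) ->
  \sum_i cabs (d i) ^+ 2 <= M ^+ 2.
Proof.
move=> u1 uI hM; set S := \sum_i _.
pose B := \sum_i \sum_(l | l != i) cabs (d i * (d l)^*) * (2 / cabs (u i * (u l)^* - 1)).
have uu i l : l != i -> u i * (u l)^* != 1.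
  move=> li; apply: contra li => /eqP h; apply/eqP/uI.
  have ul : u l * (u l)^* = 1 by rewrite -cabs_sqr_conj u1 expr1n.
  have ul0 : (u l)^* != 0.
    by apply/eqP => z; move: ul => /eqP; rewrite z mulr0 eq_sym oner_eq0.
  by apply: (mulIf ul0); rewrite ul h.
have key K : K%:R * S <= K%:R * M ^+ 2 + B.
  have E : (K%:R * S)%:C%C = \sum_(j < K) (cabs (\sum_i d i * u i ^+ j) ^+ 2)%:C%C -
     \sum_i \sum_(l | l != i) d i * (d l)^* * \sum_(j < K) (u i * (u l)^*) ^+ j :> C.
    apply/eqP; rewrite eq_sym subr_eq; apply/eqP.
    rewrite rmorphM rmorph_nat /S rmorph_sum /= mulr_sumr -big_split /=.
    have T (j : 'I_K) : (cabs (\sum_i d i * u i ^+ j) ^+ 2)%:C%C =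
        \sum_i (d i * u i ^+ j * (d i * u i ^+ j)^* +
          \sum_(l | l != i) d i * u i ^+ j * (d l * u l ^+ j)^*) :> C.
      rewrite cabs_sqr_conj rmorph_sum /= big_distrl /=; apply: eq_bigr => i _.
      by rewrite big_distrr /= (bigD1 i).
    rewrite (eq_bigr _ (fun j _ => T j)) exchange_big /=; apply: eq_bigr => i _.
    rewrite big_split /=; congr (_ + _).
      transitivity (\sum_(j < K) (cabs (d i) ^+ 2)%:C%C : C).
        apply: eq_bigr => j _; rewrite -cabs_sqr_conj; congr (_%:C%C).
        by rewrite cabsM cabsX u1 expr1n mulr1.
      by rewrite sumr_const card_ord mulr_natl.
    rewrite exchange_big /=; apply: eq_bigr => l li.
    rewrite mulr_sumr; apply: eq_bigr => j _.
    by rewrite rmorphM rmorphXn /= exprMn; ring.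
  have S0 : 0 <= K%:R * S by rewrite mulr_ge0 // sumr_ge0 // => i _; rewrite sqr_ge0.
  rewrite -[leLHS]ger0_norm // -cabs_real E.
  apply: le_trans (cabsD _ _) _; rewrite cabsN; apply: lerD.
    apply: le_trans (cabs_sum _ _ _) _.
    have -> : K%:R * M ^+ 2 = \sum_(j < K) M ^+ 2 by rewrite sumr_const card_ord mulr_natl.
    apply: ler_sum => j _; rewrite cabs_real ger0_norm ?sqr_ge0 //.
    by rewrite lerXn2r ?nnegrE ?cabs_ge0 //; apply: le_trans (hM j); rewrite cabs_ge0.
  apply: le_trans (cabs_sum _ _ _) _; apply: ler_sum => i _.
  apply: le_trans (cabs_sum _ _ _) _; apply: ler_sum => l li.
  rewrite cabsM ler_wpM2l ?cabs_ge0 //; apply: cabs_geometric_sum; last exact: uu.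
  by rewrite cabsM cabs_conj !u1 mulr1.
have B0 : 0 <= B.
  do 2![apply: sumr_ge0 => ? _]; rewrite mulr_ge0 ?cabs_ge0 // divr_ge0 ?cabs_ge0 //.
rewrite leNgt; apply/negP => SM.
have D0 : 0 < S - M ^+ 2 by rewrite subr_gt0.
have := key (Num.truncn (B / (S - M ^+ 2))).+1.
have := truncnS_gt (B / (S - M ^+ 2)).
rewrite ltr_pdivrMr //; set K := _%:R; move=> h1 h2.
have : K * (S - M ^+ 2) <= B by lra.
by rewrite leNgt h1.
Qed.

End Bessel.

Section DirichletPolynomial.
Context {R : realType}.
Local Notation C := (cplx R).
Implicit Types (s : C).

Lemma npowE n s : npow n s = cexp (- (ln n%:R)%:C%C * s).
Proof.
rewrite /npow /cexp -rmorphN Re_scale Im_scale !mulNr cosN sinN mulrN.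
by rewrite ![ln _ * _]mulrC.
Qed.

Lemma npowM m n s : (0 < m)%N -> (0 < n)%N ->
  npow (m * n) s = npow m s * npow n s.
Proof.
move=> m0 n0; rewrite !npowE natrM lnM ?posrE ?ltr0n // -cexpD.
by rewrite rmorphD /= opprD mulrDl.
Qed.

Lemma npow1 s : npow 1 s = 1.
Proof. by rewrite npowE ln1 oppr0 mul0r cexp0. Qed.

Lemma npowD n s t : npow n (s + t) = npow n s * npow n t.
Proof. by rewrite !npowE mulrDr cexpD. Qed.

(** The modulus of [npow n s] when [sigma] is the real part of [s]. *)
Definition rpow (sigma : R) (n : nat) : R := expR (- (sigma * ln n%:R)).

Lemma cabs_npow n s : cabs (npow n s) = rpow (complex.Re s) n.
Proof. by rewrite npowE cabs_cexp -rmorphN Re_scale mulNr mulrC. Qed.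

Lemma rpow_gt0 sigma n : 0 < rpow sigma n.
Proof. exact: expR_gt0. Qed.

Lemma rpowM sigma m n : (0 < m)%N -> (0 < n)%N ->
  rpow sigma (m * n) = rpow sigma m * rpow sigma n.
Proof.
by move=> m0 n0; rewrite /rpow natrM lnM ?posrE ?ltr0n // mulrDr opprD expRD.
Qed.

Lemma rpowD sigma tau n : rpow (sigma + tau) n = rpow sigma n * rpow tau n.
Proof. by rewrite /rpow mulrDl opprD expRD. Qed.

Lemma ler_rpow sigma m n : 0 <= sigma -> (0 < m)%N -> (m <= n)%N ->
  rpow sigma n <= rpow sigma m.
Proof.
move=> s0 m0 mn; rewrite ler_expR lerN2 ler_wpM2l // ler_ln ?posrE ?ltr0n ?ler_nat //.
exact: leq_trans mn.
Qed.

Lemma rpow1 sigma : rpow sigma 1 = 1.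
Proof. by rewrite /rpow ln1 mulr0 oppr0 expR0. Qed.

Lemma rpow_le1 sigma n : 0 <= sigma -> (0 < n)%N -> rpow sigma n <= 1.
Proof. by move=> s0 n0; rewrite -(rpow1 sigma) ler_rpow. Qed.

(** Formal Dirichlet polynomials: in the algebra of the monoid [dnat] the product
is the Dirichlet convolution. *)
Definition dpoly := monalg.malg dnat C.
HB.instance Definition _ := GRing.ComNzRing.on dpoly.
Implicit Types (p q : dpoly).

Definition dcoef (p : dpoly) (k : nat) : C := monalg.mcoeff (k : dnat) p.
Definition dmono (c : C) (k : nat) : dpoly := monalg.mkmalgU (k : dnat) c.

Definition dchar s (k : dnat) : C := npow k.+1 s.

Lemma dchar_mmorphism s : monalg.mmorphism (dchar s).
Proof. by split=> [m n|]; rewrite /dchar ?npow1 // dmulS npowM. Qed.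
HB.instance Definition _ s := monalg.isMultiplicative.Build dnat C (dchar s)
  (dchar_mmorphism s).

Definition deval s : dpoly -> C := monalg.mmap idfun (dchar s).
HB.instance Definition _ s := GRing.RMorphism.copy (deval s)
  (monalg.mmap idfun (dchar s)).

Lemma dpolyP p q : (forall k, dcoef p k = dcoef q k) -> p = q.
Proof. by move=> h; apply/monalg.malgP. Qed.

Lemma dcoefD p q k : dcoef (p + q) k = dcoef p k + dcoef q k.
Proof. exact: monalg.mcoeffD. Qed.

Lemma dcoefB p q k : dcoef (p - q) k = dcoef p k - dcoef q k.
Proof. exact: monalg.mcoeffB. Qed.

Lemma dcoef0 k : dcoef 0 k = 0.
Proof. exact: monalg.mcoeff0. Qed.

Lemma dcoef_sum I (r : seq I) (P : pred I) (F : I -> dpoly) k :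
  dcoef (\sum_(i <- r | P i) F i) k = \sum_(i <- r | P i) dcoef (F i) k.
Proof. exact: (raddf_sum (monalg.mcoeff (k : dnat))). Qed.

Lemma dcoef_mono c j k : dcoef (dmono c j) k = c *+ (j == k).
Proof. exact: monalg.mcoeffU. Qed.

Lemma deval_mono s c k : deval s (dmono c k) = c * npow k.+1 s.
Proof. exact: monalg.mmapU. Qed.

Definition dbounded p N := forall k, (N <= k)%N -> dcoef p k = 0.

Lemma dbounded_exists p : exists N, dbounded p N.
Proof.
exists (\max_(k <- monalg.msupp p) k).+1 => k kN.
apply/eqP; rewrite monalg.mcoeff_eq0; apply/negP => kp.
by have := @leq_bigmax_seq dnat _ xpredT (fun k => k) k kp isT; rewrite leqNgt kN.
Qed.

Lemma dpolyE p N : dbounded p N -> p = \sum_(k < N) dmono (dcoef p k) k.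
Proof.
move=> pN; apply: dpolyP => k; rewrite dcoef_sum.
under eq_bigr do rewrite dcoef_mono.
have [kN|Nk] := ltnP k N.
  rewrite (bigD1 (Ordinal kN)) //= eqxx big1 ?addr0 // => i.
  by rewrite -val_eqE /= => /negPf ->.
by rewrite pN // big1 // => i _; rewrite ltn_eqF // (leq_trans (ltn_ord i)).
Qed.

Lemma devalE p N s : dbounded p N ->
  deval s p = \sum_(k < N) dcoef p k * npow k.+1 s.
Proof.
move=> pN; rewrite {1}(dpolyE pN) rmorph_sum /=.
by apply: eq_bigr => k _; rewrite deval_mono.
Qed.

Lemma sum_dcoef_bounded p M N (F : C -> nat -> R) :
  (forall k, F 0 k = 0) -> (forall c k, 0 <= F c k) -> dbounded p N ->
  \sum_(k < M) F (dcoef p k) k <= \sum_(k < N) F (dcoef p k) k.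
Proof.
move=> F0 Fp pN; rewrite -!(big_mkord xpredT (fun k => F (dcoef p k) k)).
have [MN|NM] := leqP M N.
  rewrite (big_cat_nat _ MN) //= lerDl; exact: sumr_ge0.
rewrite (big_cat_nat _ (ltnW NM)) //= [X in _ + X]big_nat_cond [X in _ + X]big1 ?addr0 //.
by move=> k /andP[/andP[Nk _] _]; rewrite pN.
Qed.

(** On a vertical line the terms of [p] are multiples of the powers of distinct
unimodular numbers, along an arithmetic progression of small step. *)
Lemma dpoly_bessel p (M : R) :
  (forall s, C0 R s -> cabs (deval s p) <= M) ->
  forall N, \sum_(k < N) cabs (dcoef p k) ^+ 2 <= M ^+ 2.
Proof.
move=> hM N0; have [N pN] := dbounded_exists p.
apply: le_trans (@sum_dcoef_bounded p N0 N (fun c _ => cabs c ^+ 2) _ _ pN) _.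
- by move=> _; rewrite cabs0 expr0n.
- by move=> c _; rewrite sqr_ge0.
have M0 : 0 <= M by apply: le_trans (hM 1 _); rewrite ?cabs_ge0 // /C0 /= ltr01.
(* [C0] is open, so the mean is taken on the line of abscissa [eta]; the step
   [tau] keeps the arguments of the [u k] in an interval shorter than [pi], which
   makes them distinct. *)
have key eta : 0 < eta ->
    \sum_(k < N) (cabs (dcoef p k) * rpow eta k.+1) ^+ 2 <= M ^+ 2.
  move=> eta0; pose tau : R := (1 + ln N.+1%:R)^-1.
  have lnN0 : 0 <= ln N.+1%:R :> R by rewrite ln_ge0 // ler1n.
  have tau0 : 0 < tau by rewrite invr_gt0 ltr_pwDl.
  pose u (k : 'I_N) : C := npow k.+1 (Complex 0 tau).
  pose d (k : 'I_N) : C := dcoef p k * npow k.+1 (eta%:C%C).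
  have u1 k : cabs (u k) = 1 by rewrite cabs_npow /rpow mul0r oppr0 expR0.
  have sinpos (i l : 'I_N) : (i < l)%N -> u i != u l.
    move=> il; apply/negP => /eqP; rewrite /u !npowE => h.
    pose x : R := tau * (ln l.+1%:R - ln i.+1%:R).
    have hx : cexp ((ln l.+1%:R - ln i.+1%:R)%:C%C * Complex 0 tau) = 1 :> C.
      by rewrite rmorphB /= mulrBl -mulNr cexpD h -cexpD -mulrDl subrr mul0r cexp0.
    have := congr1 (@complex.Im R) hx.
    have -> z : complex.Im (cexp z) = expR (complex.Re z) * sin (complex.Im z) by [].
    rewrite Re_scale Im_scale /= mulr0 expR0 mul1r mulrC -/x.
    apply/eqP; rewrite gt_eqF // sin_gt0_pi //; apply/andP; split.
      by rewrite mulr_gt0 // subr_gt0 ltr_ln ?posrE ?ltr0n // ltr_nat ltnS.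
    apply: (@le_lt_trans _ _ 1); last by apply: lt_le_trans (pi_ge2 R); rewrite ltr1n.
    rewrite /x /tau mulrC ler_pdivrMr ?mul1r ?ltr_pwDl //.
    have : ln l.+1%:R <= ln N.+1%:R :> R.
      by rewrite ler_ln ?posrE ?ltr0n // ler_nat ltnS ltnW.
    have : 0 <= ln i.+1%:R :> R by rewrite ln_ge0 // ler1n.
    by lra.
  have uI : injective u.
    move=> i l h; apply/val_inj/eqP; case: ltngtP => // il.
      by have := sinpos _ _ il; rewrite h eqxx.
    by have := sinpos _ _ il; rewrite h eqxx.
  have := @bessel_unimodular R N d u M u1 uI.
  have hd k : cabs (d k) = cabs (dcoef p k) * rpow eta k.+1.
    by rewrite cabsM cabs_npow.
  under eq_bigr do rewrite hd.
  apply => j; have -> : \sum_(i < N) d i * u i ^+ j =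
      deval (eta%:C%C + j%:R * Complex 0 tau) p.
    rewrite (devalE _ pN); apply: eq_bigr => k _; rewrite npowD mulrA; congr (_ * _).
    by rewrite /u !npowE -cexp_muln mulrCA.
  apply: hM; rewrite /C0 /= ReD /= -[j%:R](rmorph_nat (real_complex R)) Re_scale.
  by rewrite /= mulr0 addr0.
(* The weights [rpow eta k.+1] tend to 1 with [eta]; the value of [eta] chosen
   below is small enough to contradict a gap between the two sides. *)
have lnN0 : 0 <= ln N.+1%:R :> R by rewrite ln_ge0 // ler1n.
set S := \sum_(k < N) _; rewrite leNgt; apply/negP => SM.
have S0 : 0 <= S by apply: sumr_ge0 => k _; exact: sqr_ge0.
set L : R := ln N.+1%:R in lnN0.
pose eta : R := (S - M ^+ 2) / (4 * (S * L + 1)).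
have SL : 0 < S * L + 1 by rewrite ltr_wpDl // mulr_ge0.
have eta0 : 0 < eta by rewrite divr_gt0 ?mulr_gt0 ?subr_gt0.
have h1 : S * rpow (eta *+ 2) N.+1 <= M ^+ 2.
  apply: le_trans (key _ eta0); rewrite mulr_suml; apply: ler_sum => k _.
  rewrite exprMn ler_wpM2l ?sqr_ge0 // [rpow eta _ ^+ 2]expr2 -rpowD -mulr2n.
  by rewrite ler_rpow // ?mulrn_wge0 ?ltW // ltnW // ltnS.
have h2 : S * (1 - eta *+ 2 * L) <= S * rpow (eta *+ 2) N.+1.
  by rewrite ler_wpM2l //; apply: le_trans (expR_ge1Dx _).
have h3 : eta * (4 * (S * L + 1)) = S - M ^+ 2 by rewrite divfK // gt_eqF // mulr_gt0.
rewrite mulr2n in h2.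
by nra.
Qed.


End DirichletPolynomial.

(** * Uniform limits of Dirichlet polynomials *)

Section ComplexLimits.
Context {R : realType}.
Local Notation C := (cplx R).

Lemma inv_succ_small (e : R) : 0 < e ->
  exists N, forall n, (N <= n)%N -> n.+1%:R^-1 <= e.
Proof.
move=> e0; exists (Num.truncn e^-1) => n Nn; rewrite invf_ple ?posrE ?ltr0n //.
by apply: ltW; apply: lt_le_trans (truncnS_gt _) _; rewrite ler_nat ltnS.
Qed.

Lemma real_cauchy_limit (u : nat -> R) :
  (forall e, 0 < e -> exists N, forall m n, (N <= m)%N -> (N <= n)%N ->
     `|u m - u n| <= e) ->
  exists l, forall e, 0 < e -> exists N, forall n, (N <= n)%N -> `|l - u n| <= e.
Proof.
move=> hu; have cu : cvgn u.
  apply: cauchy_cvg; apply: cauchy_exP => e e0.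
  have [N hN] := hu (e / 2) (divr_gt0 e0 (ltr0Sn _ _)).
  exists (u N); exists N => // n /= Nn; apply: le_lt_trans (hN _ _ (leqnn N) Nn) _.
  by rewrite ltr_pdivrMr // ltr_pMr // ltr1n.
exists (limn u) => e e0.
have /cvgrPdist_le/(_ e e0)[N _ hN] := cu.
by exists N => n Nn; apply: hN.
Qed.

Lemma complex_cauchy_limit (u : nat -> C) :
  (forall e, 0 < e -> exists N, forall m n, (N <= m)%N -> (N <= n)%N ->
     cabs (u m - u n) <= e) ->
  exists l, forall e, 0 < e -> exists N, forall n, (N <= n)%N ->
     cabs (l - u n) <= e.
Proof.
move=> hu.
have ReB (z w : C) : complex.Re (z - w) = complex.Re z - complex.Re w by case: z; case: w.
have ImB (z w : C) : complex.Im (z - w) = complex.Im z - complex.Im w by case: z; case: w.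
have [|a ha] := @real_cauchy_limit (fun n => complex.Re (u n)).
  move=> e e0; have [N hN] := hu e e0; exists N => m n Nm Nn.
  by apply: le_trans (hN m n Nm Nn); rewrite -ReB cabs_ge_Re.
have [|b hb] := @real_cauchy_limit (fun n => complex.Im (u n)).
  move=> e e0; have [N hN] := hu e e0; exists N => m n Nm Nn.
  by apply: le_trans (hN m n Nm Nn); rewrite -ImB cabs_ge_Im.
exists (Complex a b) => e e0; have e20 := divr_gt0 e0 (ltr0Sn _ 1).
have [N1 h1] := ha _ e20; have [N2 h2] := hb _ e20.
exists (maxn N1 N2) => n; rewrite geq_max => /andP[n1 n2].
apply: le_trans (cabs_le_ReIm _) _; rewrite ReB ImB (splitr e).
by apply: lerD; [exact: h1|exact: h2].
Qed.

End ComplexLimits.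

Section Holomorphy.
Context {R : realType}.
Local Notation C := (cplx R).
Implicit Types (f g : C -> C) (s D : C).

(** Allowing a relative error [e] lets a Dirichlet polynomial close to [f]
certify the slope [D]; the derivative of [f] is the limit of these slopes. *)
Definition almost_diff f s D (e : R) := exists2 d : R, 0 < d &
  forall h : C, cabs h < d -> cabs (f (s + h) - f s - D * h) <= e * cabs h.

(** The slopes for the errors [1 / n] form a Cauchy sequence. *)
Lemma almost_diff_derivable f s :
  (forall e, 0 < e -> exists D, almost_diff f s D e) -> derivable f s 1.
Proof.
move=> hf.
have close D1 D2 e1 e2 : almost_diff f s D1 e1 -> almost_diff f s D2 e2 ->
    cabs (D1 - D2) <= e1 + e2.
  move=> [d1 d10 h1] [d2 d20 h2].
  pose x : R := Num.min d1 d2 / 2.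
  have x0 : 0 < x by rewrite divr_gt0 // lt_min d10.
  have : x < Num.min d1 d2 by rewrite ltr_pdivrMr // ltr_pMr ?ltr1n // lt_min d10.
  rewrite lt_min => /andP[x1 x2].
  have cx : cabs (x%:C%C : C) = x by rewrite cabs_real gtr0_norm.
  have {}h1 := h1 x%:C%C; have {}h2 := h2 x%:C%C; rewrite cx in h1 h2.
  have {}h1 := h1 x1; have {}h2 := h2 x2.
  rewrite -(ler_pM2r x0) -{1}cx -cabsM.
  have -> : (D1 - D2) * x%:C%C = (f (s + x%:C%C) - f s - D2 * x%:C%C) -
     (f (s + x%:C%C) - f s - D1 * x%:C%C) by ring.
  apply: le_trans (cabsD _ _) _; rewrite cabsN mulrDl addrC.
  exact: lerD.
have hf' n : exists D, almost_diff f s D n.+1%:R^-1 by apply: hf; rewrite invr_gt0.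
have [D hD] := choice hf'.
have [|l hl] := @complex_cauchy_limit R D.
  move=> e e0; have [N hN] := inv_succ_small (divr_gt0 e0 (ltr0Sn _ 1)).
  exists N => m n Nm Nn; apply: le_trans (close _ _ _ _ (hD m) (hD n)) _.
  by rewrite (splitr e) lerD ?hN.
have hl' e : 0 < e -> exists2 d : R, 0 < d &
    forall h : C, cabs h < d -> cabs (f (s + h) - f s - l * h) <= e * cabs h.
  move=> e0; have e20 := divr_gt0 e0 (ltr0Sn _ 1).
  have [N1 hN1] := inv_succ_small e20; have [N2 hN2] := hl _ e20.
  pose n := maxn N1 N2; have [d d0 hd] := hD n; exists d => // h hh.
  have -> : f (s + h) - f s - l * h = (f (s + h) - f s - D n * h) - (l - D n) * h by ring.
  apply: le_trans (cabsD _ _) _; rewrite cabsN cabsM (splitr e) mulrDl lerD //.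
    apply: le_trans (hd h hh) _; rewrite ler_wpM2r ?cabs_ge0 //.
    by apply: hN1; exact: leq_maxl.
  rewrite ler_wpM2r ?cabs_ge0 //; apply: hN2; exact: leq_maxr.
apply/cvg_ex; exists l; apply/cvg_cabsP => e e0.
have [d d0 hd] := hl' _ (divr_gt0 e0 (ltr0Sn _ 1)).
have d0' : (0 : C) < d%:C%C by rewrite ltcR.
exists (d%:C%C : C) => // h; rewrite /ball_ /= sub0r normrN => hh h0.
have {}hh : cabs h < d by move: hh; rewrite cabsE ltcR.
have ch0 : 0 < cabs h by rewrite cabs_gt0.
have -> : (h *: 1 : C) = h by exact: mulr1.
rewrite -[h^-1 *: _]/(h^-1 * (f (h + s) - f s)).
have -> : l - h^-1 * (f (h + s) - f s) = - (h^-1 * (f (s + h) - f s - l * h)).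
  by rewrite [h + s]addrC; field.
rewrite cabsN cabsM cabsV -ltr_pdivlMl ?invr_gt0 // invrK.
apply: le_lt_trans (hd h hh) _; rewrite [cabs h * e]mulrC ltr_pM2r //.
by rewrite ltr_pdivrMr // ltr_pMr // ltr1n.
Qed.

Lemma almost_diff_npow n s (e : R) : 0 < e ->
  almost_diff (npow n) s (- (ln n%:R)%:C%C * npow n s) e.
Proof.
move=> e0; pose c : C := - (ln n%:R)%:C%C.
pose K := cabs (npow n s) * (cabs c + 1).
have K0 : 0 < K + 1 by rewrite ltr_wpDl // mulr_ge0 ?addr_ge0 ?cabs_ge0.
have [d d0 hd] := @cexp_small R _ (divr_gt0 e0 K0).
have c0 : 0 < cabs c + 1 by rewrite ltr_wpDl ?cabs_ge0.
exists (d / (cabs c + 1)) => [|h hh]; first by rewrite divr_gt0.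
have ch : cabs (c * h) < d.
  rewrite cabsM; move: hh; rewrite ltr_pdivlMr // mulrDr mulr1 mulrC.
  by apply: le_lt_trans; rewrite lerDl cabs_ge0.
have {}hd := hd _ ch.
rewrite npowD [npow n h]npowE -/c.
have -> : npow n s * cexp (c * h) - npow n s - c * npow n s * h =
  npow n s * (cexp (c * h) - 1 - c * h) by ring.
rewrite cabsM; apply: le_trans (ler_wpM2l (cabs_ge0 _) hd) _.
have -> : cabs (npow n s) * (e / (K + 1) * cabs (c * h)) =
    e * cabs h * (cabs (npow n s) * cabs c / (K + 1)).
  by rewrite cabsM; ring.
apply: ler_piMr; first by rewrite mulr_ge0 ?cabs_ge0 ?ltW.
rewrite ler_pdivrMr // mul1r /K mulrDr mulr1 -addrA lerDl addr_ge0 ?cabs_ge0 //.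
Qed.

Lemma almost_diffZ f s D e (c : C) : 0 < e ->
  (forall e, 0 < e -> almost_diff f s D e) ->
  almost_diff (fun z => c * f z) s (c * D) e.
Proof.
move=> e0 hf; have c0 : 0 < cabs c + 1 by rewrite ltr_wpDl ?cabs_ge0.
have [d d0 hd] := hf _ (divr_gt0 e0 c0); exists d => // h hh.
rewrite -mulrBr -mulrA -mulrBr cabsM.
apply: le_trans (ler_wpM2l (cabs_ge0 _) (hd h hh)) _.
rewrite mulrA ler_wpM2r ?cabs_ge0 // mulrCA ler_piMr ?(ltW e0) //.
by rewrite ler_pdivrMr // mul1r lerDl.
Qed.

Lemma almost_diffD f g s D E e : 0 < e ->
  (forall e, 0 < e -> almost_diff f s D e) ->
  (forall e, 0 < e -> almost_diff g s E e) ->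
  almost_diff (fun z => f z + g z) s (D + E) e.
Proof.
move=> e0 hf hg; have e20 := divr_gt0 e0 (ltr0Sn _ 1).
have [d d0 hd] := hf _ e20; have [d' d'0 hd'] := hg _ e20.
exists (Num.min d d'); first by rewrite lt_min d0.
move=> h; rewrite lt_min => /andP[h1 h2].
have -> : f (s + h) + g (s + h) - (f s + g s) - (D + E) * h =
  (f (s + h) - f s - D * h) + (g (s + h) - g s - E * h) by ring.
apply: le_trans (cabsD _ _) _; rewrite (splitr e) mulrDl.
by apply: lerD; [exact: hd|exact: hd'].
Qed.

Lemma almost_diff_deval (p : @dpoly R) s :
  exists D, forall e, 0 < e -> almost_diff (deval ^~ p) s D e.
Proof.
have [N pN] := dbounded_exists p; rewrite (dpolyE pN).
elim/big_ind: _ => [|q r [D hD] [E hE]|k _].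
- exists 0 => e e0; exists 1 => // h _.
  by rewrite /= !raddf0 mul0r !(subr0, addr0, oppr0) cabs0 mulr_ge0 ?cabs_ge0 ?ltW.
- exists (D + E) => e e0; have [d d0 hd] := almost_diffD e0 hD hE.
  have ED z : deval z (q + r) = deval z q + deval z r by exact: raddfD.
  by exists d => // h hh; rewrite /= !ED; exact: hd.
- exists (dcoef p k * (- (ln k.+1%:R)%:C%C * npow k.+1 s)) => e e0.
  have [d d0 hd] := almost_diffZ (dcoef p k) e0 (@almost_diff_npow k.+1 s).
  by exists d => // h hh; rewrite /= !deval_mono; exact: hd.
Qed.

Lemma C0_disc s (r : R) : r < complex.Re s -> forall z : C, cabs z <= r -> C0 R (s + z).
Proof.
move=> rs z zr; rewrite /C0 /= ReD.
have := cabs_ge_Re z; rewrite ler_norml => /andP[+ _]; lra.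
Qed.

Lemma deval_lipschitz (p : @dpoly R) s (M r : R) (h : C) :
  (forall z, C0 R z -> cabs (deval z p) <= M) -> 0 < r -> r < complex.Re s ->
  cabs h <= r / 2 -> cabs (deval (s + h) p - deval s p) <= 2 * M / r * cabs h.
Proof.
move=> pM r0 rs hr; have [N pN] := dbounded_exists p.
have E z : deval (s + z) p =
    \sum_(k < N) (dcoef p k * npow k.+1 s) * cexp (- (ln k.+1%:R)%:C%C * z).
  by rewrite (devalE _ pN); apply: eq_bigr => k _; rewrite npowD mulrA [npow _ z]npowE.
have := @poly_approx_lipschitz R (fun z => deval (s + z) p) r M h r0.
rewrite addr0; apply => //.
- move=> e e0; have [q hq] := @poly_approx_sum R r _ (index_enum 'I_N) _
    (fun k : 'I_N => poly_approxZ (dcoef p k * npow k.+1 s)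
       (poly_approx_cexp (- (ln k.+1%:R)%:C%C) r0)) e e0.
  by exists q => z zr; rewrite E; exact: hq.
- by move=> z zr; apply: pM; apply: C0_disc rs _ _; rewrite zr.
Qed.

(** The difference quotients of the limit are compared with those of one
polynomial, the Lipschitz estimate bounding the error independently of the
increment. *)
Lemma uniform_limit_derivable (f : C -> C) :
  (forall e, 0 < e -> exists p : @dpoly R,
     forall s, C0 R s -> cabs (f s - deval s p) <= e) ->
  forall s, C0 R s -> derivable f s 1.
Proof.
move=> hf s s0; apply: almost_diff_derivable => e e0.
pose r := complex.Re s / 2.
have r0 : 0 < r by rewrite divr_gt0.
have rs : r < complex.Re s by rewrite ltr_pdivrMr // ltr_pMr // ltr1n.
pose a := e * r / 8.
have a0 : 0 < a by rewrite divr_gt0 // mulr_gt0.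
have [p hp] := hf a a0.
have [D hD] := almost_diff_deval p s.
have [d d0 hd] := hD _ (divr_gt0 e0 (ltr0Sn _ 1)).
exists D; exists (Num.min d (r / 2)); first by rewrite lt_min d0 divr_gt0.
move=> h; rewrite lt_min => /andP[h1 h2].
have sh0 : C0 R (s + h) by apply: C0_disc rs _ _; lra.
have lip : cabs ((f (s + h) - deval (s + h) p) - (f s - deval s p)) <= e / 2 * cabs h.
  apply/ler_addgt0Pr => b b0.
  have b'0 : 0 < Num.min a (b / 2) by rewrite lt_min a0 divr_gt0.
  have [q hq] := hf _ b'0.
  have qa z : C0 R z -> cabs (f z - deval z q) <= a.
    by move=> z0; apply: le_trans (hq z z0) _; rewrite ge_min lexx.
  have qb z : C0 R z -> cabs (f z - deval z q) <= b / 2.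
    by move=> z0; apply: le_trans (hq z z0) _; rewrite ge_min lexx orbT.
  have M z : C0 R z -> cabs (deval z (q - p)) <= 2 * a.
    move=> z0; rewrite raddfB /=; apply: le_trans (cabs_distD (f z) _ _) _.
    by rewrite cabsB; have := qa z z0; have := hp z z0; lra.
  have EB z : deval z (q - p) = deval z q - deval z p by exact: raddfB.
  have := deval_lipschitz M r0 rs (ltW h2); rewrite !EB.
  have -> : 2 * (2 * a) / r * cabs h = e / 2 * cabs h.
    by rewrite /a; field; rewrite gt_eqF.
  have := qb _ s0; have := qb _ sh0.
  set x := f (s + h); set y := f s; set qx := deval (s + h) q; set qy := deval s q.
  set px := deval (s + h) p; set py := deval s p => c1 c2 c3.
  have -> : x - px - (y - py) = (qx - px - (qy - py)) + ((x - qx) - (y - qy)) by ring.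
  apply: le_trans (cabsD _ _) _; apply: lerD => //.
  by apply: le_trans (cabsD _ _) _; rewrite cabsN; lra.
have {}hd := hd h h1.
have -> : f (s + h) - f s - D * h =
  ((f (s + h) - deval (s + h) p) - (f s - deval s p)) +
  (deval (s + h) p - deval s p - D * h) by ring.
apply: le_trans (cabsD _ _) _; rewrite (splitr e) mulrDl; exact: lerD.
Qed.

End Holomorphy.

(** * Coefficients and absolute convergence *)

Section Coefficients.
Context {R : realType}.
Local Notation C := (cplx R).
Implicit Types (f g : C0 R -> C) (a : nat -> C) (p q : @dpoly R).

Definition approximable f := forall e : R, 0 < e ->
  exists p, forall s : C0 R, cabs (f s - deval (\val s) p) <= e.

(** For a uniform limit [f] of Dirichlet polynomials, the Bessel inequality for
the differences [f - p] determines the sequence [a] of its coefficients, and it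
is the only fact about them that the estimates use. *)
Definition has_coefs f a := forall p (M : R),
  (forall s : C0 R, cabs (f s - deval (\val s) p) <= M) ->
  forall N, \sum_(k < N) cabs (a k - dcoef p k) ^+ 2 <= M ^+ 2.

Lemma C0P (s : C) : C0 R s -> exists t : C0 R, \val t = s.
Proof. by move=> s0; exists (SigSub (mem_set s0)). Qed.

Lemma C0_val (s : C0 R) : C0 R (\val s).
Proof. exact: (set_mem (valP s)). Qed.

Lemma cabs_coef_le f a p M k : 0 <= M -> has_coefs f a ->
  (forall s : C0 R, cabs (f s - deval (\val s) p) <= M) ->
  cabs (a k - dcoef p k) <= M.
Proof.
move=> M0 fa /fa/(_ k.+1); rewrite big_ord_recr /= => h.
rewrite -(@ler_pXn2r _ 2) ?nnegrE ?cabs_ge0 //; apply: le_trans h.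
by rewrite lerDr sumr_ge0 // => i _; rewrite sqr_ge0.
Qed.

Lemma has_coefs_deval p : has_coefs (fun s => deval (\val s) p) (dcoef p).
Proof.
move=> q M hM N; have := @dpoly_bessel R (p - q) M _ N.
under eq_bigr do rewrite dcoefB; apply=> s /C0P[t <-].
by rewrite raddfB; exact: hM.
Qed.

(** The coefficients of approximating polynomials converge, by the Bessel
inequality for their differences. *)
Lemma has_coefs_exists f : approximable f -> exists a, has_coefs f a.
Proof.
move=> hf.
have /choice[p hp] n : exists p, forall s : C0 R,
    cabs (f s - deval (\val s) p) <= n.+1%:R^-1 by apply: hf; rewrite invr_gt0.
have cauchy k : exists l : C, forall e, 0 < e -> exists N, forall n, (N <= n)%N ->
    cabs (l - dcoef (p n) k) <= e.
  apply: complex_cauchy_limit => e e0.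
  have [N hN] := inv_succ_small (divr_gt0 e0 (ltr0Sn _ 1)).
  exists N => m n Nm Nn; apply: (cabs_coef_le _ (ltW e0) (@has_coefs_deval (p m))) => s.
  apply: le_trans (cabs_distD (f s) _ _) _; rewrite (splitr e) cabsB.
  by apply: lerD; [exact: le_trans (hp m s) (hN m Nm)|exact: le_trans (hp n s) (hN n Nn)].
have [a ha] := choice cauchy.
have ha' N e : 0 < e -> exists n0, forall n, (n0 <= n)%N -> forall k, (k < N)%N ->
    cabs (a k - dcoef (p n) k) <= e.
  move=> e0; elim: N => [|N [n1 h1]]; first by exists 0%N.
  have [n2 h2] := ha N e e0; exists (maxn n1 n2) => n; rewrite geq_max => /andP[c1 c2] k.
  by rewrite ltnS leq_eqVlt => /orP[/eqP ->|]; [exact: h2|exact: h1].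
exists a => q M hM N.
have M0 : 0 <= M.
  have [t _] := C0P (ltr01 : C0 R 1); by apply: le_trans (hM t); exact: cabs_ge0.
set T := \sum_(k < N) _.
have key e : 0 < e -> e <= 1 -> T <= M ^+ 2 + e * (2 * M + 1 + N%:R * (2 * M + 3)).
  move=> e0 e1; have [n1 h1] := ha' N e e0; have [n2 h2] := inv_succ_small e0.
  pose n := maxn n1 n2.
  have hn (s : C0 R) : cabs (deval (\val s) (p n) - deval (\val s) q) <= M + e.
    apply: le_trans (cabs_distD (f s) _ _) _; rewrite addrC; apply: lerD (hM s) _.
    by rewrite cabsB; apply: le_trans (hp n s) (h2 n (leq_maxr _ _)).
  have Me : 0 <= M + e by rewrite addr_ge0 // ltW.
  have B := has_coefs_deval hn N.
  have bnd (k : 'I_N) : cabs (a k - dcoef q k) ^+ 2 <=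
      cabs (dcoef (p n) k - dcoef q k) ^+ 2 + e * (2 * M + 3).
    have c1 := h1 n (leq_maxl _ _) k (ltn_ord k).
    have c2 := cabs_coef_le k Me (@has_coefs_deval (p n)) hn.
    have c3 := cabs_distD (dcoef (p n) k) (a k) (dcoef q k).
    have c4 := cabs_ge0 (a k - dcoef q k).
    have c5 := cabs_ge0 (dcoef (p n) k - dcoef q k).
    set x := cabs (a k - dcoef q k) in c3 c4 *.
    set y := cabs (dcoef (p n) k - dcoef q k) in c2 c3 c5 *.
    have xy : x <= y + e by lra.
    have : x ^+ 2 <= (y + e) ^+ 2 by rewrite lerXn2r ?nnegrE ?addr_ge0 // ltW.
    by rewrite sqrrD; nra.
  apply: (@le_trans _ _ ((M + e) ^+ 2 + N%:R * (e * (2 * M + 3)))).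
    apply: le_trans (ler_sum _ (fun k _ => bnd k)) _.
    rewrite big_split /=; apply: lerD; first exact: B.
    by rewrite sumr_const card_ord -[leLHS]mulr_natl.
  by nra.
apply/ler_addgt0Pr => b b0.
set K := _ + _ in key.
have K0 : 0 < K + 1.
  have : 0 <= N%:R * (2 * M + 3) :> R by apply: mulr_ge0 => //; lra.
  by rewrite /K; lra.
have e0 : 0 < Num.min 1 (b / (K + 1)) by rewrite lt_min ltr01 divr_gt0.
have := key _ e0; rewrite ge_min lexx => /(_ isT) /le_trans; apply; rewrite lerD2l.
apply: (@le_trans _ _ (b / (K + 1) * (K + 1))); last by rewrite divfK // gt_eqF.
have : Num.min 1 (b / (K + 1)) <= b / (K + 1) by rewrite ge_min lexx orbT.
set x := Num.min _ _ in e0 *; set y := b / _ => xy.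
have : x * (K + 1) <= y * (K + 1) by rewrite ler_wpM2r // ltW.
by lra.
Qed.

(** Cauchy condensation: the terms of the block from [2 ^ j] to [2 ^ j.+1] are
at most [rpow t (2 ^ j)]. *)
Lemma p_series_bounded (t : R) : 1 < t ->
  exists2 Z : R, 0 <= Z & forall N, \sum_(k < N) rpow t k.+1 <= Z.
Proof.
move=> t1; pose x : R := 2 * rpow t 2.
have t0 : 0 <= t by lra.
have x0 : 0 <= x by rewrite mulr_ge0 // ltW // rpow_gt0.
have x1 : x < 1.
  rewrite /x -{1}[2]lnK ?posrE // /rpow -expRD -[ltRHS]expR0 ltr_expR.
  have : 0 < ln 2 :> R by rewrite ln_gt0 // ltr1n.
  by nra.
have dyadic J : \sum_(k < (2 ^ J).-1) rpow t k.+1 <= \sum_(j < J) x ^+ j.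
  elim: J => [|J IH]; first by rewrite big_ord0 big_ord0.
  rewrite [leRHS]big_ord_recr /= -(big_mkord xpredT (fun k => rpow t k.+1)).
  have J0 : (0 < 2 ^ J)%N by rewrite expn_gt0.
  have le : ((2 ^ J).-1 <= (2 ^ J.+1).-1)%N by rewrite expnS; lia.
  rewrite (big_cat_nat _ le) //= big_mkord lerD //.
  apply: (@le_trans _ _ (\sum_((2 ^ J).-1 <= k < (2 ^ J.+1).-1) rpow t (2 ^ J))).
    rewrite !big_nat; apply: ler_sum => k /andP[k1 k2].
    by rewrite ler_rpow //; lia.
  rewrite sumr_const_nat.
  have -> : ((2 ^ J.+1).-1 - (2 ^ J).-1)%N = (2 ^ J)%N by rewrite expnS; lia.
  have -> : rpow t (2 ^ J) = rpow t 2 ^+ J.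
    by elim: J {IH J0 le} => [|J IH]; rewrite ?rpow1 // expnS rpowM ?expn_gt0 // IH exprS.
  by rewrite -mulr_natl natrX -exprMn.
exists (1 - x)^-1 => [|N]; first by rewrite invr_ge0 subr_ge0 ltW.
have NN : (N <= (2 ^ N).-1)%N by have := @ltn_expl 2 N isT; lia.
apply: (@le_trans _ _ (\sum_(k < (2 ^ N).-1) rpow t k.+1)).
  rewrite -!(big_mkord xpredT (fun k => rpow t k.+1)) [leRHS](big_cat_nat _ NN) //=.
  by rewrite lerDl sumr_ge0 // => k _; rewrite ltW // rpow_gt0.
apply: le_trans (dyadic N) _; rewrite -[leRHS]mul1r ler_pdivlMr ?subr_gt0 //.
have := subrX1 x N; have := exprn_ge0 N x0; nra.
Qed.

(** Above the abscissa 1/2 the weights are square summable, so that the Bessel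
inequality bounds the sum of the moduli of the coefficients. *)
Lemma coefs_absolute_bound (sigma : R) : 1 / 2 < sigma ->
  exists2 K : R, 0 <= K & forall f a p M, 0 < M -> has_coefs f a ->
    (forall s : C0 R, cabs (f s - deval (\val s) p) <= M) ->
    forall N, \sum_(k < N) cabs (a k - dcoef p k) * rpow sigma k.+1 <= M * K.
Proof.
move=> hs; have t1 : 1 < sigma + sigma by lra.
have [Z Z0 hZ] := p_series_bounded t1.
exists (1 + Z) => [|f a p M M0 fa hM N]; first by rewrite addr_ge0.
(* the inequality of arithmetic and geometric means, balanced by [M] *)
apply: (@le_trans _ _ (\sum_(k < N) (M^-1 * cabs (a k - dcoef p k) ^+ 2
    + M * rpow (sigma + sigma) k.+1))).
  apply: ler_sum => k _; rewrite rpowD.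
  set x := cabs _; set y := rpow _ _.
  have x0 : 0 <= x := cabs_ge0 _; have y0 : 0 <= y by rewrite ltW // rpow_gt0.
  rewrite -(ler_pM2l M0).
  have -> : M * (M^-1 * x ^+ 2 + M * (y * y)) = x ^+ 2 + (M * y) ^+ 2.
    by field; rewrite gt_eqF.
  by have := sqr_ge0 (x - M * y); nra.
rewrite big_split /= -!mulr_sumr mulrDr mulr1; apply: lerD.
  rewrite ler_pdivrMl //; exact: fa.
by rewrite ler_pM2l //; exact: hZ.
Qed.

Lemma has_coefs_cvg f a (s : C0 R) : approximable f -> has_coefs f a ->
  1 / 2 < complex.Re (\val s) -> series (dirichlet_term a (\val s)) @ \oo --> f s.
Proof.
move=> hf fa hs; have [K K0 hK] := coefs_absolute_bound hs.
apply/cvg_cabsP => e e0.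
have K2 : 0 < K + 2 by lra.
have d0 := divr_gt0 e0 K2; set d := e / (K + 2) in d0.
have [p hp] := hf d d0; have [N0 pN0] := dbounded_exists p.
exists N0 => // N /= N0N.
have pN : dbounded p N by move=> k Nk; apply: pN0; exact: leq_trans Nk.
have {hK} := hK f a p d d0 fa hp N.
rewrite /series /= big_mkord /dirichlet_term => hK.
have -> : f s - \sum_(k < N) a k * npow k.+1 (\val s) =
  (f s - deval (\val s) p) - \sum_(k < N) (a k - dcoef p k) * npow k.+1 (\val s).
  rewrite (devalE _ pN) -addrA -opprD -big_split /=; congr (_ - _).
  by apply: eq_bigr => k _; rewrite -mulrDl subrKC.
apply: le_lt_trans (cabsD _ _) _; rewrite cabsN.
have : cabs (\sum_(k < N) (a k - dcoef p k) * npow k.+1 (\val s)) <= d * K.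
  apply: le_trans (cabs_sum _ _ _) _; apply: le_trans hK.
  by apply: ler_sum => k _; rewrite cabsM cabs_npow.
have := hp s; have : d * (K + 2) = e by rewrite divfK // gt_eqF.
by nra.
Qed.

Definition abs_sum a (sigma : R) N : R := \sum_(k < N) cabs (a k) * rpow sigma k.+1.

Lemma abs_sum_homo a sigma : {homo abs_sum a sigma : m n / (m <= n)%N >-> m <= n}.
Proof.
move=> m n mn; rewrite /abs_sum -!(big_mkord xpredT (fun k => cabs (a k) * rpow sigma k.+1)).
rewrite [leRHS](big_cat_nat _ mn) //= lerDl sumr_ge0 // => k _.
by rewrite mulr_ge0 ?cabs_ge0 // ltW // rpow_gt0.
Qed.

Lemma normed_dirichlet_series a (s : C) :
  [normed series (dirichlet_term a s)] =
  (fun N => (abs_sum a (complex.Re s) N)%:C%C : C).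
Proof.
apply/funext => N; rewrite /normed_series_of seriesEord /abs_sum rmorph_sum /=.
by apply: eq_bigr => k _; rewrite /dirichlet_term cabsE cabsM cabs_npow.
Qed.

Lemma sigma_a_le_half f a : approximable f -> has_coefs f a ->
  (sigma_a a <= (2^-1)%:E)%E.
Proof.
move=> hf fa; apply: ereal_inf_lbound; exists 2^-1 => // s hs.
have [p hp] := hf 1 ltr01; have [N0 pN0] := dbounded_exists p.
have hs' : 1 / 2 < complex.Re s by rewrite mul1r.
have [K K0 hK] := coefs_absolute_bound hs'.
have {hK} := hK f a p 1 ltr01 fa hp; rewrite mul1r => hK.
rewrite normed_dirichlet_series.
have cu : cvgn (abs_sum a (complex.Re s)).
  apply: nondecreasing_is_cvgn; first exact: abs_sum_homo.
  exists (K + abs_sum (dcoef p) (complex.Re s) N0) => _ [N _ <-].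
  apply: (@le_trans _ _ (\sum_(k < N) cabs (a k - dcoef p k) * rpow (complex.Re s) k.+1
     + abs_sum (dcoef p) (complex.Re s) N)).
    rewrite /abs_sum -big_split /=; apply: ler_sum => k _.
    by rewrite -mulrDl ler_wpM2r ?(ltW (rpow_gt0 _ _)) // addrC cabs_dist.
  apply: lerD (hK N) _.
  apply: (@sum_dcoef_bounded R p N N0 (fun c k => cabs c * rpow _ k.+1)) => //.
  - by move=> k; rewrite cabs0 mul0r.
  - by move=> c k; rewrite mulr_ge0 ?cabs_ge0 ?(ltW (rpow_gt0 _ _)).
apply/cvg_ex; exists ((limn (abs_sum a (complex.Re s)))%:C%C : C).
apply/cvg_cabsP => e e0; have /cvgrPdist_lt/(_ e e0) := cu.
by apply: filterS => N; rewrite -cabs_real rmorphB.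
Qed.

Lemma sigma_a_ge_half a :
  (forall sigma B : R, 0 <= sigma -> sigma < 1 / 2 -> exists N, B < abs_sum a sigma N) ->
  ((2^-1)%:E <= sigma_a a)%E.
Proof.
move=> hB; apply: le_ereal_inf_tmp => _ [sigma hsigma <-]; rewrite lee_fin leNgt.
apply/negP => s2.
have m0 : 0 <= Num.max sigma 0 by rewrite le_max lexx orbT.
have ms : sigma <= Num.max sigma 0 by rewrite le_max lexx.
have m2 : Num.max sigma 0 < 2^-1 by rewrite gt_max s2 invr_gt0 ltr0n.
move: (Num.max sigma 0) m0 ms m2 => m m0 ms m2.
pose tau := (m + 2^-1) / 2.
have [t0 st t2] : [/\ 0 <= tau, sigma < tau & tau < 1 / 2].
  by rewrite /tau; split; lra.
have := hsigma (tau%:C%C : C) st; rewrite normed_dirichlet_series.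
move=> /cvg_cabsP/(_ 1 ltr01)[N _]; set l := lim _ => hN.
have [n hn] := hB tau (cabs l + 1) t0 t2.
have := hN (maxn N n) (leq_maxl _ _) => /=.
have := abs_sum_homo a tau (leq_maxr N n).
have := cabs_dist ((abs_sum a tau (maxn N n))%:C%C : C) l.
rewrite cabs_real ger0_norm; last first.
  by apply: sumr_ge0 => k _; rewrite mulr_ge0 ?cabs_ge0 ?(ltW (rpow_gt0 _ _)).
by rewrite cabsB; lra.
Qed.

Lemma deval_bounded p : exists M : R, forall s : C0 R, cabs (deval (\val s) p) <= M.
Proof.
have [N pN] := dbounded_exists p; exists (\sum_(k < N) cabs (dcoef p k)) => s.
rewrite (devalE _ pN); apply: le_trans (cabs_sum _ _ _) _; apply: ler_sum => k _.
rewrite cabsM cabs_npow ler_piMr ?cabs_ge0 // rpow_le1 // ltW //.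
exact: C0_val.
Qed.

Lemma approximable_bounded f : approximable f ->
  exists2 M : R, 0 < M & forall s, cabs (f s) <= M.
Proof.
move=> /(_ 1 ltr01)[p hp]; have [M hM] := deval_bounded p.
exists (`|M| + 1) => [|s]; first by rewrite ltr_wpDl.
apply: le_trans (cabs_dist _ (deval (\val s) p)) _; apply: lerD => //.
exact: le_trans (hM s) (ler_norm _).
Qed.

Lemma dirichlet_polynomialP (P : C0 R -> C) :
  dirichlet_polynomial P <-> exists p, forall s, P s = deval (\val s) p.
Proof.
split=> [[N [a ha]]|[p hp]].
  exists (\sum_(k < N) dmono (a k) k) => s; rewrite ha /series /= big_mkord rmorph_sum /=.
  by apply: eq_bigr => k _; rewrite deval_mono.
have [N pN] := dbounded_exists p; exists N, (dcoef p) => s.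
by rewrite hp (devalE _ pN) /series /= big_mkord.
Qed.

(** Holomorphy, boundedness and the representation by a Dirichlet series all
follow from uniform approximability. *)
Lemma AC0P (f : C0 R -> C) : AC0 R f <-> approximable f.
Proof.
split.
- case=> _ [P [Pp cP]] e e0.
  have e0' : (0 : C) < e%:C%C by rewrite ltcR.
  have W : nbhs (f : {uniform C0 R -> C})
      [set h | forall s : C0 R, [set: C0 R] s -> ball (f s) (e%:C%C : C) (h s)].
    apply/uniform_nbhs; exists [set xy : C * C | ball xy.1 (e%:C%C : C) xy.2]; split => //.
    by rewrite -entourage_ballE; exists (e%:C%C : C).
  have := cP _ W.
  case=> k _ /(_ k (leqnn k)) /= hk.
  have /dirichlet_polynomialP[p hp] := Pp k; exists p => s.
  by have := hk s I; rewrite -ball_normE /= cabsE hp ltcR => /ltW.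
- move=> hf; split; first split.
  + move=> s s0; apply: uniform_limit_derivable => // e e0.
    have [p hp] := hf e e0; exists p => t /C0P[u <-].
    by have := congr1 (fun g => g u) (valLK 0 f) => /= ->; exact: hp.
  + have [M M0 hM] := approximable_bounded hf.
    exists (M%:C%C : C); split; first by apply/complex_realP; exists M.
    by move=> x Mx s _ /=; rewrite cabsE; apply: le_trans (ltW Mx); rewrite lecR.
  + have [a fa] := has_coefs_exists hf; exists a, (1 / 2) => s hs.
    exact: has_coefs_cvg.
  have /choice[p hp] n : exists p, forall s : C0 R,
      cabs (f s - deval (\val s) p) <= n.+1%:R^-1 by apply: hf; rewrite invr_gt0.
  exists (fun n s => deval (\val s) (p n)); split.
    by move=> k; apply/dirichlet_polynomialP; exists (p k).
  move=> W /uniform_nbhs[E [entE EW]].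
  move: entE; rewrite -entourage_ballE => -[eps eps0 epsE].
  have eps0' : (0 : C) < eps := eps0.
  have eps1 : 0 < complex.Re eps by move: eps0'; rewrite ltcE => /andP[].
  have epsC : eps = ((complex.Re eps)%:C%C : C).
    move: eps0'; rewrite ltcE => /andP[/eqP /= i0 _].
    by rewrite [LHS]complexE i0 mulr0 addr0.
  have [N hN] := inv_succ_small (divr_gt0 eps1 (ltr0Sn _ 1)).
  exists N => // n /= Nn; apply: EW => s _; apply: epsE => /=.
  rewrite -ball_normE /= cabsE epsC ltcR.
  apply: le_lt_trans (hp n s) _; apply: le_lt_trans (hN n Nn) _.
  by rewrite ltr_pdivrMr // ltr_pMr // ltr1n.
Qed.

End Coefficients.

(** * A lower bound for the number of primes *)

Section PrimeCounting.
Local Open Scope nat_scope.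

(** In Legendre's formula the floor of [2 * n / p ^ k] exceeds twice that of
[n / p ^ k] by at most 1, and by 0 once [p ^ k] exceeds [2 * n]. *)
Lemma pfactor_central_binomial p n : prime p -> 0 < n ->
  p ^ logn p 'C(n + n, n) <= n + n.
Proof.
move=> pp n0; have p1 := prime_gt1 pp.
have nn0 : 0 < n + n by rewrite addn_gt0 n0.
apply: leq_trans (trunc_logP p1 nn0); rewrite leq_exp2l //.
set T := trunc_log p (n + n).
have C0 : 0 < 'C(n + n, n) by rewrite bin_gt0 leq_addr.
have /(congr1 (logn p)) := bin_fact (leq_addr n n).
rewrite addnK !lognM ?muln_gt0 ?fact_gt0 // !logn_fact //.
have -> : \sum_(1 <= k < n.+1) n %/ p ^ k = \sum_(1 <= k < (n + n).+1) n %/ p ^ k.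
  have le : n.+1 <= (n + n).+1 by rewrite ltnS leq_addr.
  rewrite [RHS](big_cat_nat _ le) //= [X in _ = _ + X]big_nat [X in _ = _ + X]big1 ?addn0 //.
  move=> k /andP[nk _]; rewrite divn_small //; apply: leq_trans nk _.
  exact: ltnW (ltn_expl _ p1).
have Tle : T.+1 <= (n + n).+1.
  by rewrite ltnS; apply: leq_trans (trunc_logP p1 nn0); exact: ltnW (ltn_expl _ p1).
have : \sum_(1 <= k < (n + n).+1) (n + n) %/ p ^ k <=
    \sum_(1 <= k < (n + n).+1) (n %/ p ^ k + n %/ p ^ k + (k <= T)).
  rewrite !big_nat; apply: leq_sum => k _; have [kT|kT] := leqP k T.
    exact: leq_divDl.
  rewrite divn_small //; apply: leq_trans (trunc_log_ltn _ p1) _.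
  by rewrite leq_exp2l.
rewrite !big_split /=.
have -> : \sum_(1 <= k < (n + n).+1) (k <= T) = T.
  rewrite (big_cat_nat _ Tle) //= [X in _ + X]big_nat [X in _ + X]big1 ?addn0; last first.
    by move=> k /andP[Tk _]; rewrite leqNgt Tk.
  rewrite big_nat (eq_bigr (fun=> 1)); last by move=> k /andP[_]; rewrite ltnS => ->.
  by rewrite -big_nat sum_nat_const_nat subn1 muln1.
lia.
Qed.

Lemma central_binomial_ge n : 2 ^ n <= 'C(n + n, n).
Proof.
elim: n => [|n IH]; first by rewrite bin0.
rewrite addSn addnS binS.
have -> : 'C((n + n).+1, n.+1) = 'C((n + n).+1, n).
  by rewrite -[RHS]bin_sub ?leqW ?leq_addr //; congr 'C(_, _); lia.
have : 'C(n + n, n) <= 'C((n + n).+1, n).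
  by case: n {IH} => [|n]; rewrite ?bin0 // [X in _ <= X]binS leq_addr.
by rewrite expnS; lia.
Qed.

Definition primes_upto x := [seq p <- iota 0 x.+1 | prime p].

Lemma mem_primes_upto x p : (p \in primes_upto x) = prime p && (p <= x).
Proof. by rewrite mem_filter mem_iota add0n ltnS. Qed.

Lemma uniq_primes_upto x : uniq (primes_upto x).
Proof. by rewrite filter_uniq ?iota_uniq. Qed.

(** The central binomial coefficient is a product of prime powers, one for each
prime up to [n + n], none of which exceeds [n + n]. *)
Lemma chebyshev_lower n : 0 < n -> 2 ^ n <= (n + n) ^ size (primes_upto (n + n)).
Proof.
move=> n0; apply: leq_trans (central_binomial_ge n) _.
set B := 'C(n + n, n).
have B0 : 0 < B by rewrite bin_gt0 leq_addr.
rewrite -{1}(partnT B0) /partn big_mkcond /=.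
apply: (@leq_trans (\prod_(0 <= p < B.+1 | p \in primes_upto (n + n)) (n + n))).
  rewrite [X in _ <= X]big_mkcond /=; apply: leq_prod => p _.
  rewrite mem_primes_upto; have [pp|] := boolP (prime p); last first.
    by rewrite lognE => /negPf ->.
  have le := pfactor_central_binomial pp n0; rewrite -/B in le.
  have [pn //|np] /= := leqP p (n + n).
  case E : (logn p B) le => [|k] // le.
  have : p <= n + n.
    by apply: leq_trans le; rewrite -{1}(expn1 p) leq_exp2l ?prime_gt1.
  by rewrite leqNgt np.
rewrite -big_filter big_const_seq count_predT iter_muln_1.
rewrite leq_pexp2l ?addn_gt0 ?n0 //.
apply: uniq_leq_size; first by rewrite filter_uniq ?iota_uniq.
by move=> p; rewrite mem_filter => /andP[].
Qed.

Lemma chebyshev_lower_exp r : 2 ^ r <= r.+1 * size (primes_upto (2 ^ r.+1)).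
Proof.
have := @chebyshev_lower (2 ^ r); rewrite expn_gt0 => /(_ isT).
have -> : 2 ^ r + 2 ^ r = 2 ^ r.+1 by rewrite expnS mul2n addnn.
by rewrite -expnM leq_exp2l.
Qed.

Lemma primes_between q k r : (q.+1 + k) * r.+1 <= 2 ^ r ->
  exists P : nat -> nat,
    (forall i, i < k -> [/\ prime (P i), q < P i & P i <= 2 ^ r.+1]) /\
    (forall i j, i < k -> j < k -> P i = P j -> i = j).
Proof.
move=> h; pose s := [seq p <- primes_upto (2 ^ r.+1) | q < p].
have ks : k <= size s.
  have : size (primes_upto (2 ^ r.+1)) <= size s + q.+1.
    rewrite -(size_iota 0 q.+1) -size_cat; apply: uniq_leq_size.
      exact: uniq_primes_upto.
    move=> p pp; rewrite mem_cat mem_filter pp andbT mem_iota add0n ltnS.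
    by case: ltnP.
  by have := chebyshev_lower_exp r; nia.
have us : uniq s by rewrite filter_uniq // uniq_primes_upto.
exists (nth 0 s); split=> [i ik|i j ik jk /eqP].
  have := mem_nth 0 (leq_trans ik ks); rewrite mem_filter mem_primes_upto.
  by case/and3P.
by rewrite nth_uniq ?(leq_trans _ ks) // => /eqP.
Qed.

Lemma linear_le_exp2 c d : exists v, c * v + d <= 2 ^ v.
Proof.
pose w := 2 * c + d; exists (w + w); rewrite expnD.
have ww : w.+1 * w.+1 <= 2 ^ w * 2 ^ w by apply: leq_mul; exact: ltn_expl.
apply: leq_trans ww; have : w = c + c + d by rewrite /w mul2n addnn.
move: w => w ->; nia.
Qed.

End PrimeCounting.

(** * Products of Fourier matrices as Dirichlet polynomials *)

Section FormalCoefficients.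
Context {R : realType}.
Local Notation C := (cplx R).
Implicit Types (p q : @dpoly R).

Lemma dmonoM (c1 c2 : C) k1 k2 :
  dmono c1 k1 * dmono c2 k2 = dmono (c1 * c2) (dmul k1 k2) :> @dpoly R.
Proof. exact: monalg.fgmulUU. Qed.

Lemma dmul_inj k : injective (dmul k).
Proof.
move=> i j /(congr1 succn); rewrite !dmulS => /eqP.
by rewrite eqn_pmul2l // eqSS => /eqP.
Qed.

Lemma dcoefM_unique p q k1 k2 :
  (forall i j, dcoef p i != 0 -> dcoef q j != 0 -> dmul i j = dmul k1 k2 ->
     i = k1 /\ j = k2) ->
  dcoef (p * q) (dmul k1 k2) = dcoef p k1 * dcoef q k2.
Proof.
move=> uniq12; have [N0 pN0] := dbounded_exists p; have [M0 qM0] := dbounded_exists q.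
pose N := (N0 + k1.+1)%N; pose M := (M0 + k2.+1)%N.
have pN : dbounded p N by move=> k Nk; apply: pN0; exact: leq_trans (leq_addr _ _) Nk.
have qM : dbounded q M by move=> k Nk; apply: qM0; exact: leq_trans (leq_addr _ _) Nk.
have k1N : (k1 < N)%N by exact: leq_addl.
have k2M : (k2 < M)%N by exact: leq_addl.
rewrite {1}(dpolyE pN) {1}(dpolyE qM) mulr_suml dcoef_sum.
under eq_bigr => i _.
  rewrite mulr_sumr dcoef_sum.
  under eq_bigr => j _ do rewrite dmonoM dcoef_mono.
  over.
have term (i : 'I_N) (j : 'I_M) : (i != k1 :> nat) || (j != k2 :> nat) ->
    (dcoef p i * dcoef q j) *+ (dmul i j == dmul k1 k2) = 0.
  move=> ne; have [e|//] := eqVneq (dmul i j) (dmul k1 k2).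
  have [->|pi] := eqVneq (dcoef p i) 0; first by rewrite mul0r.
  have [->|qj] := eqVneq (dcoef q j) 0; first by rewrite mulr0.
  by case: (uniq12 _ _ pi qj e) ne => -> ->; rewrite !eqxx.
rewrite (bigD1 (Ordinal k1N)) //= (bigD1 (Ordinal k2M)) //= eqxx.
rewrite big1 => [|j jk]; last by apply: (term (Ordinal k1N) j); rewrite jk orbT.
rewrite big1 ?addr0 // => i ik; rewrite big1 // => j _.
by apply: (term i j); rewrite ik.
Qed.

Lemma dcoefM_support p q k : dcoef (p * q) k != 0 ->
  exists i j, [/\ dcoef p i != 0, dcoef q j != 0 & k.+1 = (i.+1 * j.+1)%N].
Proof.
rewrite monalg.mcoeff_neq0 => /monalg.msuppM_le[i [j [pi qj ->]]].
by exists i, j; rewrite -!monalg.mcoeff_neq0 in pi qj *; split => //; exact: dmulS.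
Qed.

(** The formal counterpart of [npow n]. *)
Definition dX n : @dpoly R := dmono 1 n.-1.

Lemma deval_dX s n : (0 < n)%N -> deval s (dX n) = npow n s.
Proof. by move=> n0; rewrite deval_mono mul1r prednK. Qed.

Lemma dcoef_dXM n p k : dcoef (dX n * p) (dmul n.-1 k) = dcoef p k.
Proof.
rewrite dcoefM_unique ?dcoef_mono ?eqxx ?mul1r // => i j.
rewrite dcoef_mono; case: (eqVneq n.-1 i) => [<- _ _ e|_]; last by move/eqP/(_ erefl).
by split=> //; exact: dmul_inj e.
Qed.

Lemma dcoef_dXM_support n p k : (0 < n)%N -> dcoef (dX n * p) k != 0 ->
  exists2 j, dcoef p j != 0 & k.+1 = (n * j.+1)%N.
Proof.
move=> n0 /dcoefM_support[i [j [+ pj ->]]]; rewrite dcoef_mono.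
case: (eqVneq _.-1 _) => [<- _|_]; last by move/eqP/(_ erefl).
by exists j; rewrite // prednK.
Qed.

Lemma dcoefCM (c : C) p k : dcoef (dmono c 0 * p) k = c * dcoef p k.
Proof. exact: monalg.mcoeffCM. Qed.

Lemma sum_reindex_le (u : nat -> R) (phi : nat -> nat) N :
  (forall k, 0 <= u k) -> injective phi ->
  exists M, \sum_(k < N) u (phi k) <= \sum_(k < M) u k.
Proof.
move=> u0 phiI; pose s := [seq phi k | k <- iota 0 N].
pose M := (\max_(k <- s) k).+1; exists M.
have us : uniq s by rewrite map_inj_uniq ?iota_uniq.
have sM : {subset s <= iota 0 M}.
  by move=> k ks; rewrite mem_iota add0n ltnS /=; exact: (@leq_bigmax_seq _ _ xpredT id).
rewrite -(big_mkord xpredT (fun k => u (phi k))) -(big_mkord xpredT u).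
rewrite /index_iota !subn0 -(big_map phi xpredT u) -/s.
have pe : perm_eq s [seq k <- iota 0 M | k \in s].
  apply: uniq_perm; rewrite ?filter_uniq ?iota_uniq // => k.
  by rewrite mem_filter; case ks : (k \in s) => //=; rewrite sM.
by rewrite (perm_big _ pe) big_filter big_mkcond /=; apply: ler_sum => k _; case: ifP.
Qed.

Definition abs_ge (sigma : R) p (x : R) := exists N, x <= abs_sum (dcoef p) sigma N.

Lemma abs_ge_dX (sigma : R) p x n : (0 < n)%N -> abs_ge sigma p x ->
  abs_ge sigma (dX n * p) (rpow sigma n * x).
Proof.
move=> n0 [N hN].
have [M hM] := @sum_reindex_le
  (fun k => cabs (dcoef (dX n * p) k) * rpow sigma k.+1) (dmul n.-1) N
  (fun k => mulr_ge0 (cabs_ge0 _) (ltW (rpow_gt0 _ _))) (@dmul_inj _).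
exists M; apply: le_trans hM; rewrite -ler_pdivlMl ?rpow_gt0 //.
apply: le_trans hN _; rewrite ler_pdivlMl ?rpow_gt0 // mulr_sumr.
apply: ler_sum => k _; rewrite dcoef_dXM dmulS prednK // rpowM //.
by rewrite mulrCA.
Qed.

Lemma abs_geZ (sigma : R) p x c : abs_ge sigma p x ->
  abs_ge sigma (dmono c 0 * p) (cabs c * x).
Proof.
move=> [N hN]; exists N; apply: le_trans (ler_wpM2l (cabs_ge0 c) hN) _.
by rewrite mulr_sumr; apply: ler_sum => k _; rewrite dcoefCM cabsM mulrA.
Qed.

Lemma abs_ge_sum n (sigma : R) (p : nat -> @dpoly R) x :
  (forall i, (i < n)%N -> abs_ge sigma (p i) x) ->
  (forall i j k, (i < n)%N -> (j < n)%N -> dcoef (p i) k != 0 ->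
     dcoef (p j) k != 0 -> i = j) ->
  abs_ge sigma (\sum_(i < n) p i) (n%:R * x).
Proof.
elim: n => [|n IH] hx dis; first by exists 0%N; rewrite mul0r /abs_sum big_ord0.
have [|i j k ilt jlt|N hN] := IH.
- by move=> i ilt; apply: hx; rewrite leqW.
- by apply: dis; rewrite leqW.
have [M hM] := hx n (leqnn _).
exists (maxn N M); rewrite -natr1 mulrDl mul1r.
apply: (@le_trans _ _ (abs_sum (dcoef (\sum_(i < n) p i)) sigma (maxn N M)
    + abs_sum (dcoef (p n)) sigma (maxn N M))).
  apply: lerD; first by apply: le_trans hN _; apply: abs_sum_homo; exact: leq_maxl.
  by apply: le_trans hM _; apply: abs_sum_homo; exact: leq_maxr.
rewrite /abs_sum -big_split /=; apply: ler_sum => k _.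
rewrite -mulrDl ler_wpM2r ?(ltW (rpow_gt0 _ _)) //.
rewrite big_ord_recr /= dcoefD.
have [->|pn] := eqVneq (dcoef (p n) k) 0; first by rewrite cabs0 !addr0.
rewrite dcoef_sum big1 ?cabs0 ?add0r // => i _; apply/eqP.
apply: contraT => pi; have := dis i n k (ltnW (ltn_ord i)) (leqnn _) pi pn.
by move=> e; have := ltn_ord i; rewrite {1}e ltnn.
Qed.

End FormalCoefficients.

Section FourierPolynomial.
Context {R : realType}.
Local Notation C := (cplx R).

(** The Fourier matrix is unitary up to a scalar: all its entries have
modulus 1, yet it increases the Euclidean norm by [sqrt N] only. *)
Lemma fourier_parseval N (w : C) (x : 'I_N -> C) : N.-primitive_root w ->
  \sum_(i < N) cabs (\sum_(j < N) w ^+ (i * j) * x j) ^+ 2 =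
  N%:R * \sum_(j < N) cabs (x j) ^+ 2.
Proof.
move=> pw; have N0 := prim_order_gt0 pw.
apply: (@complexI R); rewrite rmorph_sum rmorphM rmorph_nat rmorph_sum /=.
have w1 : `|w| = 1 := norm_unity_root N0 (prim_expr_order pw).
have wconj k : (w ^+ k)^* = w ^- k.
  rewrite -(mulKf (_ : w ^+ k != 0) (_ ^*)).
    by rewrite -normCK normrX w1 !expr1n mulr1.
  by rewrite expf_neq0 // -normr_eq0 w1 oner_eq0.
have T (i : 'I_N) : (cabs (\sum_(j < N) w ^+ (i * j) * x j) ^+ 2)%:C%C =
    \sum_(j < N) \sum_(k < N) (x j * (x k)^*) * ((w ^+ i) ^+ j * (w ^+ i) ^- k) :> C.
  rewrite cabs_sqr_conj rmorph_sum /= big_distrl /=; apply: eq_bigr => j _.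
  rewrite big_distrr /=; apply: eq_bigr => k _.
  by rewrite rmorphM /= wconj -!exprM; ring.
rewrite (eq_bigr _ (fun i _ => T i)) exchange_big /= mulr_sumr.
apply: eq_bigr => j _; rewrite exchange_big /=.
under eq_bigr => k _ do rewrite -mulr_sumr (prim_root_orthogonality _ _ pw).
rewrite (bigD1 j) //= eqxx big1 ?addr0 => [|k kj]; last first.
  by rewrite eq_sym (negPf kj) mul0r mulr0.
by rewrite mul1r cabs_sqr_conj mulrC.
Qed.

Variables (N K : nat) (w : C) (P : nat -> nat).

(** The [i]-th entry of the vector [D_l F D_(l-1) F ... F D_0 1], where [F] is
the Fourier matrix of order [N] and [D_l] is diagonal with entries the monomials
of the [l]-th block of [N] primes. *)
Fixpoint fourier_vec (l i : nat) : @dpoly R :=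
  if l is l'.+1 then
    dX (P (l * N + i)) * \sum_(j < N) dmono (w ^+ (i * j)) 0 * fourier_vec l' j
  else dX (P i).

Hypothesis (pw : N.-primitive_root w).
Variable (m : nat).
Hypothesis (P_prime : forall c, (c < m.+1 * N)%N -> prime (P c)).
Hypothesis (P_inj : forall c d, (c < m.+1 * N)%N -> (d < m.+1 * N)%N -> P c = P d -> c = d).
Hypothesis (P_le : forall c, (c < m.+1 * N)%N -> (P c <= K)%N).

Let idx l i : (l <= m)%N -> (i < N)%N -> (l * N + i < m.+1 * N)%N.
Proof. by move=> lm iN; nia. Qed.

(** The prime of the last block identifies the entry, so that different entries
have no monomial in common. *)
Lemma fourier_vec_support l i k : (l <= m)%N -> (i < N)%N ->
  dcoef (fourier_vec l i) k != 0 ->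
  (P (l * N + i) %| k.+1)%N /\
  forall p, prime p -> (p %| k.+1)%N ->
    exists2 c, ((c < l * N) || (c == l * N + i))%N & p = P c.
Proof.
elim: l i k => [|l IH] i k lm iN /=.
  rewrite dcoef_mono; have Pi := P_prime (idx lm iN); rewrite mul0n add0n in Pi *.
  case: (eqVneq _.-1 _) => [<- _|_]; last by move/eqP/(_ erefl).
  rewrite prednK ?prime_gt0 //; split=> // p pp; rewrite dvdn_prime2 // => /eqP ->.
  by exists i; rewrite ?eqxx ?orbT.
have Pi := P_prime (idx lm iN).
move=> /(dcoef_dXM_support (prime_gt0 Pi))[j]; rewrite dcoef_sum => sj ->.
split; first exact: dvdn_mulr.
move=> p pp; rewrite Euclid_dvdM // dvdn_prime2 // => /orP[/eqP ->|pj].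
  by exists (l.+1 * N + i)%N; rewrite ?eqxx ?orbT.
have [b bj] : exists b : 'I_N, dcoef (fourier_vec l b) j != 0.
  apply: contrapT => /forallNP h; move: sj; rewrite big1 ?eqxx // => b _.
  by rewrite dcoefCM; have /negP/negPn/eqP -> := h b; rewrite mulr0.
have [_ /(_ p pp pj)[c hc ->]] := IH b j (ltnW lm) (ltn_ord b) bj.
exists c => //; move: hc (ltn_ord b); rewrite mulSn; lia.
Qed.

Lemma fourier_vec_disjoint l i j k : (l <= m)%N -> (i < N)%N -> (j < N)%N ->
  dcoef (fourier_vec l i) k != 0 -> dcoef (fourier_vec l j) k != 0 -> i = j.
Proof.
move=> lm iN jN ki kj.
have [Pik _] := fourier_vec_support lm iN ki.
have [_ /(_ _ (P_prime (idx lm iN)) Pik)[c hc]] := fourier_vec_support lm jN kj.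
have := idx lm jN => hj; move/(P_inj (idx lm iN)) => e.
have : (c < m.+1 * N)%N by case/orP: hc => [|/eqP ->//]; lia.
by move/e => {}e; move: hc; rewrite -e; lia.
Qed.

Lemma fourier_vec_abs_ge (sigma : R) l i : 0 <= sigma -> (l <= m)%N -> (i < N)%N ->
  abs_ge sigma (fourier_vec l i) (rpow sigma K ^+ l.+1 * N%:R ^+ l).
Proof.
move=> s0; elim: l i => [|l IH] i lm iN /=.
  have Pi := P_prime (idx lm iN); have PK := P_le (idx lm iN).
  rewrite mul0n add0n in Pi PK.
  exists (P i); rewrite /abs_sum.
  have i1 : ((P i).-1 < P i)%N by rewrite prednK ?prime_gt0.
  rewrite (bigD1 (Ordinal i1)) //= dcoef_mono eqxx cabs1 mul1r mulr1 prednK ?prime_gt0 //.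
  rewrite expr1; apply: ler_wpDr; last by rewrite ler_rpow ?prime_gt0.
  by apply: sumr_ge0 => k _; rewrite mulr_ge0 ?cabs_ge0 // ltW ?rpow_gt0.
have Pi := P_prime (idx lm iN); have PK := P_le (idx lm iN).
have N0 := prim_order_gt0 pw.
have w1 k : cabs (w ^+ k) = 1.
  rewrite cabsX /cabs; have -> : `|w| = 1 := norm_unity_root N0 (prim_expr_order pw).
  by rewrite expr1n.
have wn0 k : w ^+ k != 0 by rewrite -cabs_eq0 w1 oner_eq0.
have := @abs_ge_sum R N sigma (fun j => dmono (w ^+ (i * j)) 0 * fourier_vec l j)
   (rpow sigma K ^+ l.+1 * N%:R ^+ l).
case=> [j jN|a b k aN bN|M hM].
- by have := abs_geZ (w ^+ (i * j)) (IH j (ltnW lm) jN); rewrite w1 mul1r.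
- have E c : dcoef (dmono (w ^+ (i * c)) 0 * fourier_vec l c) k != 0 ->
      dcoef (fourier_vec l c) k != 0.
    by rewrite dcoefCM mulf_eq0 negb_or => /andP[].
  move=> /E ha /E hb; exact: fourier_vec_disjoint (ltnW lm) aN bN ha hb.
have [M' hM'] := abs_ge_dX (prime_gt0 Pi) (ex_intro _ M hM).
exists M'; apply: le_trans hM'; rewrite exprS -mulrA.
apply: ler_pM; rewrite ?(ltW (rpow_gt0 _ _)) //.
- by rewrite mulr_ge0 ?exprn_ge0 // ltW // rpow_gt0.
- by rewrite ler_rpow ?prime_gt0.
- by rewrite [N%:R ^+ l.+1]exprS mulrCA.
Qed.

Lemma fourier_vec_norm s l : C0 R s -> (l <= m)%N ->
  \sum_(i < N) cabs (deval s (fourier_vec l i)) ^+ 2 <= N%:R ^+ l.+1.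
Proof.
move=> s0; have small n : (0 < n)%N -> cabs (npow n s) ^+ 2 <= 1.
  by move=> n0; rewrite cabs_npow exprn_ile1 ?(ltW (rpow_gt0 _ _)) ?rpow_le1 ?(ltW s0).
elim: l => [|l IH] lm.
  rewrite expr1; apply: (@le_trans _ _ (\sum_(i < N) 1)); last first.
    by rewrite sumr_const card_ord.
  apply: ler_sum => i _ /=; have := P_prime (idx lm (ltn_ord i)); rewrite mul0n add0n => Pi.
  by rewrite deval_dX ?prime_gt0 // small ?prime_gt0.
rewrite exprS; apply: le_trans (_ : _ <= N%:R * \sum_(j < N) cabs (deval s (fourier_vec l j)) ^+ 2) _.
  rewrite -(fourier_parseval _ pw); apply: ler_sum => i _ /=.
  have Pi := prime_gt0 (P_prime (idx lm (ltn_ord i))).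
  rewrite rmorphM /= deval_dX // cabsM exprMn.
  rewrite -[leRHS]mul1r; apply: ler_pM; rewrite ?sqr_ge0 ?small //.
  rewrite rmorph_sum /= le_eqVlt; apply/orP; left; apply/eqP; congr (cabs _ ^+ 2).
  by apply: eq_bigr => j _; rewrite rmorphM /= deval_mono npow1 mulr1.
by rewrite ler_wpM2l // IH // ltnW.
Qed.

End FourierPolynomial.

(** * Bounded polynomials with large absolute sums *)

Section LargePolynomial.
Context {R : realType}.
Local Notation C := (cplx R).

(** The sharpness of the exponent 1/2. With [M = 2 * a + 1] blocks of [N] primes
at most [K], the [N ^ M] coefficients of the polynomial are unimodular while its
norm is at most [N ^ (a + 1)], so that the weighted sum of the moduli is at
least [N ^ a * rpow sigma K ^ M] times the norm. The number of primes
up to [K] is [K] up to a logarithmic factor, so that this is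
large when [sigma < 1/2] and [a] is large. *)
Lemma large_dirichlet_polynomial (sigma B : R) (q : nat) :
  0 <= sigma -> sigma < 1 / 2 ->
  exists A : @dpoly R,
    [/\ forall s, C0 R s -> cabs (deval s A) <= 1,
        forall k, dcoef A k != 0 -> forall p, prime p -> (p %| k.+1)%N -> (q < p)%N &
        abs_ge sigma A B].
Proof.
move=> s0 s2.
pose a := (Num.truncn (2 / (1 - 2 * sigma))).+1.
have ha : 1 <= a%:R * (1 - 2 * sigma) - sigma.
  have d0 : 0 < 1 - 2 * sigma by lra.
  by have := truncnS_gt (2 / (1 - 2 * sigma)); rewrite ltr_pdivrMr // -/a; lra.
pose b := (Num.truncn B).+1.
have hb : B <= 2 ^+ b.
  apply: le_trans (ltW (truncnS_gt B)) _; rewrite -natrX ler_nat.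
  by rewrite ltnW // ltn_expl.
(* [K = 2 ^ r] and [N = 2 ^ (r - u)]. With [r = 2 ^ v] and [u] of order [v], the
   [(2 * a + 1) * N] primes required are available up to [K], and the loss [u * a]
   in the exponent is negligible against [r]. *)
have [v hv] := linear_le_exp2 a.+1 ((2 * a + 3) * a.+1 + b + q + 3).
pose r := (2 ^ v)%N; pose u := (v + 2 * a + 3)%N.
have r0 : (0 < r)%N by rewrite expn_gt0.
have ur : (u <= r)%N by rewrite /u /r; nia.
have uab : (u * a + b <= r)%N by rewrite /u /r; nia.
have qvr : (q + v + 2 <= r)%N by rewrite /r; nia.
pose N := (2 ^ (r - u))%N.
have N0 : (0 < N)%N by rewrite expn_gt0.
have prime_count : ((q.+1 + (2 * a).+1 * N) * r.-1.+1 <= 2 ^ r.-1)%N.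
  rewrite prednK // mulnDl.
  have h1 : (q.+1 * r <= 2 ^ (r - 2))%N.
    apply: (@leq_trans (2 ^ q * 2 ^ v)%N); first by rewrite leq_mul // ltn_expl.
    by rewrite -expnD leq_exp2l //; lia.
  have h2 : ((2 * a).+1 * N * r <= 2 ^ (r - 2))%N.
    apply: (@leq_trans (2 ^ (2 * a).+1 * 2 ^ (r - u) * 2 ^ v)%N).
      by rewrite !leq_mul // ltnW // ltn_expl.
    by rewrite -!expnD leq_exp2l // /u; move: ur; rewrite /u; lia.
  have -> : (2 ^ r.-1 = 2 ^ (r - 2) + 2 ^ (r - 2))%N.
    rewrite addnn -mul2n -expnS; congr (2 ^ _)%N.
    by move: qvr; lia.
  exact: leq_add.
have [P [hP P_inj]] := primes_between prime_count.
have P_prime c : (c < (2 * a).+1 * N)%N -> prime (P c) by case/hP.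
have P_le c : (c < (2 * a).+1 * N)%N -> (P c <= 2 ^ r)%N by case/hP; rewrite prednK.
have P_gt c : (c < (2 * a).+1 * N)%N -> (q < P c)%N by case/hP.
have [w pw] := @primitive_root_exists C N N0.
pose vec i := fourier_vec N w P (2 * a) i.
have NR : 0 < N%:R :> R by rewrite ltr0n.
pose c := (N%:R ^+ a.+1 : R)^-1.
have c0 : 0 < c by rewrite invr_gt0 exprn_gt0.
pose A0 : @dpoly R := \sum_(i < N) vec i.
exists (dmono (c%:C%C : C) 0 * A0); split.
- move=> s hs.
  rewrite rmorphM /= deval_mono npow1 mulr1 cabsM cabs_real gtr0_norm //.
  rewrite ler_pdivrMl ?exprn_gt0 // mulr1.
  rewrite -(@ler_pXn2r _ 2) ?nnegrE ?cabs_ge0 ?exprn_ge0 //.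
  have := @fourier_parseval R N w (fun i => deval s (vec i)) pw.
  rewrite (bigD1 (Ordinal N0)) //=.
  under [X in cabs X]eq_bigr => j _ do rewrite mul0n expr0 mul1r.
  rewrite /A0 rmorph_sum /=; set S := \sum_(i < N | i != _) _ => E.
  have S0 : 0 <= S by apply: sumr_ge0 => i _; rewrite sqr_ge0.
  apply: (@le_trans _ _ (N%:R * \sum_(j < N) cabs (deval s (vec j)) ^+ 2)).
    by rewrite -E lerDl.
  apply: le_trans (ler_wpM2l (ltW NR) (fourier_vec_norm pw P_prime hs (leqnn _))) _.
  by rewrite -exprS -exprM; rewrite (_ : (2 * a).+2 = (a.+1 * 2)%N) //; lia.
- move=> k; rewrite dcoefCM mulf_eq0 negb_or => /andP[_].
  rewrite dcoef_sum => sk p pp pk.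
  have [i ik] : exists i : 'I_N, dcoef (vec i) k != 0.
    apply: contrapT => /forallNP h; move: sk; rewrite big1 ?eqxx // => i _.
    by have /negP/negPn/eqP := h i.
  have [_ /(_ p pp pk)[d hd ->]] :=
    fourier_vec_support pw P_prime (leqnn _) (ltn_ord i) ik.
  by apply: P_gt; have := ltn_ord i; move: hd; rewrite mulSn; lia.
have [M hM] : abs_ge sigma A0 (N%:R * (rpow sigma (2 ^ r) ^+ (2 * a).+1 * N%:R ^+ (2 * a))).
  apply: abs_ge_sum => [i iN|i j k iN jN].
    exact: (fourier_vec_abs_ge pw P_prime P_inj P_le).
  exact: (fourier_vec_disjoint pw P_prime P_inj).
have [M' hM'] := abs_geZ (c%:C%C : C) (ex_intro _ M hM).
exists M'; apply: le_trans hM'; rewrite cabs_real gtr0_norm //.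
apply: le_trans hb _.
have -> : c * (N%:R * (rpow sigma (2 ^ r) ^+ (2 * a).+1 * N%:R ^+ (2 * a))) =
    N%:R ^+ a * rpow sigma (2 ^ r) ^+ (2 * a).+1.
  rewrite /c mul2n -addnn exprD exprS; field.
  by rewrite !expf_neq0 ?gt_eqF.
have L0 : 0 < ln 2 :> R by rewrite ln_gt0 // ltr1n.
have E2 : 2 = expR (ln 2) :> R by rewrite lnK // posrE.
have -> : N%:R = expR ((r - u)%:R * ln 2) :> R by rewrite natrX {1}E2 expRM_natl.
have -> : rpow sigma (2 ^ r) = expR (- (sigma * (r%:R * ln 2))).
  by rewrite /rpow natrX lnXn // mulr_natl.
rewrite {1}E2 -!expRM_natl -expRD ler_expR natrB //.
have h1 : u%:R * a%:R + b%:R <= r%:R :> R by rewrite -natrM -natrD ler_nat.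
have h2 : r%:R <= r%:R * (a%:R * (1 - 2 * sigma) - sigma) by rewrite ler_peMr.
have -> : a%:R * ((r%:R - u%:R) * ln 2) + (2 * a).+1%:R * - (sigma * (r%:R * ln 2)) =
  (r%:R * (a%:R * (1 - 2 * sigma) - sigma) - u%:R * a%:R) * ln 2.
  by rewrite -[(2 * a).+1%:R]natr1 [(2 * a)%:R]natrM; ring.
by rewrite ler_wpM2r ?(ltW L0) //; lra.
Qed.

End LargePolynomial.

(** * Coefficients marked by new primes *)

Section MarkedCoefficients.
Context {R : realType}.
Local Notation C := (cplx R).
Implicit Types (p q : @dpoly R).

(** Under the correspondence between primes and variables, [p] is homogeneous of
degree [i] in the variable of [r]. *)
Definition homog (r i : nat) p :=
  forall k, dcoef p k != 0 -> logn r k.+1 = i.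

Lemma homog0 r i : homog r i 0.
Proof. by move=> k; rewrite dcoef0 eqxx. Qed.

Lemma homogD r i p q : homog r i p -> homog r i q -> homog r i (p + q).
Proof.
move=> hp hq k; rewrite dcoefD => pq.
have [p0|/hp //] := eqVneq (dcoef p k) 0.
by apply: hq; move: pq; rewrite p0 add0r.
Qed.

Lemma dcoefMn p n k : dcoef (p *+ n) k = dcoef p k *+ n.
Proof. exact: monalg.mcoeffMn. Qed.

Lemma homogM r i j p q : homog r i p -> homog r j q -> homog r (i + j) (p * q).
Proof.
move=> hp hq k /dcoefM_support[a [b [pa qb ->]]].
by rewrite lognM // (hp _ pa) (hq _ qb).
Qed.

Lemma homogC r c : homog r 0 (dmono c 0).
Proof.
move=> k; rewrite dcoef_mono; case: (eqVneq 0%N k) => [<- _|_].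
  by rewrite logn1.
by rewrite mulr0n eqxx.
Qed.

Lemma homog1 r : homog r 0 1.
Proof. exact: (@homogC r 1). Qed.

Lemma homogX r i p n : homog r i p -> homog r (n * i) (p ^+ n).
Proof.
move=> hp; elim: n => [|n IH]; first exact: homog1.
by rewrite exprS mulSn; exact: homogM.
Qed.

Lemma homogMn r i p n : homog r i p -> homog r i (p *+ n).
Proof.
move=> hp; elim: n => [|n IH]; first by rewrite mulr0n; exact: homog0.
by rewrite mulrS; exact: homogD.
Qed.

Lemma homog_dX r n : (0 < n)%N -> homog r (logn r n) (dX n).
Proof.
move=> n0 k; rewrite dcoef_mono; case: (eqVneq n.-1 k) => [<- _|_].
  by rewrite prednK.
by rewrite mulr0n eqxx.
Qed.

Lemma homog_coef0 r i p k : homog r i p -> logn r k.+1 != i -> dcoef p k = 0.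
Proof. by move=> hp ki; apply/eqP; apply: contraT => /hp e; rewrite e eqxx in ki. Qed.

Lemma logn_small r k : (0 < k)%N -> (k < r)%N -> logn r k = 0%N.
Proof.
move=> k0 kr; have [->//|l0] := posnP (logn r k).
have := l0; rewrite logn_gt0 mem_primes => /and3P[_ _ /(dvdn_leq k0)].
by rewrite leqNgt kr.
Qed.

Lemma homog_small r N p : (N < r)%N -> dbounded p N -> homog r 0 p.
Proof.
move=> Nr pN k pk; apply: logn_small => //; apply: leq_ltn_trans Nr.
by rewrite ltnNge; apply/negP => /pN e; rewrite e eqxx in pk.
Qed.

Lemma dX_M m n : (0 < m)%N -> (0 < n)%N -> dX m * dX n = dX (m * n) :> @dpoly R.
Proof.
move=> m0 n0; rewrite /dX dmonoM mulr1; congr dmono.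
by apply: succn_inj; rewrite dmulS !prednK // muln_gt0 m0.
Qed.

Lemma dX_exp m d : (0 < m)%N -> dX m ^+ d = dX (m ^ d) :> @dpoly R.
Proof.
move=> m0; elim: d => [|d IH] //.
by rewrite exprS IH dX_M ?expn_gt0 ?m0 // expnS.
Qed.

Lemma dmono0_exp (c : C) d : dmono c 0 ^+ d = dmono (c ^+ d) 0 :> @dpoly R.
Proof.
elim: d => [|d IH] //.
by rewrite !exprS IH dmonoM; congr dmono.
Qed.

Lemma coprime_small_rough m x : (0 < m)%N -> (0 < x)%N ->
  (forall p : nat, prime p -> (p %| x)%N -> (m < p)%N) -> coprime m x.
Proof.
move=> m0 x0 hx; rewrite /coprime; apply: contraT => g1.
have g0 : (0 < gcdn m x)%N by rewrite gcdn_gt0 m0.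
have g2 : (1 < gcdn m x)%N by rewrite ltn_neqAle eq_sym g1.
have := hx _ (pdiv_prime g2) (dvdn_trans (pdiv_dvd _) (dvdn_gcdr _ _)).
by rewrite ltnNge dvdn_leq // (dvdn_trans (pdiv_dvd _) (dvdn_gcdl _ _)).
Qed.

(** The monomials [dX r] and [dX r'] of two new primes mark the terms of the
expansion: degree [d] in [r] selects the top coefficient [Rj d], and then
degree 1 in [r'] selects the terms linear in [A]. *)
Lemma marked_coef (r r' d N k1 k2 : nat) (Rj : nat -> @dpoly R) (p0 A : @dpoly R)
    (eta : C) :
  prime r -> prime r' -> (N < r)%N -> (r < r')%N -> (0 < d)%N ->
  (forall j, (j <= d)%N -> dbounded (Rj j) N) -> dbounded p0 N ->
  (forall k, dcoef A k != 0 -> forall p : nat, prime p -> (p %| k.+1)%N -> (r' < p)%N) ->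
  dcoef (Rj d) k1 != 0 -> dcoef A k2 != 0 ->
  dcoef (\sum_(j < d.+1) Rj j * (p0 + dmono eta 0 * (dX r * (1 + dX r' * A))) ^+ j)
    (dmul (r ^ d * r').-1 (dmul k1 k2)) =
  d%:R * eta ^+ d * (dcoef (Rj d) k1 * dcoef A k2).
Proof.
move=> pr pr' Nr rr' d0 RN p0N Ar Rk1 Ak2.
have r0 := prime_gt0 pr; have r'0 := prime_gt0 pr'.
have Nr' : (N < r')%N by exact: ltn_trans rr'.
have neq : (r == r') = false by rewrite ltn_eqF.
have rough x k : dcoef A k != 0 -> prime x -> (x <= r')%N -> logn x k.+1 = 0%N.
  move=> Ak px xr; have [->//|] := posnP (logn x k.+1).
  rewrite logn_gt0 mem_primes => /and3P[_ _ /(Ar k Ak x px)].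
  by rewrite ltnNge xr.
have k1N : (k1.+1 <= N)%N.
  by rewrite ltnNge; apply: contra Rk1 => h; apply/eqP; exact: RN h.
pose T := dX r' * A; pose U := 1 + T.
set k := dmul _ _.
have kE : k.+1 = ((r ^ d * r') * (k1.+1 * k2.+1))%N.
  by rewrite /k !dmulS prednK // muln_gt0 expn_gt0 r0.
have lE x : logn x k.+1 = (d * logn x r + logn x r' + (logn x k1.+1 + logn x k2.+1))%N.
  by rewrite kE !lognM ?lognX // ?muln_gt0 ?expn_gt0 ?r0.
have small x : (N < x)%N -> logn x k1.+1 = 0%N.
  by move=> Nx; rewrite logn_small //; exact: leq_ltn_trans Nx.
have lk : logn r k.+1 = d.
  rewrite lE (logn_prime r pr) (logn_prime r pr') eqxx neq small // (rough r k2) ?(ltnW rr') //.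
  by rewrite !addn0 muln1.
have lk' : logn r' k.+1 = 1%N.
  by rewrite lE (logn_prime r' pr) (logn_prime r' pr') eqxx eq_sym neq small // (rough r' k2) // !addn0 muln0.
have hA x : prime x -> (x <= r')%N -> homog x 0 A by move=> px xr j Aj; exact: rough.
have hU : homog r 0 U.
  apply: homogD (@homog1 _) _; rewrite -[0%N]addn0; apply: homogM.
    have := @homog_dX r r' r'0; by rewrite logn_prime // neq.
  by apply: hA => //; exact: ltnW.
have hT : homog r' 1 T.
  rewrite -[1%N]addn0; apply: homogM; last exact: hA.
  by have := @homog_dX r' r' r'0; rewrite logn_prime // eqxx.
have hY i : homog r i ((dmono eta 0 * (dX r * U)) ^+ i).
  rewrite -[X in homog _ X _]muln1; apply: homogX.
  rewrite -[1%N]add0n; apply: homogM (@homogC _ _) _.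
  rewrite -[1%N]addn0; apply: homogM; last exact: hU.
  by have := @homog_dX r r r0; rewrite logn_prime // eqxx.
(* As [i <= j <= d], degree [d] in [r] is only reached for [i = j = d]. *)
have hterm j i : (j <= d)%N -> homog r i
    (Rj j * (p0 ^+ (j - i) * (dmono eta 0 * (dX r * U)) ^+ i *+ 'C(j, i))).
  move=> jd; rewrite -[X in homog _ X _]add0n; apply: homogM; first exact: homog_small Nr (RN _ jd).
  apply: homogMn; rewrite -[X in homog _ X _]add0n; apply: homogM; last exact: hY.
  by rewrite -(muln0 (j - i)%N); apply: homogX; exact: homog_small Nr p0N.
have -> : dcoef (\sum_(j < d.+1) Rj j * (p0 + dmono eta 0 * (dX r * U)) ^+ j) k =
    dcoef (Rj d * (dmono eta 0 * (dX r * U)) ^+ d) k.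
  rewrite dcoef_sum big_ord_recr /= big1 ?add0r => [|j _].
    rewrite exprDn mulr_sumr dcoef_sum big_ord_recr /= big1 ?add0r => [|i _].
      by rewrite subnn expr0 mul1r binn.
    apply: (homog_coef0 (hterm d i (leqnn _))); rewrite lk.
    by rewrite eq_sym ltn_eqF.
  rewrite exprDn mulr_sumr dcoef_sum big1 // => i _.
  apply: (homog_coef0 (hterm j i (ltnW (ltn_ord j)))); rewrite lk eq_sym ltn_eqF //.
  by apply: leq_ltn_trans (ltn_ord j); rewrite -ltnS.
(* [V] and [1] have degree 0 in [r'], so that only the linear term of the
   expansion of [(1 + T) ^+ d] contributes. *)
pose V := Rj d * (dmono (eta ^+ d) 0 * dX (r ^ d)).
have hV : homog r' 0 V.
  rewrite -[0%N]addn0; apply: homogM; first exact: homog_small Nr' (RN _ (leqnn _)).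
  rewrite -[0%N]addn0; apply: homogM (@homogC _ _) _.
  have := @homog_dX r' (r ^ d); rewrite expn_gt0 r0 lognX logn_prime // [r' == r]eq_sym neq muln0.
  exact.
have -> : Rj d * (dmono eta 0 * (dX r * U)) ^+ d = V * U ^+ d.
  have E (S : comPzRingType) (x y z t : S) :
      x * (y * (z * t)) ^+ d = x * (y ^+ d * z ^+ d) * t ^+ d.
    by rewrite !exprMn !mulrA.
  by rewrite E dmono0_exp dX_exp.
have hterm' i : homog r' i (V * (1 ^+ (d - i) * T ^+ i *+ 'C(d, i))).
  rewrite -[X in homog _ X _]add0n; apply: homogM => //; apply: homogMn.
  rewrite expr1n mul1r -[X in homog _ X _]muln1; exact: homogX.
have -> : dcoef (V * U ^+ d) k = dcoef (V * T *+ d) k.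
  rewrite /U exprDn mulr_sumr dcoef_sum.
  have d1 : (1 < d.+1)%N by rewrite ltnS.
  rewrite (bigD1 (Ordinal d1)) //= big1 ?addr0 => [|i ij].
    by rewrite expr1n mul1r expr1 bin1 mulrnAr.
  by apply: (homog_coef0 (hterm' i)); rewrite lk' eq_sym.
have -> : V * T *+ d = dmono (d%:R * eta ^+ d) 0 * (dX (r ^ d * r') * (Rj d * A)).
  have -> : dmono (d%:R * eta ^+ d) 0 = dmono (eta ^+ d) 0 *+ d :> @dpoly R.
    by apply: dpolyP => j; rewrite dcoefMn !dcoef_mono mulr_natl mulrnAC.
  have E (S : comPzRingType) (x y z u v : S) :
      x * (y * z) * (u * v) *+ d = y *+ d * (z * u * (x * v)).
    by rewrite mulrnAl; congr (_ *+ _); ring.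
  by rewrite -(dX_M (m := (r ^ d)%N)) ?expn_gt0 ?r0 // E.
rewrite dcoefCM dcoef_dXM dcoefM_unique // => i j Ri Aj e.
have iN : (i.+1 <= N)%N.
  by rewrite ltnNge; apply: contra Ri => h; apply/eqP; exact: RN h.
have cop a b : (a.+1 <= N)%N -> dcoef A b != 0 -> coprime b.+1 a.+1.
  move=> aN Ab; rewrite coprime_sym; apply: coprime_small_rough => // p pp pb.
  by apply: leq_ltn_trans aN _; exact: ltn_trans Nr' (Ar b Ab p pp pb).
have {}e : (i.+1 * j.+1 = k1.+1 * k2.+1)%N by rewrite -!dmulS e.
have jk : j = k2.
  apply/eqP; rewrite -eqSS eqn_dvd.
  rewrite -(Gauss_dvdr k2.+1 (cop k1 j k1N Aj)) -e dvdn_mull //=.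
  by rewrite -(Gauss_dvdr j.+1 (cop i k2 iN Ak2)) e dvdn_mull.
split=> //; move/eqP: e; rewrite jk eqn_pmul2r // eqSS => /eqP //.
Qed.

End MarkedCoefficients.

(** * Polynomials in one function with Dirichlet polynomials as coefficients *)

Section PolynomialCombinations.
Context {R : realType}.
Local Notation C := (cplx R).
Implicit Types (f g h : C0 R -> C) (Rj : nat -> @dpoly R).

Lemma approximable_deval (p : @dpoly R) : approximable (fun s => deval (\val s) p).
Proof. by move=> e e0; exists p => s; rewrite subrr cabs0 ltW. Qed.

Lemma approximableD f g : approximable f -> approximable g ->
  approximable (fun s => f s + g s).
Proof.
move=> hf hg e e0; have e20 := divr_gt0 e0 (ltr0Sn _ 1).
have [p hp] := hf _ e20; have [q hq] := hg _ e20.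
exists (p + q) => s; rewrite rmorphD /= opprD addrACA (splitr e).
apply: le_trans (cabsD _ _) _; exact: lerD.
Qed.

Lemma approximableM f g : approximable f -> approximable g ->
  approximable (fun s => f s * g s).
Proof.
move=> hf hg e e0.
have [A A0 hA] := approximable_bounded hf; have [B B0 hB] := approximable_bounded hg.
pose K := A + B + 1; have K0 : 0 < K by rewrite /K; lra.
have d0 : 0 < Num.min 1 (e / K) by rewrite lt_min ltr01 divr_gt0.
set d := Num.min _ _ in d0.
have d1 : d <= 1 by rewrite ge_min lexx.
have dK : d * K <= e by rewrite -ler_pdivlMr // ge_min lexx orbT.
have [p hp] := hf _ d0; have [q hq] := hg _ d0.
exists (p * q) => s; rewrite rmorphM /=.
set x := deval _ p; set y := deval _ q.
have -> : f s * g s - x * y = f s * (g s - y) + (f s - x) * y by ring.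
apply: le_trans (cabsD _ _) _; rewrite !cabsM.
have hy : cabs y <= B + 1.
  apply: le_trans (cabs_dist _ (g s)) _; apply: lerD => //.
  by rewrite cabsB; exact: le_trans (hq s) d1.
have h1 : cabs (f s) * cabs (g s - y) <= A * d by apply: ler_pM; rewrite ?cabs_ge0.
have h2 : cabs (f s - x) * cabs y <= d * (B + 1) by apply: ler_pM; rewrite ?cabs_ge0.
by apply: le_trans dK; rewrite /K; lra.
Qed.

Lemma approximableX f n : approximable f -> approximable (fun s => f s ^+ n).
Proof.
move=> hf; elim: n => [|n IH] e e0.
  by exists 1 => s; rewrite rmorph1 subrr cabs0 ltW.
have [p hp] := approximableM hf IH e0; exists p => s; rewrite exprS; exact: hp.
Qed.

Lemma approximable_sum n (F : nat -> C0 R -> C) :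
  (forall i, approximable (F i)) -> approximable (fun s => \sum_(i < n) F i s).
Proof.
move=> hF; elim: n => [|n IH] e e0.
  by exists 0 => s; rewrite big_ord0 rmorph0 subrr cabs0 ltW.
have [p hp] := approximableD IH (hF n) e0.
by exists p => s; rewrite big_ord_recr /=; exact: hp.
Qed.

(** Coefficients in the Dirichlet polynomials, rather than numbers, are allowed
because the polynomials in several functions [npow c * f] are of this form. *)
Definition pcomb Rj d f : C0 R -> C :=
  fun s => \sum_(j < d.+1) deval (\val s) (Rj j) * f s ^+ j.

Lemma approximable_pcomb Rj d f : approximable f -> approximable (pcomb Rj d f).
Proof.
move=> hf; apply: (@approximable_sum d.+1 (fun j s => deval (\val s) (Rj j) * f s ^+ j)).
by move=> j; apply: approximableM; [exact: approximable_deval|exact: approximableX].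
Qed.

Lemma pcomb_lipschitz Rj d f g (B E delta : R) : 1 <= E ->
  (forall j (s : C0 R), (j <= d)%N -> cabs (deval (\val s) (Rj j)) <= B) ->
  (forall s, cabs (f s) <= E) -> (forall s, cabs (g s) <= E) ->
  (forall s, cabs (f s - g s) <= delta) ->
  forall s, cabs (pcomb Rj d f s - pcomb Rj d g s) <=
    d.+1%:R * (B * (d%:R * E ^+ d)) * delta.
Proof.
move=> E1 hB hf hg hd s.
have E0 : 0 <= E by apply: le_trans E1.
have B0 : 0 <= B by apply: le_trans (hB 0%N s (leq0n _)); exact: cabs_ge0.
have -> : d.+1%:R * (B * (d%:R * E ^+ d)) * delta =
    \sum_(j < d.+1) B * (d%:R * E ^+ d * delta).
  by rewrite sumr_const card_ord -[RHS]mulr_natl; ring.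
rewrite /pcomb -sumrB; apply: le_trans (cabs_sum _ _ _) _.
apply: ler_sum => j _; have jd : (j <= d)%N by rewrite -ltnS.
rewrite -mulrBr cabsM; apply: ler_pM; rewrite ?cabs_ge0 ?hB //.
apply: le_trans (cabs_expB_le _ (hf s) (hg s) E1) _.
apply: ler_pM; rewrite ?cabs_ge0 ?mulr_ge0 ?exprn_ge0 //.
by apply: ler_pM; rewrite ?exprn_ge0 ?ler_nat // ler_weXn2l.
Qed.

Lemma pcomb_deval Rj d (p : @dpoly R) (s : C0 R) :
  pcomb Rj d (fun s => deval (\val s) p) s = deval (\val s) (\sum_(j < d.+1) Rj j * p ^+ j).
Proof.
by rewrite rmorph_sum /=; apply: eq_bigr => j _; rewrite rmorphM rmorphXn.
Qed.

(** A bounded set of polynomials in one variable with Dirichlet polynomials as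
coefficients, of positive degree and with top coefficient bounded away from 0.
As [n] grows these sets exhaust all polynomials of positive degree. *)
Definition family n d Rj :=
  [/\ (0 < d <= n)%N, forall j, (j <= d)%N -> dbounded (Rj j) n,
      forall j k, (j <= d)%N -> cabs (dcoef (Rj j) k) <= n%:R &
      exists k, n.+1%:R^-1 <= cabs (dcoef (Rj d) k)].

Lemma family_deval_le n d Rj j (s : C0 R) : family n d Rj -> (j <= d)%N ->
  cabs (deval (\val s) (Rj j)) <= n%:R * n%:R.
Proof.
move=> [_ hN hc _] jd; rewrite (devalE _ (hN j jd)).
have -> : n%:R * n%:R = \sum_(k < n) n%:R :> R by rewrite sumr_const card_ord mulr_natl.
apply: le_trans (cabs_sum _ _ _) _; apply: ler_sum => k _.
rewrite cabsM cabs_npow -[leRHS]mulr1; apply: ler_pM; rewrite ?cabs_ge0 ?hc //.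
  exact: ltW (rpow_gt0 _ _).
by rewrite rpow_le1 // ltW //; exact: C0_val.
Qed.

Definition sig n : R := 1 / 2 - (2 * n.+1%:R)^-1.

Lemma sig_ge0 n : 0 <= sig n.
Proof.
rewrite /sig subr_ge0 mul1r lef_pV2 ?posrE ?mulr_gt0 ?ltr0n //.
by rewrite ler_peMr // ler1n.
Qed.

Lemma sig_lt n : sig n < 1 / 2.
Proof. by rewrite /sig gtrBl invr_gt0 mulr_gt0 // ltr0n. Qed.

(** Only finitely many coefficients are involved, which makes this condition
stable under small uniform perturbations of [f]. *)
Definition good n f := forall d Rj, family n d Rj ->
  forall a, has_coefs (pcomb Rj d f) a -> exists N, n%:R <= abs_sum a (sig n) N.

Lemma dboundedM (p q : @dpoly R) M N : dbounded p M -> dbounded q N ->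
  dbounded (p * q) (M * N).
Proof.
move=> pM qN k MNk; apply/eqP; apply: contraT => /dcoefM_support[i [j [pi qj kE]]].
have iM : (i < M)%N by rewrite ltnNge; apply: contra pi => /pM ->.
have jN : (j < N)%N by rewrite ltnNge; apply: contra qj => /qN ->.
have kMN : (k.+1 <= M * N)%N by rewrite kE leq_mul.
by have := leq_trans kMN MNk; rewrite ltnn.
Qed.

Lemma dboundedX (p : @dpoly R) N j : dbounded p N -> dbounded (p ^+ j) (N ^ j).
Proof.
move=> pN; elim: j => [|j IH]; last by rewrite exprS expnS; exact: dboundedM.
by case=> // k _; exact: (dcoef_mono 1 0 k.+1).
Qed.

Lemma dbounded_leq (p : @dpoly R) M N : (M <= N)%N -> dbounded p M -> dbounded p N.
Proof. by move=> MN pM k Nk; apply: pM; exact: leq_trans Nk. Qed.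

(** The first [N] coefficients of [pcomb Rj d f] differ by at most [eps] from
those of [F d Rj], whose absolute sum has 1 to spare. *)
Lemma good_of_near n f g (F : nat -> (nat -> @dpoly R) -> @dpoly R) (N : nat) (eps : R) :
  N%:R * eps <= 1 -> 0 <= eps ->
  (forall d Rj, family n d Rj -> forall s : C0 R, pcomb Rj d g s = deval (\val s) (F d Rj)) ->
  (forall d Rj, family n d Rj -> n.+1%:R <= abs_sum (dcoef (F d Rj)) (sig n) N) ->
  (forall d Rj, family n d Rj -> forall s,
     cabs (pcomb Rj d f s - pcomb Rj d g s) <= eps) ->
  good n f.
Proof.
move=> Neps eps0 gF Fge fg d Rj fam a ha; exists N.
have ab k : cabs (a k - dcoef (F d Rj) k) <= eps.
  by apply: cabs_coef_le ha _ => // s; rewrite -gF //; exact: fg.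
rewrite -(lerD2r 1) natr1; apply: le_trans (Fge d Rj fam) _.
apply: (@le_trans _ _ (abs_sum a (sig n) N + N%:R * eps)); last by rewrite lerD2l.
have -> : N%:R * eps = \sum_(k < N) eps by rewrite sumr_const card_ord mulr_natl.
rewrite /abs_sum -big_split /=; apply: ler_sum => k _.
have := cabs_dist (dcoef (F d Rj) k) (a k); rewrite cabsB => h.
apply: (@le_trans _ _ ((cabs (a k) + eps) * rpow (sig n) k.+1)).
  by rewrite ler_wpM2r ?(ltW (rpow_gt0 _ _)) //; apply: le_trans h _; rewrite lerD2l.
by rewrite mulrDl lerD2l ler_piMr // rpow_le1 // sig_ge0.
Qed.

End PolynomialCombinations.

(** * Density of the good functions *)

Section Density.
Context {R : realType}.
Local Notation C := (cplx R).

(** The coefficients at the multiples of [r ^ d * r' * k1.+1] reproduce those of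
[A], up to a factor that does not depend on [A] and is bounded below over the
whole of [family n]. *)
Lemma perturbed_abs_ge n d k1 r r' N (Rj : nat -> @dpoly R) (p0 A : @dpoly R)
    (eta B : R) :
  prime r -> prime r' -> (N < r)%N -> (r < r')%N -> (n <= N)%N ->
  (0 < d <= n)%N -> (forall j, (j <= d)%N -> dbounded (Rj j) n) -> dbounded p0 N ->
  (forall k, dcoef A k != 0 -> forall p : nat, prime p -> (p %| k.+1)%N -> (r' < p)%N) ->
  0 < eta -> eta <= 1 -> n.+1%:R^-1 <= cabs (dcoef (Rj d) k1) ->
  0 <= B -> abs_ge (sig n) A B ->
  abs_ge (sig n)
    (\sum_(j < d.+1) Rj j * (p0 + dmono eta%:C%C 0 * (dX r * (1 + dX r' * A))) ^+ j)
    (eta ^+ n * n.+1%:R^-1 * rpow (sig n) (r ^ n * r' * N) * B).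
Proof.
move=> pr pr' Nr rr' nN /andP[d0 dn] RN p0N Ar eta0 eta1 hk1 B0 [NA hA].
set F := \sum_(j < _) _.
have Rk1 : dcoef (Rj d) k1 != 0.
  by rewrite -cabs_gt0; apply: lt_le_trans hk1; rewrite invr_gt0.
have k1n : (k1.+1 <= N)%N.
  apply: leq_trans nN; rewrite ltnNge; apply: contra Rk1 => h; apply/eqP; exact: RN h.
pose phi k2 := dmul (r ^ d * r').-1 (dmul k1 k2).
have phiI : injective phi by move=> i j /dmul_inj/dmul_inj.
have [M hM] := @sum_reindex_le R (fun k => cabs (dcoef F k) * rpow (sig n) k.+1) phi NA
  (fun k => mulr_ge0 (cabs_ge0 _) (ltW (rpow_gt0 _ _))) phiI.
exists M; apply: le_trans hM.
set c := eta ^+ n * _ * rpow _ _.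
have c0 : 0 <= c by rewrite !mulr_ge0 ?exprn_ge0 ?invr_ge0 ?(ltW (rpow_gt0 _ _)) ?(ltW eta0).
apply: le_trans (ler_wpM2l c0 hA) _; rewrite mulr_sumr; apply: ler_sum => k2 _.
have [Ak|Ak] := eqVneq (dcoef A k2) 0.
  by rewrite Ak cabs0 mul0r mulr0 mulr_ge0 ?cabs_ge0 ?(ltW (rpow_gt0 _ _)).
have RN' j : (j <= d)%N -> dbounded (Rj j) N.
  by move=> jd; apply: dbounded_leq (RN j jd).
rewrite /F (marked_coef _ pr pr' Nr rr' d0 RN' p0N Ar Rk1 Ak).
have r0 := prime_gt0 pr; have r'0 := prime_gt0 pr'.
have rd0 : (0 < r ^ d * r')%N by rewrite muln_gt0 expn_gt0 r0.
have rdk0 : (0 < r ^ d * r' * k1.+1)%N by rewrite muln_gt0 rd0.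
rewrite /phi !dmulS prednK // mulnA rpowM //.
rewrite !cabsM cabs_nat cabsX cabs_real gtr0_norm //.
have -> : c * (cabs (dcoef A k2) * rpow (sig n) k2.+1) =
  (cabs (dcoef A k2) * rpow (sig n) k2.+1) * c by rewrite mulrC.
set y := cabs (dcoef A k2); set z := rpow _ k2.+1; set t := rpow _ (_ * k1.+1).
have -> : d%:R * eta ^+ d * (cabs (dcoef (Rj d) k1) * y) * (t * z) =
  (y * z) * (d%:R * (eta ^+ d * cabs (dcoef (Rj d) k1) * t)) by ring.
rewrite ler_wpM2l ?mulr_ge0 ?cabs_ge0 ?(ltW (rpow_gt0 _ _)) //.
have tc : rpow (sig n) (r ^ n * r' * N) <= t.
  apply: ler_rpow rdk0 _; first exact: sig_ge0.
  by rewrite !leq_mul // leq_pexp2l.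
have ec : eta ^+ n <= eta ^+ d by rewrite ler_wiXn2l // ltW.
apply: (@le_trans _ _ (1 * (eta ^+ d * cabs (dcoef (Rj d) k1) * t))).
  rewrite mul1r; apply: ler_pM; rewrite ?(ltW (rpow_gt0 _ _)) //.
    by rewrite mulr_ge0 ?exprn_ge0 ?invr_ge0 ?(ltW eta0).
  by apply: ler_pM; rewrite ?exprn_ge0 ?invr_ge0 ?(ltW eta0).
rewrite ler_wpM2r ?ler1n // !mulr_ge0 ?exprn_ge0 ?cabs_ge0 ?(ltW (rpow_gt0 _ _)) ?(ltW eta0) //.
Qed.

(** Near every [f] there is a Dirichlet polynomial around which [good n] holds
on a whole ball: a small perturbation by [eta * r^-s * (1 + r'^-s * A)], with new
primes [r] and [r'] and a polynomial [A] of norm at most 1 and large absolute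
sum, makes all the combinations of [family n] large at once. *)
Lemma good_dense n (f : C0 R -> C) (e : R) : approximable f -> 0 < e ->
  exists g, [/\ approximable g, forall s, cabs (f s - g s) <= e &
    exists2 delta : R, 0 < delta &
      forall h, (forall s, cabs (h s - g s) <= delta) -> good n h].
Proof.
move=> hf e0.
have [p0 hp0] := hf _ (divr_gt0 e0 (ltr0Sn _ 1)).
have [N0 p0N0] := dbounded_exists p0.
pose N := maxn N0 n.
have p0N : dbounded p0 N by apply: dbounded_leq p0N0; exact: leq_maxl.
have [r Nr pr] := prime_above N; have [r' rr' pr'] := prime_above r.
pose eta : R := Num.min (e / 4) 1.
have eta0 : 0 < eta by rewrite lt_min ltr01 divr_gt0.
have eta1 : eta <= 1 by rewrite ge_min lexx orbT.
have etae : eta <= e / 4 by rewrite ge_min lexx.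
pose c : R := eta ^+ n * n.+1%:R^-1 * rpow (sig n) (r ^ n * r' * N).
have c0 : 0 < c by rewrite !mulr_gt0 ?exprn_gt0 ?invr_gt0 ?rpow_gt0.
(* [c] depends on [r'] but not on [A], which is chosen last. *)
pose B : R := n.+1%:R / c.
have B0 : 0 <= B by rewrite divr_ge0 // ltW.
have [A [A1 Ar AB]] := large_dirichlet_polynomial B r' (sig_ge0 n) (sig_lt n).
pose gp : @dpoly R := p0 + dmono eta%:C%C 0 * (dX r * (1 + dX r' * A)).
pose g : C0 R -> C := fun s => deval (\val s) gp.
have npow_le1 x (s : C0 R) : (0 < x)%N -> cabs (npow x (\val s)) <= 1.
  by move=> x0; rewrite cabs_npow rpow_le1 // ltW //; exact: C0_val.
have pert (s : C0 R) : cabs (deval (\val s) p0 - g s) <= 2 * eta.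
  rewrite /g /gp rmorphD opprD addrA subrr sub0r cabsN !rmorphM /= deval_mono npow1 mulr1.
  rewrite deval_dX ?prime_gt0 // rmorphD rmorph1 rmorphM /= deval_dX ?prime_gt0 //.
  rewrite !cabsM cabs_real gtr0_norm // mulrC ler_pM2r //.
  rewrite -[leRHS]mul1r; apply: ler_pM; rewrite ?cabs_ge0 ?npow_le1 ?prime_gt0 //.
  apply: le_trans (cabsD _ _) _; rewrite cabs1 cabsM lerD2l -[leRHS]mulr1.
  by apply: ler_pM; rewrite ?cabs_ge0 ?npow_le1 ?prime_gt0 // A1 //; exact: C0_val.
have hg : approximable g by exact: approximable_deval.
have [Ng gpN] := dbounded_exists gp.
have gpN' : dbounded gp Ng.+1 by apply: dbounded_leq gpN.
pose N1 := (n * Ng.+1 ^ n)%N.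
have [E0 E00 hE0] := approximable_bounded hg.
pose E := E0 + 1; have E1 : 1 <= E by rewrite /E lerDr ltW.
pose L : R := n.+1%:R * (n%:R * n%:R * (n%:R * E ^+ n)).
have L0 : 0 <= L by rewrite !mulr_ge0 ?exprn_ge0 // (le_trans _ E1).
have N1L : 0 < N1%:R * L + 1 by rewrite ltr_wpDl // mulr_ge0.
pose delta := Num.min 1 (N1%:R * L + 1)^-1.
have delta0 : 0 < delta by rewrite lt_min ltr01 invr_gt0.
have delta1 : delta <= 1 by rewrite ge_min lexx.
exists g; split=> // [s|].
  apply: le_trans (cabs_distD (deval (\val s) p0) _ _) _.
  by have := hp0 s; have := pert s; lra.
exists delta => // h hh.
pose F d (Rj : nat -> @dpoly R) := \sum_(j < d.+1) Rj j * gp ^+ j.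
apply: (@good_of_near R n h g F N1 (L * delta)).
- rewrite mulrA; apply: (@le_trans _ _ ((N1%:R * L + 1) * (N1%:R * L + 1)^-1)).
    apply: ler_pM; first by rewrite mulr_ge0.
    - exact: ltW.
    - by rewrite lerDl.
    - by rewrite ge_min lexx orbT.
  by rewrite divff // gt_eqF.
- by rewrite mulr_ge0 // ltW.
- by move=> d Rj _ s; exact: pcomb_deval.
- move=> d Rj [dn RN Rc [k1 hk1]].
  have [M hM] := perturbed_abs_ge pr pr' Nr rr' (leq_maxr _ _) dn RN p0N Ar eta0 eta1 hk1 B0 AB.
  have FN : dbounded (F d Rj) N1.
    move=> k Nk; rewrite dcoef_sum big1 // => j _.
    have jd : (j <= d)%N by rewrite -ltnS.
    have Fj := @dboundedM R _ _ _ _ (RN j jd) (@dboundedX R _ _ j gpN').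
    apply: Fj; apply: leq_trans Nk.
    by rewrite /N1 leq_mul2l leq_pexp2l ?orbT //; case/andP: dn => _; exact: leq_trans jd.
  apply: le_trans (@sum_dcoef_bounded R _ M N1 (fun c k => cabs c * rpow (sig n) k.+1) _ _ FN).
  + apply: le_trans hM; rewrite -/c /B mulrC divfK // gt_eqF //.
  + by move=> k; rewrite cabs0 mul0r.
  + by move=> a k; rewrite mulr_ge0 ?cabs_ge0 ?(ltW (rpow_gt0 _ _)).
- move=> d Rj fam s.
  have hhE t : cabs (h t) <= E.
    apply: le_trans (cabs_dist _ (g t)) _; apply: lerD; first exact: hE0.
    exact: le_trans (hh t) delta1.
  have hgE t : cabs (g t) <= E by apply: le_trans (hE0 t) _; rewrite /E lerDl.
  apply: le_trans (pcomb_lipschitz E1 _ hhE hgE hh s) _.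
    by move=> j t jd; exact: family_deval_le fam jd.
  have /andP[d0 dn] : (0 < d <= n)%N by case: fam.
  have E0' : 0 <= E by apply: le_trans E1.
  rewrite ler_wpM2r ?(ltW delta0) // /L.
  apply: ler_pM; rewrite ?mulr_ge0 ?exprn_ge0 ?ler_nat //.
  apply: ler_wpM2l; rewrite ?mulr_ge0 //.
  by apply: ler_pM; rewrite ?exprn_ge0 ?ler_nat // ler_weXn2l.
Qed.

End Density.

(** * The Baire category argument *)

Section BaireCategory.
Context {R : realType}.
Local Notation C := (cplx R).
Implicit Types (D : AC0 R).

Definition fun_of (D : AC0 R) : C0 R -> C := \val D.

Lemma approximable_fun_of D : approximable (fun_of D).
Proof. by apply/AC0P; exact: (set_mem (valP D)). Qed.

Lemma fun_of_surj (f : C0 R -> C) : approximable f -> exists D, fun_of D = f.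
Proof.
by move=> /AC0P hf; exists (SigSub (mem_set (hf : AC0 R (f : {uniform C0 R -> C})))).
Qed.

(** Pointwise bounds are easier to handle than the supremum norm, and describe
the same neighbourhoods. *)
Lemma AC0_nbhsP D (U : set (AC0 R)) : nbhs D U <->
  exists2 e : R, 0 < e &
    forall E : AC0 R, (forall s, cabs (fun_of E s - fun_of D s) <= e) -> U E.
Proof.
have C1 : exists t : C0 R, True by have [t _] := C0P (ltr01 : C0 R (1 : C)); exists t.
split=> [/nbhs_AC0_supnorm[e e0 hU]|[e e0 hU]].
  exists (e / 2); first by rewrite divr_gt0.
  move=> E hE; apply: hU; apply: (@le_lt_trans _ _ (e / 2)); last first.
    by rewrite ltr_pdivrMr // ltr_pMr // ltr1n.
  apply: ge_sup; first by have [t _] := C1; eexists; exists t.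
  by move=> _ [s _ <-]; exact: hE.
apply/nbhs_AC0_supnorm; exists e => // E hE; apply: hU => s.
apply: ltW; apply: le_lt_trans hE; apply: ub_le_sup; last by exists s.
have [M _ hM] := approximable_bounded (approximable_fun_of E).
have [N _ hN] := approximable_bounded (approximable_fun_of D).
exists (M + N) => _ [t _ <-]; apply: le_trans (cabsD _ _) _.
by rewrite cabsN; apply: lerD; [exact: hM|exact: hN].
Qed.

Lemma AC0_complete (f : nat -> C0 R -> C) (e : nat -> R) :
  (forall n, approximable (f n)) ->
  (forall n m s, (n <= m)%N -> cabs (f m s - f n s) <= e n) ->
  (forall b, 0 < b -> exists n, e n <= b) ->
  exists2 g, approximable g & forall n s, cabs (g s - f n s) <= e n.
Proof.
move=> hf fe e0.
have /choice[g hg] s : exists l : C, forall b, 0 < b -> exists N, forall n, (N <= n)%N ->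
    cabs (l - f n s) <= b.
  apply: complex_cauchy_limit => b b0.
  have [N hN] := e0 _ (divr_gt0 b0 (ltr0Sn _ 1)).
  exists N => m n Nm Nn; apply: le_trans (cabs_distD (f N s) _ _) _.
  rewrite (splitr b); apply: lerD; first exact: le_trans (fe _ _ s Nm) hN.
  by rewrite cabsB; exact: le_trans (fe _ _ s Nn) hN.
have gf n s : cabs (g s - f n s) <= e n.
  apply/ler_addgt0Pr => b b0; have [N hN] := hg s b b0.
  apply: le_trans (cabs_distD (f (maxn N n) s) _ _) _; rewrite addrC.
  by apply: lerD; [exact: fe (leq_maxr _ _)|exact: hN (leq_maxl _ _)].
exists g => // b b0; have [n hn] := e0 _ (divr_gt0 b0 (ltr0Sn _ 1)).
have [p hp] := hf n _ (divr_gt0 b0 (ltr0Sn _ 1)).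
exists p => s; apply: le_trans (cabs_distD (f n s) _ _) _.
rewrite (splitr b); apply: lerD => //; exact: le_trans (gf n s) hn.
Qed.

(** Baire's argument: nested balls whose radii tend to 0 have a common point. *)
Lemma AC0_baire (S : nat -> set (AC0 R)) :
  (forall n D (e : R), 0 < e -> exists E, (forall s, cabs (fun_of D s - fun_of E s) <= e) /\
     nbhs E (S n)) ->
  dense (\bigcap_n (interior (S n))).
Proof.
move=> hS O [D0 OD0] oO.
have [e0 e00 ball0] : exists2 e : R, 0 < e &
    forall E : AC0 R, (forall s, cabs (fun_of E s - fun_of D0 s) <= e) -> O E.
  by apply/AC0_nbhsP; apply: open_nbhs_nbhs.
pose state := {De : AC0 R * R | 0 < De.2}.
have /choice[step hstep] (nx : nat * state) : exists y : state,
    [/\ (sval y).2 <= (sval nx.2).2 / 2,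
        forall s, cabs (fun_of (sval nx.2).1 s - fun_of (sval y).1 s) <= (sval nx.2).2 / 2 &
        forall E, (forall s, cabs (fun_of E s - fun_of (sval y).1 s) <= (sval y).2) ->
          interior (S nx.1) E].
  case: nx => n [[D e] /= he]; have e20 := divr_gt0 he (ltr0Sn _ 1).
  have [E [DE /AC0_nbhsP[d d0 hd]]] := hS n D _ e20.
  have y0 : 0 < Num.min (d / 2) (e / 2) by rewrite lt_min e20 divr_gt0.
  exists (exist _ (E, Num.min (d / 2) (e / 2)) y0); split=> //=.
    by rewrite ge_min lexx orbT.
  move=> E' hE'; apply/AC0_nbhsP; exists (d / 2); first by rewrite divr_gt0.
  move=> E'' hE''; apply: hd => s; apply: le_trans (cabs_distD (fun_of E' s) _ _) _.
  rewrite (splitr d); apply: lerD; first exact: hE''.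
  by apply: le_trans (hE' s) _; rewrite ge_min lexx.
pose x := fix x n : state := if n is n'.+1 then step (n', x n') else exist _ (D0, e0) e00.
pose f n := fun_of (sval (x n)).1; pose e n := (sval (x n)).2.
have eS n : e n.+1 <= e n / 2 by have [+ _ _] := hstep (n, x n).
have fS n s : cabs (f n s - f n.+1 s) <= e n / 2 by have [_ + _] := hstep (n, x n); exact.
have epos n : 0 < e n := svalP (x n).
have fe n m s : (n <= m)%N -> cabs (f m s - f n s) <= e n - e m.
  elim: m => [|m IH]; first by rewrite leqn0 => /eqP ->; rewrite !subrr cabs0.
  rewrite leq_eqVlt => /orP[/eqP <-|]; first by rewrite !subrr cabs0.
  rewrite ltnS => /IH nm; apply: le_trans (cabs_distD (f m s) _ _) _.
  by have := fS m s; rewrite cabsB; have := eS m; lra.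
have e_small b : 0 < b -> exists n, e n <= b.
  move=> b0; have eb n : e n * 2 ^+ n <= e0.
    elim: n => [|n IH]; first by rewrite mulr1.
    apply: le_trans IH; rewrite exprS mulrA ler_wpM2r ?exprn_ge0 //.
    by have := eS n; lra.
  exists (Num.truncn (e0 / b)).+1; set n := _.+1.
  have h1 : e0 / b <= 2 ^+ n.
    apply: le_trans (ltW (truncnS_gt _)) _; rewrite -natrX ler_nat -/n.
    by rewrite ltnW // ltn_expl.
  have h2 : 0 < 2 ^+ n :> R by rewrite exprn_gt0.
  rewrite -(ler_pM2r h2); apply: le_trans (eb n) _.
  by rewrite mulrC -ler_pdivrMr.
have [g hg gf] : exists2 g, approximable g & forall n s, cabs (g s - f n s) <= e n.
  apply: AC0_complete => // [n|n m s nm]; first exact: approximable_fun_of.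
  by apply: le_trans (fe n m s nm) _; rewrite gerBl ltW.
have [E gE] := fun_of_surj hg.
exists E; split; first by apply: ball0 => s; rewrite gE; exact: (gf 0%N).
move=> n _; have [_ _] := hstep (n, x n); apply=> s; rewrite gE; exact: (gf n.+1).
Qed.

Definition generic : set (AC0 R) :=
  \bigcap_n (interior [set D | good n (fun_of D)]).

Lemma generic_dense : dense generic.
Proof.
apply: AC0_baire => n D e e0.
have [g [hg Dg [d d0 hd]]] := good_dense n (approximable_fun_of D) e0.
have [E gE] := fun_of_surj hg; exists E; split=> [s|]; first by rewrite gE.
by apply/AC0_nbhsP; exists d => // E' hE'; apply: hd; rewrite -gE.
Qed.

Lemma generic_Gdelta : Gdelta generic.
Proof.
exists (fun n => interior [set D | good n (fun_of D)]) => // n.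
exact: open_interior.
Qed.

Lemma generic_good D : generic D -> forall n, good n (fun_of D).
Proof. by move=> hD n; exact: interior_subset (hD n I). Qed.

End BaireCategory.

(** * Generated algebras and generic functions *)

Section GeneratedAlgebra.
Context {T : Type} {K : fieldType}.
Implicit Types (X : set (T -> K)).

Lemma meval_at0 n (Q : mpoly.mpoly n K) :
  mpoly.meval (fun=> 0) Q = mpoly.mcoeff mpoly.mnm0 Q.
Proof.
rewrite mpoly.mevalE.
have E (m : mpoly.multinom n) : \prod_(i < n) (0 : K) ^+ m i = (m == mpoly.mnm0)%:R.
  have [->|m0] := eqVneq m; first by rewrite big1 // => i _; rewrite mpoly.mnm0E expr0.
  have [i mi] : exists i, m i != 0%N.
    apply: contrapT => /forallNP h; move/eqP: m0; apply; apply/mpoly.mnmP => i.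
    by rewrite mpoly.mnm0E; apply/eqP; apply: contrapT => /negP; exact: h.
  by rewrite (bigD1 i) //= expr0n (negPf mi) mul0r.
under eq_bigr do rewrite E.
have [Q0|Q0] := boolP (mpoly.mnm0 \in mpoly.msupp Q).
  rewrite (bigD1_seq _ Q0 (mpoly.msupp_uniq Q)) /= eqxx mulr1 big1 ?addr0 // => m m0.
  by rewrite (negPf m0) mulr0.
rewrite (mpoly.memN_msupp_eq0 Q0) big_seq big1 // => m mQ.
have [e|_] := eqVneq m; last by rewrite mulr0.
by rewrite e (negPf Q0) in mQ.
Qed.

Lemma generated_algebra0 X : generated_algebra X (cst 0).
Proof.
exists 0%N, (fun i => cst 0), 0; split=> [[]//||]; first exact: mpoly.mcoeff0.
by apply/funext => t; rewrite /poly_eval mpoly.meval0.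
Qed.

Lemma generated_algebraZ X (c : K) f :
  generated_algebra X f -> generated_algebra X (fun t => c * f t).
Proof.
move=> [n [x [Q [Xx Q0 ->]]]]; exists n, x, (c *: Q); split=> //.
  by rewrite mpoly.mcoeffZ Q0 mulr0.
by apply/funext => t; rewrite /poly_eval mpoly.mevalZ.
Qed.

(** Concatenating the families of generators reduces sums and products to those
of polynomials in the same variables. *)
Lemma generated_algebra_join X f g :
  generated_algebra X f -> generated_algebra X g ->
  exists n (x : 'I_n -> T -> K) (P Q : mpoly.mpoly n K),
    [/\ forall i, X (x i), mpoly.mcoeff mpoly.mnm0 P = 0, mpoly.mcoeff mpoly.mnm0 Q = 0,
        f = poly_eval P x & g = poly_eval Q x].
Proof.
move=> [n1 [x1 [P [X1 P0 ->]]]] [n2 [x2 [Q [X2 Q0 ->]]]].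
pose x (i : 'I_(n1 + n2)) := match fintype.split i with inl a => x1 a | inr b => x2 b end.
pose P' := mpoly.comp_mpoly [tuple mpoly.mpolyX K (mpoly.mnm1 (lshift n2 i)) | i < n1] P.
pose Q' := mpoly.comp_mpoly [tuple mpoly.mpolyX K (mpoly.mnm1 (rshift n1 i)) | i < n2] Q.
exists (n1 + n2)%N, x, P', Q'; split.
- by move=> i; rewrite /x; case: fintype.splitP.
- rewrite -meval_at0 mpoly.comp_mpoly_meval -[RHS]P0 -meval_at0; apply: mpoly.meval_eq => i.
  by rewrite tnth_mktuple mpoly.mevalXU.
- rewrite -meval_at0 mpoly.comp_mpoly_meval -[RHS]Q0 -meval_at0; apply: mpoly.meval_eq => i.
  by rewrite tnth_mktuple mpoly.mevalXU.
- apply/funext => t; rewrite /poly_eval mpoly.comp_mpoly_meval; apply: mpoly.meval_eq => i.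
  by rewrite tnth_mktuple mpoly.mevalXU /x (unsplitK (inl i)).
- apply/funext => t; rewrite /poly_eval mpoly.comp_mpoly_meval; apply: mpoly.meval_eq => i.
  by rewrite tnth_mktuple mpoly.mevalXU /x (unsplitK (inr i)).
Qed.

Lemma generated_algebraD X f g :
  generated_algebra X f -> generated_algebra X g -> generated_algebra X (f \+ g).
Proof.
move=> hf hg; have [n [x [P [Q [Xx P0 Q0 -> ->]]]]] := generated_algebra_join hf hg.
exists n, x, (P + Q); split=> //; first by rewrite mpoly.mcoeffD P0 Q0 addr0.
by apply/funext => t; rewrite /poly_eval mpoly.mevalD.
Qed.

Lemma generated_algebraM X f g :
  generated_algebra X f -> generated_algebra X g -> generated_algebra X (f \* g).
Proof.
move=> hf hg; have [n [x [P [Q [Xx P0 Q0 -> ->]]]]] := generated_algebra_join hf hg.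
exists n, x, (P * Q); split=> //.
  by rewrite -meval_at0 mpoly.mevalM meval_at0 P0 mul0r.
by apply/funext => t; rewrite /poly_eval mpoly.mevalM.
Qed.

End GeneratedAlgebra.

Section Generic.
Context {R : realType}.
Local Notation C := (cplx R).
Implicit Types (f : C0 R -> C) (Rj : nat -> @dpoly R).

Lemma dpoly_size (p : @dpoly R) :
  exists N, dbounded p N /\ forall k, cabs (dcoef p k) <= N%:R.
Proof.
have [N pN] := dbounded_exists p.
pose S := \sum_(k < N) cabs (dcoef p k).
have S0 : 0 <= S by apply: sumr_ge0 => k _; exact: cabs_ge0.
pose M := maxn N (Num.truncn S).+1; exists M; split.
  by apply: dbounded_leq pN; exact: leq_maxl.
have SM : S <= M%:R.
  by apply: le_trans (ltW (truncnS_gt S)) _; rewrite ler_nat leq_maxr.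
move=> k; have [kN|/pN ->] := ltnP k N; last by rewrite cabs0.
apply: le_trans SM; rewrite /S (bigD1 (Ordinal kN)) //= lerDl sumr_ge0 // => i _.
exact: cabs_ge0.
Qed.

Lemma coefficients_size Rj d : exists N, forall j, (j <= d)%N ->
  dbounded (Rj j) N /\ forall k, cabs (dcoef (Rj j) k) <= N%:R.
Proof.
elim: d => [|d [N hN]].
  by have [N hN] := dpoly_size (Rj 0%N); exists N => j; rewrite leqn0 => /eqP ->.
have [M [hM1 hM2]] := dpoly_size (Rj d.+1); exists (maxn N M) => j.
rewrite leq_eqVlt => /orP[/eqP ->|jd].
  split; first by apply: dbounded_leq hM1; exact: leq_maxr.
  by move=> k; apply: le_trans (hM2 k) _; rewrite ler_nat leq_maxr.
have [h1 h2] := hN j jd; split; first by apply: dbounded_leq h1; exact: leq_maxl.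
by move=> k; apply: le_trans (h2 k) _; rewrite ler_nat leq_maxl.
Qed.

Lemma abs_sum_le_sigma (a : nat -> C) (sigma tau : R) N : sigma <= tau ->
  abs_sum a tau N <= abs_sum a sigma N.
Proof.
move=> st; apply: ler_sum => k _; rewrite ler_wpM2l ?cabs_ge0 //.
by rewrite ler_expR lerN2 ler_wpM2r // ln_ge0 // ler1n.
Qed.

Lemma dpoly_neq0_coef (p : @dpoly R) : p <> 0 -> exists k, dcoef p k != 0.
Proof.
move=> p0; apply: contrapT => /forallNP h; apply: p0; apply: dpolyP => k.
by rewrite dcoef0; apply/eqP; apply: contrapT => /negP; exact: h.
Qed.

(** A fixed combination belongs to [family n] for all large [n]. *)
Lemma good_unbounded f Rj d a : (forall n, good n f) -> (0 < d)%N -> Rj d <> 0 ->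
  has_coefs (pcomb Rj d f) a ->
  forall sigma B : R, 0 <= sigma -> sigma < 1 / 2 -> exists N, B < abs_sum a sigma N.
Proof.
move=> hf d0 /dpoly_neq0_coef[k1 hk1] ha sigma B s0 s2.
have [N0 hN0] := coefficients_size Rj d.
have c0 : 0 < cabs (dcoef (Rj d) k1) by rewrite cabs_gt0.
have [N1 hN1] := inv_succ_small c0.
have s3 : 0 < 1 / 2 - sigma by rewrite subr_gt0.
have [N2 hN2] := inv_succ_small s3.
pose n := maxn (maxn N0 N1) (maxn N2 (maxn d (Num.truncn B).+1)).
have n0 : (N0 <= n)%N by rewrite !leq_max leqnn.
have n1 : (N1 <= n)%N by rewrite !leq_max leqnn orbT.
have n2 : (N2 <= n)%N by rewrite !leq_max leqnn !orbT.
have nd : (d <= n)%N by rewrite !leq_max leqnn !orbT.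
have nB : ((Num.truncn B).+1 <= n)%N by rewrite !leq_max leqnn !orbT.
have fam : family n d Rj.
  split=> [|j jd|j k jd|]; first by rewrite d0.
  - by apply: dbounded_leq n0 _; have [] := hN0 j jd.
  - have [_ /(_ k) h] := hN0 j jd; apply: le_trans h _; by rewrite ler_nat.
  - by exists k1; exact: hN1.
have [N hN] := hf n d Rj fam a ha; exists N.
have sn : sigma <= sig n.
  rewrite /sig; have := hN2 n n2.
  have : (2 * n.+1%:R)^-1 <= n.+1%:R^-1 :> R.
    by rewrite lef_pV2 ?posrE ?mulr_gt0 ?ltr0n // ler_peMl // ler1n.
  by move: (n.+1%:R^-1) ((2 * n.+1%:R)^-1) => x y; lra.
apply: lt_le_trans (abs_sum_le_sigma a N sn); apply: lt_le_trans hN.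
by apply: lt_le_trans (truncnS_gt B) _; rewrite ler_nat.
Qed.

Lemma pcomb_recr Rj d f s : Rj d.+1 = 0 -> pcomb Rj d.+1 f s = pcomb Rj d f s.
Proof. by move=> Rd; rewrite /pcomb big_ord_recr /= Rd rmorph0 mul0r addr0. Qed.

Lemma calM_pcomb f Rj d : approximable f -> (forall n, good n f) -> (0 < d)%N ->
  Rj d <> 0 -> calM R (pcomb Rj d f).
Proof.
move=> hf gf d0 Rd; have hp := approximable_pcomb Rj d hf.
have [a ha] := has_coefs_exists hp.
split; first by apply/AC0P.
exists a; first by exists (1 / 2) => s hs; exact: has_coefs_cvg.
apply/eqP; rewrite eq_le (sigma_a_le_half hp ha) sigma_a_ge_half //.
exact: good_unbounded gf d0 Rd ha.
Qed.

Lemma calM_or_zero_pcomb f Rj d : approximable f -> (forall n, good n f) ->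
  Rj 0%N = 0 -> calM R (pcomb Rj d f) \/ pcomb Rj d f = cst 0.
Proof.
move=> hf gf R0; elim: d => [|d IH].
  by right; apply/funext => s; rewrite /pcomb big_ord1 R0 rmorph0 mul0r.
have [Rd|/eqP Rd] := eqVneq (Rj d.+1) 0; last by left; exact: calM_pcomb.
have -> // : pcomb Rj d.+1 f = pcomb Rj d f.
by apply/funext => s; exact: pcomb_recr.
Qed.

Lemma deval_eq0 (p : @dpoly R) : (forall s : C0 R, deval (\val s) p = 0) -> p = 0.
Proof.
move=> hp; apply: dpolyP => k; rewrite dcoef0.
have := @dpoly_bessel R p 0 _ k.+1; rewrite expr0n /= => h.
have {}h : \sum_(i < k.+1) cabs (dcoef p i) ^+ 2 <= 0.
  by apply: h => s /C0P[t <-]; rewrite hp cabs0.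
apply/eqP; rewrite -cabs_eq0 -(sqrf_eq0 (cabs _)) eq_le sqr_ge0 andbT.
apply: le_trans h; rewrite big_ord_recr /= lerDr sumr_ge0 // => i _.
exact: sqr_ge0.
Qed.

(** If the top coefficient were not 0, the absolute sums of the coefficients of
the zero function would be unbounded. *)
Lemma pcomb_eq0 f Rj d : (forall n, good n f) ->
  (forall s, pcomb Rj d f s = 0) -> forall j, (j <= d)%N -> Rj j = 0.
Proof.
move=> gf; elim: d => [|d IH] h0.
  move=> j; rewrite leqn0 => /eqP ->; apply: deval_eq0 => s.
  by have := h0 s; rewrite /pcomb big_ord1 expr0 mulr1.
have Rd : Rj d.+1 = 0.
  apply: contrapT => Rd.
  have ha : has_coefs (pcomb Rj d.+1 f) (fun=> 0).
    move=> p M hM N; have := @has_coefs_deval R 0 p M.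
    rewrite /has_coefs => /(_ _ N) h; apply: le_trans (h _) => [|s].
      by apply: ler_sum => k _; rewrite dcoef0.
    by rewrite rmorph0 -(h0 s).
  have [N] := good_unbounded gf (ltn0Sn d) Rd ha (sigma := 0) 0 (lexx _) ltac:(by lra).
  by rewrite /abs_sum big1 ?ltxx // => k _; rewrite cabs0 mul0r.
move=> j; rewrite leq_eqVlt => /orP[/eqP -> //|]; rewrite ltnS; apply: IH => s.
by rewrite -pcomb_recr.
Qed.

(** A monomial [m] in the functions [npow (c i) * f] is [f ^+ mdeg m] times the
Dirichlet monomial of the product of the [c i ^ m i]; collecting equal degrees
gives the coefficients of [Q] as a polynomial in [f]. *)
Definition mcomb n (c : 'I_n -> nat) (Q : mpoly.mpoly n C) (j : nat) : @dpoly R :=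
  \sum_(m <- mpoly.msupp Q | mpoly.mdeg m == j)
    dmono (mpoly.mcoeff m Q) (\prod_(i < n) c i ^ m i)%N.-1.

Lemma npow_prod n (c : 'I_n -> nat) (m : mpoly.multinom n) (s : C) :
  (forall i, 0 < c i)%N ->
  npow (\prod_(i < n) c i ^ m i)%N s = \prod_(i < n) npow (c i) s ^+ m i.
Proof.
move=> c0; have npowX x k : (0 < x)%N -> npow (x ^ k) s = npow x s ^+ k.
  move=> x0; elim: k => [|k IH]; first by rewrite npow1.
  by rewrite expnS npowM ?expn_gt0 ?x0 // IH exprS.
suff [] : (0 < \prod_(i < n) c i ^ m i)%N /\
    npow (\prod_(i < n) c i ^ m i)%N s = \prod_(i < n) npow (c i) s ^+ m i by [].
elim/big_ind2: _ => [|x u y v [x0 xu] [y0 yv]|i _].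
- by rewrite npow1.
- by rewrite muln_gt0 x0 y0 npowM // xu yv.
- by rewrite expn_gt0 c0 npowX.
Qed.

Lemma poly_eval_pcomb n (c : 'I_n -> nat) (x : 'I_n -> C0 R -> C) f (Q : mpoly.mpoly n C) :
  (forall i, 0 < c i)%N -> (forall i s, x i s = npow (c i) (\val s) * f s) ->
  poly_eval Q x = pcomb (mcomb c Q) (mpoly.msize Q) f.
Proof.
move=> c0 xE; apply/funext => s; rewrite /poly_eval mpoly.mevalE /pcomb.
transitivity (\sum_(j < (mpoly.msize Q).+1) \sum_(m <- mpoly.msupp Q | mpoly.mdeg m == j)
   mpoly.mcoeff m Q * npow (\prod_(i < n) c i ^ m i)%N (\val s) * f s ^+ j); last first.
  apply: eq_bigr => j _; rewrite rmorph_sum /= mulr_suml; apply: eq_bigr => m _.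
  by rewrite deval_mono prednK // prodn_gt0 // => i; rewrite expn_gt0 c0.
under [RHS]eq_bigr do rewrite big_mkcond /=.
rewrite exchange_big /= big_seq [RHS]big_seq; apply: eq_bigr => m mQ.
have md : (mpoly.mdeg m < (mpoly.msize Q).+1)%N by rewrite ltnS ltnW // mpoly.msize_mdeg_lt.
rewrite (bigD1 (Ordinal md)) //= eqxx [X in _ = _ + X]big1 ?addr0 => [|j jm]; last first.
  by rewrite ifN // eq_sym.
rewrite -mulrA; congr (_ * _); rewrite npow_prod // mpoly.mdegE -prodrXr -big_split /=.
by apply: eq_bigr => i _; rewrite xE exprMn.
Qed.

Lemma mcomb_deg0 n (c : 'I_n -> nat) (Q : mpoly.mpoly n C) :
  mpoly.mcoeff mpoly.mnm0 Q = 0 -> mcomb c Q 0 = 0.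
Proof.
move=> Q0; rewrite /mcomb big_seq_cond big1 // => m /andP[mQ]; rewrite mpoly.mdeg_eq0 => /eqP e.
by move: mQ; rewrite mpoly.mcoeff_msupp e Q0 eqxx.
Qed.

Lemma mcomb_eq0 n (c : 'I_n -> nat) (Q : mpoly.mpoly n C) :
  (forall i, 0 < c i)%N ->
  (forall m m' : mpoly.multinom n, mpoly.mdeg m = mpoly.mdeg m' ->
     (\prod_(i < n) c i ^ m i = \prod_(i < n) c i ^ m' i)%N -> m = m') ->
  (forall j, (j <= mpoly.msize Q)%N -> mcomb c Q j = 0) -> Q = 0.
Proof.
move=> c0 cI Qj; apply/mpoly.mpolyP => m; rewrite mpoly.mcoeff0.
apply/eqP; apply: contraT; rewrite -mpoly.mcoeff_msupp => mQ.
have := congr1 (fun p => dcoef p (\prod_(i < n) c i ^ m i)%N.-1)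
  (Qj (mpoly.mdeg m) (ltnW (mpoly.msize_mdeg_lt mQ))).
rewrite dcoef0 dcoef_sum big_mkcond /= (bigD1_seq _ mQ (mpoly.msupp_uniq Q)) /= eqxx.
rewrite dcoef_mono eqxx mulr1n big1 ?addr0 => [/eqP|m' m'm].
  by rewrite -[_ == 0]negbK -mpoly.mcoeff_msupp mQ.
case: ifP => // /eqP md; rewrite dcoef_mono; case: eqVneq => // e.
have P0 (u : mpoly.multinom n) : (0 < \prod_(i < n) c i ^ u i)%N.
  by rewrite prodn_gt0 // => i; rewrite expn_gt0 c0.
have := cI m' m md; rewrite -(prednK (P0 m')) -(prednK (P0 m)) e => /(_ erefl) mm.
by rewrite mm eqxx in m'm.
Qed.

End Generic.

(** * Free generators *)

Section AlgebraicIndependence.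
Context {R : realType}.
Local Notation C := (cplx R).

Lemma prime_sequence : exists P : nat -> nat, injective P /\ forall i, prime (P i).
Proof.
pose P := fix P i := if i is i'.+1 then s2val (prime_above (P i')) else 2%N.
have P_S i : (P i < P i.+1)%N by rewrite /=; case: prime_above.
have P_lt i j : (i < j)%N -> (P i < P j)%N.
  elim: j => // j IH; rewrite ltnS leq_eqVlt => /orP[/eqP ->|/IH ij]; first exact: P_S.
  exact: ltn_trans ij (P_S j).
exists P; split=> [i j Pij|[|i] //]; last by rewrite /=; case: prime_above.
case: (ltngtP i j) => // /P_lt; by rewrite Pij ltnn.
Qed.

Lemma prod_primes_inj n (c : 'I_n -> nat) (m m' : mpoly.multinom n) :
  injective c -> (forall i, prime (c i)) ->
  (\prod_(i < n) c i ^ m i = \prod_(i < n) c i ^ m' i)%N -> m = m'.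
Proof.
move=> cI cP e.
have lognE (u : mpoly.multinom n) k : logn (c k) (\prod_(i < n) c i ^ u i)%N = u k.
  have [_ ->] : (0 < \prod_(i < n) c i ^ u i)%N /\
      logn (c k) (\prod_(i < n) c i ^ u i)%N = (\sum_(i < n) u i * (c k == c i))%N.
    elim/big_ind2: _ => [|x a y b [x0 xa] [y0 yb]|i _].
    - by rewrite logn1.
    - by rewrite muln_gt0 x0 y0 lognM // xa yb.
    - by rewrite expn_gt0 prime_gt0 // lognX logn_prime.
  rewrite (bigD1 k) //= eqxx muln1 big1 ?addn0 // => i ik.
  by rewrite (inj_eq cI) eq_sym (negPf ik) muln0.
by apply/mpoly.mnmP => k; rewrite -(lognE m) e lognE.
Qed.

Variable f : C0 R -> C.
Hypotheses (hf : approximable f) (gf : forall n, good n f).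

(** With [A] the set of primes these are the generators of the free algebra; with
[A] reduced to 1 there is only [f] itself. *)
Definition twists (A : set nat) : set (C0 R -> C) :=
  [set (fun s => npow c (\val s) * f s) | c in A].

Lemma twists_choice (A : set nat) n (x : 'I_n -> C0 R -> C) :
  (forall i, twists A (x i)) ->
  exists c : 'I_n -> nat, (forall i, A (c i)) /\
    forall i s, x i s = npow (c i) (\val s) * f s.
Proof.
move=> Ax; have /choice[c hc] i : exists k, A k /\ forall s, x i s = npow k (\val s) * f s.
  by have [k Ak <-] := Ax i; exists k.
by exists c; split=> i; have [] := hc i.
Qed.

Lemma generated_twists_sub_calM (A : set nat) : (forall c, A c -> (0 < c)%N) ->
  generated_algebra (twists A) `<=` (calM R : set (C0 R -> C)) `|` [set cst 0].
Proof.
move=> A0 _ [n [x [Q [/twists_choice[c [Ac xE]] Q0 ->]]]].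
rewrite (poly_eval_pcomb _ (fun i => A0 _ (Ac i)) xE).
have [] := calM_or_zero_pcomb (mpoly.msize Q) hf gf (mcomb_deg0 c Q0); by [left|right].
Qed.

(** The condition on [A] says that distinct monomials of the same degree in the
generators involve distinct Dirichlet monomials, which then cannot cancel. *)
Lemma twists_algebraically_independent (A : set nat) :
  (forall c, A c -> (0 < c)%N) ->
  (forall n (c : 'I_n -> nat), injective c -> (forall i, A (c i)) ->
     forall m m' : mpoly.multinom n, mpoly.mdeg m = mpoly.mdeg m' ->
     (\prod_(i < n) c i ^ m i = \prod_(i < n) c i ^ m' i)%N -> m = m') ->
  algebraically_independent (twists A).
Proof.
move=> A0 AI n x xI /twists_choice[c [Ac xE]] Q.
rewrite (poly_eval_pcomb _ (fun i => A0 _ (Ac i)) xE) => Qx.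
have cI : injective c.
  by move=> i j cij; apply: xI; apply/funext => s; rewrite !xE cij.
apply: (mcomb_eq0 (fun i => A0 _ (Ac i)) (AI n c cI Ac)).
by apply: pcomb_eq0 gf _ => s; rewrite Qx.
Qed.

Lemma twists_inj c c' : (0 < c)%N -> (0 < c')%N ->
  (fun s : C0 R => npow c (\val s) * f s) = (fun s => npow c' (\val s) * f s) -> c = c'.
Proof.
move=> c0 c'0 e.
pose Rj j : @dpoly R := if j == 1%N then dX c - dX c' else 0.
have R0 : dX c - dX c' = 0 :> @dpoly R.
  apply: (@pcomb_eq0 R f Rj 1 gf _ 1%N (leqnn _)) => s.
  rewrite /pcomb big_ord_recr big_ord1 /= rmorph0 mul0r add0r expr1 rmorphB /=.
  by rewrite !deval_dX // mulrBl (congr1 (fun g => g s) e) subrr.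
have := congr1 (fun p => dcoef p c.-1) R0.
rewrite dcoefB !dcoef_mono eqxx dcoef0; case: eqVneq => [/eqP|_].
  by rewrite -eqSS !prednK // => /eqP.
by rewrite mulr1n mulr0n subr0 => /eqP; rewrite oner_eq0.
Qed.

End AlgebraicIndependence.

Theorem theorem1p3 (R : realType) :
  strongly_algebrable (AC0 R : set (C0 R -> cplx R)) [set: nat] (calM R) /\
  exists G : set (AC0 R), [/\ dense G, Gdelta G &
    forall D : AC0 R, G D ->
      generates_free_algebra (\val D : C0 R -> cplx R) /\
      generated_algebra [set (\val D : C0 R -> cplx R)]
        `<=` calM R `|` [set cst 0]].
Proof.
split.
  have [D [_ /generic_good gD]] : [set: AC0 R] `&` generic !=set0.
    apply: generic_dense; last exact: openT.
    have [D _] := fun_of_surj (approximable_deval (0 : @dpoly R)).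
    by exists D.
  have hD := approximable_fun_of D; set f := fun_of D in gD hD.
  have [P [PI Pp]] := prime_sequence.
  pose A : set nat := range P.
  have A0 c : A c -> (0 < c)%N by move=> [i _ <-]; exact: prime_gt0.
  exists (generated_algebra (twists f A)); split.
  - split.
    + move=> _ [n [x [Q [/twists_choice[c [Ac xE]] Q0 ->]]]].
      rewrite (poly_eval_pcomb _ (fun i => A0 _ (Ac i)) xE).
      by apply/AC0P; exact: approximable_pcomb.
    + exact: generated_algebra0.
    + move=> g h; exact: generated_algebraD.
    + move=> g h; exact: generated_algebraM.
    + move=> c g; exact: generated_algebraZ.
  - exists (twists f A); split=> //.
    + have -> : twists f A = range (fun i (s : C0 R) => npow (P i) (\val s) * f s).
        by rewrite /twists /A image_comp.
      apply: inj_card_eq => i j _ _.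
      by move/(twists_inj gD (prime_gt0 (Pp i)) (prime_gt0 (Pp j))); exact: PI.
    + apply: twists_algebraically_independent => // n c cI Ac m m' _.
      by apply: prod_primes_inj => // i; have [k _ <-] := Ac i.
  - exact: generated_twists_sub_calM.
exists generic; split; [exact: generic_dense|exact: generic_Gdelta|].
move=> D /generic_good gD; have hD := approximable_fun_of D.
rewrite /generates_free_algebra.
have -> : [set (\val D : C0 R -> cplx R)] = twists (fun_of D) [set 1%N].
  rewrite /twists image_set1; congr [set _]; apply/funext => s.
  by rewrite npow1 mul1r.
have A0 c : [set 1%N] c -> (0 < c)%N by move=> ->.
split; last exact: generated_twists_sub_calM.
apply: twists_algebraically_independent => // n c cI c1 m m' mm' _.
apply/mpoly.mnmP => i; move: mm'; rewrite !mpoly.mdegE.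
(* an injective constant family has at most one member *)
have only j : j = i by apply: cI; rewrite (c1 j) (c1 i).
have E (u : mpoly.multinom n) : (\sum_j u j)%N = u i.
  by rewrite (bigD1 i) //= big1 ?addn0 // => j; rewrite (only j) eqxx.
by rewrite !E.
Qed.
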